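(* Assume Conditions (C1)–(C4) below hold. Let $D_1,D_2>0$ be constants, let $$\lambda=C_x\sqrt{\frac Kn}+2C_x\sqrt{\frac{D_2K\log p}{n}},$$ and let $\hat{\bm\beta}$ be a minimizer of $L_\lambda$. There is a positive constant $C^*$ (not depending on $n,p,s$) such that, with $\delta^*=8C^*\sqrt{\frac{s+1}{n}}\left[4D_1\sqrt{\log p}+\sqrt{2K}\right]$, with probability at least $1-16p^{1-D_1}-2p^{1-D_2}$, $$\|\hat{\bm\beta}-\bm\beta^*\|_2\le\frac{3}{c_1\tilde b}\left[\max\left(\delta^*,\,K\sqrt{\frac{8\tilde B}{n}}\right)+c_2\lambda\sqrt s\right],$$ provided this upper bound is smaller than $\tilde d$.
   Context: Setting: $(y_i,\bm x_i)$, $i=1,\dots,n$, i.i.d., $y_i\in\mathbb{R}$, $\bm x_i=(1,x_{i1},\dots,x_{ip})^\top\in\mathbb{R}^{p+1}$ (index $j=0$ is the intercept), $p\ge2$. Quantile levels $0<\tau_1<\dots<\tau_K<1$; check loss $\rho_\tau(u)=u(\tau-I(u<0))$. Model: for each $k$, $y_i=\bm x_i^\top\bm\beta_k^*+\epsilon_i^k$ with $P(\epsilon_i^k<0\mid\bm x_i)=\tau_k$. Stacked vectors $\bm\beta=(\bm\beta_1^\top,\dots,\bm\beta_K^\top)^\top\in\mathbb{R}^{K(p+1)}$; for $j\in\{0,\dots,p\}$, $\bm\beta^j=(\beta_{1j},\dots,\beta_{Kj})^\top$; for $\bm\Delta\in\mathbb{R}^{K(p+1)}$, $\bm\Delta_k\in\mathbb{R}^{p+1}$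 is its $k$-th quantile block and $\bm\Delta^j\in\mathbb{R}^K$ its $j$-th predictor group. Estimator: $\hat{\bm\beta}$ minimizes $L_\lambda(\bm\beta)=\frac1n\sum_{k=1}^K\sum_{i=1}^n\rho_{\tau_k}(y_i-\bm x_i^\top\bm\beta_k)+\lambda\sum_{j=1}^p\|\bm\beta^j\|_2$. Active set $\mathcal S=\{j\in\{1,\dots,p\}:\|\bm\beta^{*j}\|_2\ne0\}$, $s=|\mathcal S|$, $\bar{\mathcal S}=\mathcal S\cup\{0\}$. Cone $\mathcal C=\{\bm\Delta:\sum_{j\in\bar{\mathcal S}^c}\|\bm\Delta^j\|_2\le3\sum_{j\in\bar{\mathcal S}}\|\bm\Delta^j\|_2\}$. Conditions: (C1) Let $f_i,f_i'$ be the conditional density of $y_i$ given $\bm x_i$ and its derivative; there are constants $c_1,c_2>0$ with $f_i(\bm x_i^\top\bm\beta_k^* )\ge c_1$ for all $i,k$ and $\sup_t|f_i'(t)|\le c_2$ for all $i$. (C2) There is $C_x>0$ with $\max_{i,j}|x_{ij}|<C_x$. (C3) There are positive constants $\tilde b\le b_k$ and $B_k\le\tilde B$ ($k=1,\dots,K$) such that for every $\bm\Delta\in\mathcal C$ and every $k$, $b_k\|\bm\Delta_k\|_2^2\le\bm\Delta_k^\top E[\bm x_i\bm x_i^\top]\bm\Delta_k\le B_k\|\bm\Delta_k\|_2^2$. (C4) There is $\tilde d>0$ such that for every $k$, $d_k:=\frac{c_1}{c_2\sqrt{B_k}}\inf_{\bm\Delta\in\mathcal C,\ \bm\Delta_k\ne0}\frac{E[(\bm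 x_i^\top\bm\Delta_k)^2]^{3/2}}{E[|\bm x_i^\top\bm\Delta_k|^3]}\ge\tilde d$. *)

(* Defs.v *)
From HB Require Import structures.
From mathcomp Require Import all_boot all_order all_algebra.
From mathcomp Require Import all_classical all_reals all_analysis.
Set Implicit Arguments. Unset Strict Implicit. Unset Printing Implicit Defensive.
Import Order.TTheory GRing.Theory Num.Theory.
Import numFieldNormedType.Exports.
Local Open Scope classical_set_scope.
Local Open Scope ring_scope.

Section Defs.
Variable R : realType.

Definition check_loss (tau u : R) : R := u * (tau - (if u < 0 then 1 else 0)).

(* coefficients beta in R^{K(p+1)} are stored as K x (p+1) matrices:
   row k = beta_k (quantile block), column j = beta^j (predictor group) *)
Definition group_norm K q (D : 'M[R]_(K, q)) (j : 'I_q) : R :=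
  Num.sqrt (\sum_(k < K) D k j ^+ 2).
Definition block_norm K q (D : 'M[R]_(K, q)) (k : 'I_K) : R :=
  Num.sqrt (\sum_(j < q) D k j ^+ 2).
Definition l2norm K q (D : 'M[R]_(K, q)) : R :=
  Num.sqrt (\sum_(k < K) \sum_(j < q) D k j ^+ 2).

Definition xdot q (x : 'I_q -> R) K (D : 'M[R]_(K, q)) (k : 'I_K) : R :=
  \sum_(j < q) x j * D k j.

(* S-bar = S u {0}: index 0 (intercept) together with active predictors *)
Definition Sbar K p (b : 'M[R]_(K, p.+1)) : {set 'I_p.+1} :=
  [set j | (j == ord0) || (group_norm b j != 0)].
Definition Sact K p (b : 'M[R]_(K, p.+1)) : {set 'I_p.+1} :=
  [set j | (j != ord0) && (group_norm b j != 0)].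

Definition cone K p (b : 'M[R]_(K, p.+1)) : set 'M[R]_(K, p.+1) :=
  [set D | \sum_(j in ~: Sbar b) group_norm D j
           <= 3 * \sum_(j in Sbar b) group_norm D j].

Definition Lobj n K p (tau : 'I_K -> R) (lam : R)
  (y : 'I_n -> R) (x : 'I_n -> 'I_p.+1 -> R) (b : 'M[R]_(K, p.+1)) : R :=
  n%:R^-1 * (\sum_(k < K) \sum_(i < n) check_loss (tau k) (y i - xdot (x i) b k))
  + lam * \sum_(j < p.+1 | j != ord0) group_norm b j.

Definition is_minimizer n K p tau lam y x (b : 'M[R]_(K, p.+1)) : Prop :=
  forall b' : 'M[R]_(K, p.+1), @Lobj n K p tau lam y x b <= Lobj tau lam y x b'.

Section Prob.
Context d (T : measurableType d) (P : probability T R).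

Definition gen_sigma m (Z : 'I_m -> T -> R) : set (set T) :=
  <<s [set A | exists j B, measurable B /\ A = Z j @^-1` B] >>.

Definition sigmaX n p (X : 'I_n -> T -> 'I_p.+1 -> R) (i : 'I_n) :=
  gen_sigma (fun j w => X i w j).

Definition sigmaYX n p (y : 'I_n -> T -> R) (X : 'I_n -> T -> 'I_p.+1 -> R)
  (i : 'I_n) :=
  gen_sigma (fun j : 'I_p.+2 =>
    match unlift ord0 j with None => y i | Some j' => fun w => X i w j' end).

Definition mutually_independent n (S : 'I_n -> set (set T)) : Prop :=
  forall A : 'I_n -> set T, (forall i, S i (A i)) ->
    P (\bigcap_(i in [set: 'I_n]) A i) = (\prod_(i < n) fine (P (A i)))%:E.

(* (y_i, x_i) identically distributed: equal joint laws on all measurable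
   rectangles of R^{p+2} (which determine the Borel law) *)
Definition identically_distributed n p (y : 'I_n -> T -> R)
  (X : 'I_n -> T -> 'I_p.+1 -> R) : Prop :=
  forall i i' (B0 : set R) (B : 'I_p.+1 -> set R),
    measurable B0 -> (forall j, measurable (B j)) ->
    P [set w | B0 (y i w) /\ forall j, B j (X i w j)] =
    P [set w | B0 (y i' w) /\ forall j, B j (X i' w j)].

Definition Ex (Z : T -> R) : R := Rintegral P setT Z.

Definition quad_form p (x : T -> 'I_p.+1 -> R) (v : 'I_p.+1 -> R) : R :=
  \sum_(j < p.+1) \sum_(l < p.+1) v j * Ex (fun w => x w j * x w l) * v l.

End Prob.
End Defs.

(* Main.v *)
(* On the event that every group of the gradient of the empirical loss at [betastar] has
   norm at most [lam / 2], every direction along which the penalized objective does not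
   increase lies in the cone.  By convexity it is then enough to show that the objective
   increases on the part of the cone of norm exactly the claimed bound.  There the expected
   loss grows quadratically: (C1) gives a quadratic minorant with a cubic error, which (C4)
   makes harmless below radius [dt].  The deviation of the empirical loss is controlled
   uniformly over an l1-ball by symmetrization, contraction and a finite net.

   Two devices replace conditioning arguments.  The number of quantile curves lying above
   the response is independent of the covariates, so the gradient can be treated with the
   covariates frozen, by an Azuma-type recursion for the norm of a random vector.  And all
   random variables are discretized to finitely many values, so that symmetrization,
   contraction and concentration are statements about finite weighted sums. *)

Require Import Defs.
From HB Require Import structures.
From mathcomp Require Import all_boot all_order all_algebra.
From mathcomp Require Import all_classical all_reals all_analysis.
From mathcomp Require Import measurable_realfun.
From mathcomp Require Import zify ring lra.
Import Order.TTheory GRing.Theory Num.Theory.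
Import numFieldNormedType.Exports.
Local Open Scope classical_set_scope.
Local Open Scope ring_scope.

Set Implicit Arguments.
Unset Strict Implicit.
Unset Printing Implicit Defensive.

(** * Sub-Gaussian bounds over finite weights *)

(** The conditional laws are known only through identities integrated over events of the covariate
    σ-algebra, so every statement given [x] must be recovered from such events. For the gradient
    this succeeds because strictly increasing levels force the quantile curves to be ordered almost
    surely: the [K] indicators then depend on a single integer, whose law involves the levels only.
    Each gradient group is thus a sum of independent centred vectors weighted by the covariates, and
    [n * lam / 2] is exactly the bound on its mean norm plus a deviation of order sqrt (D2 log p).

    The net may be arbitrarily fine because its cardinality never enters: after contraction, the
    supremum of a linear functional over an l1-ball is controlled by the 2(p+1) signed coordinates.
    The cone is what turns the Euclidean radius r into an l1 radius 4 sqrt (s+1) r for each quantile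
    block. *)

Section Exponential.
Variable R : realType.
Implicit Types x y h s : R.

(** This is tanh x <= x cleared of denominators, the form that settles the sign of a derivative in
    the next lemma. *)
Lemma expR2_le x : 0 <= x -> (1 - x) * expR (2 * x) <= 1 + x.
Proof.
move=> x0.
pose F (u : R) : R := 1 + u - (1 - u) * expR (2 * u).
pose dF (u : R) : R := 1 + expR (2 * u) - 2 * (1 - u) * expR (2 * u).
have dFE (u : R) : is_derive u 1 F (dF u).
  rewrite /F /dF; apply: is_derive_eq.
  by rewrite /GRing.scale /=; ring.
have cF : {within `[0, x], continuous F}.
  apply: continuous_subspaceT => u.
  exact/differentiable_continuous/derivable1_diffP/(@ex_derive _ _ _ _ _ _ _ (dFE u)).
have [c /[!in_itv]/= /andP[c0 _] E] := MVT_segment x0 (fun u _ => dFE u) cF.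
have: 0 <= F x - F 0.
  rewrite E subr0 mulr_ge0// /dF.
  have -> : 1 + expR (2 * c) - 2 * (1 - c) * expR (2 * c) =
    expR (2 * c) * (expR (- (2 * c)) - (1 - 2 * c)).
    by rewrite [RHS]mulrBr -expRD subrr expR0; ring.
  rewrite mulr_ge0 ?expR_ge0// subr_ge0; apply: le_trans (expR_ge1Dx _); lra.
by rewrite /F mulr0 expR0 mulr1 addr0 subr0 subrr subr0 subr_ge0.
Qed.

(** The quotient [F] of 2 cosh by the Gaussian factor decreases on the positive half-line, since its
    derivative has the sign of tanh u - u. *)
Lemma cosh_le_expR x : expR x + expR (- x) <= 2 * expR (x ^+ 2 / 2).
Proof.
wlog x0 : x / 0 <= x.
  move=> H; have [|/ltW xle0] := leP 0 x; first exact: H.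
  by have := H (- x); rewrite opprK sqrrN addrC; apply; rewrite oppr_ge0.
pose F (u : R) : R := expR (- (u ^+ 2 / 2)) * (expR u + expR (- u)).
pose dF (u : R) : R := expR (- (u ^+ 2 / 2)) * ((expR u - expR (- u)) - u * (expR u + expR (- u))).
have dFE (u : R) : is_derive u 1 F (dF u).
  rewrite /F /dF; apply: is_derive_eq.
  by rewrite /GRing.scale /=; field.
have cF : {within `[0, x], continuous F}.
  apply: continuous_subspaceT => u.
  exact/differentiable_continuous/derivable1_diffP/(@ex_derive _ _ _ _ _ _ _ (dFE u)).
have [c /[!in_itv]/= /andP[c0 _] E] := MVT_segment x0 (fun u _ => dFE u) cF.
have: F x - F 0 <= 0.
  rewrite E subr0; apply: mulr_le0_ge0 => //; rewrite /dF.
  rewrite pmulr_rle0 ?expR_gt0//.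
  have -> : expR c - expR (- c) - c * (expR c + expR (- c)) =
     expR (- c) * ((1 - c) * expR (2 * c) - (1 + c)).
    have -> : expR c = expR (- c) * expR (2 * c) by rewrite -expRD; congr expR; ring.
    ring.
  by rewrite pmulr_rle0 ?expR_gt0// subr_le0 expR2_le.
rewrite /F expr0n mul0r !oppr0 !expR0 mul1r subr_le0 -[1 + 1]/(2%:R) => H.
have -> : expR x + expR (- x) = expR (x ^+ 2 / 2) * F x.
  by rewrite /F mulrA -expRD subrr expR0 mul1r.
by rewrite mulrC ler_pM2r ?expR_gt0.
Qed.

End Exponential.

Section FiniteWeights.
Variables (R : realType) (V : finType) (mu : V -> R).
Hypothesis mu_ge0 : forall v, 0 <= mu v.
Hypothesis mu_sum : \sum_v mu v = 1.

Lemma wsum_le (f g : V -> R) : (forall v, f v <= g v) ->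
  \sum_v mu v * f v <= \sum_v mu v * g v.
Proof. by move=> fg; apply: ler_sum => v _; rewrite ler_wpM2l. Qed.

Lemma wsum_cst (c : R) : \sum_v mu v * c = c.
Proof. by rewrite -mulr_suml mu_sum mul1r. Qed.

(** The tangent to the exponential at the mean [m] lies below it and averages to exactly
    [expR m]. *)
Lemma expR_jensen (z : V -> R) :
  expR (\sum_v mu v * z v) <= \sum_v mu v * expR (z v).
Proof.
set m := \sum_v _.
have -> : expR m = \sum_v mu v * (expR m * (1 + (z v - m))).
  under eq_bigr do rewrite mulrCA.
  rewrite -mulr_sumr -[LHS]mulr1; congr (_ * _).
  under eq_bigr do rewrite mulrDr mulrBr.
  by rewrite big_split /= sumrB wsum_cst wsum_cst -/m subrr addr0.
apply: wsum_le => v.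
have -> : expR (z v) = expR m * expR (z v - m) by rewrite -expRD addrC subrK.
by rewrite ler_pM2l ?expR_gt0// expR_ge1Dx.
Qed.

(* By convexity the left-hand side is at most [M (s * c)], where [M] is the moment
   generating function of a centred two-point law.  The constant comes from
   [1 <= M (- h)] and [M h * M (- h) <= cosh (h / 2) ^ 2 <= expR (h ^ 2 / 4)]. *)
Lemma hoeffding_mgf (Z : V -> R) (c s : R) :
  (forall v v', Z v - Z v' <= c) ->
  \sum_v mu v * expR (s * (Z v - \sum_v' mu v' * Z v')) <= expR (s ^+ 2 * c ^+ 2 / 4).
Proof.
move=> Zc; pose m := \sum_v mu v * Z v; rewrite -/m.
have [v1 _|V0] := pickP V; last first.
  by move: mu_sum; rewrite big_pred0// => /esym/eqP; rewrite oner_eq0.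
have [v0 _ minZ] := arg_minP Z (isT : predT v1).
have c0 : 0 <= c by rewrite -(subrr (Z v1)).
have Zlo v : 0 <= Z v - Z v0 by rewrite subr_ge0; exact: minZ.
have mlo : Z v0 <= m.
  by rewrite -[leLHS]wsum_cst /m; apply: wsum_le => v; exact: minZ.
have mhi : m <= Z v0 + c.
  rewrite -[leRHS]wsum_cst /m; apply: wsum_le => v.
  by have := Zc v v0; lra.
(* A zero range is set apart because [th] and [t] divide by [c]. *)
move: c0; rewrite le_eqVlt => /orP[/eqP cE|c0].
  rewrite -cE expr0n mulr0 mul0r expR0 -[leRHS]mu_sum.
  apply: ler_sum => v _.
  have -> : Z v - m = 0.
    by move: (Zlo v) (Zc v v0) mlo mhi; rewrite -cE; lra.
  by rewrite mulr0 expR0 mulr1.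
pose th := (m - Z v0) / c.
have th01 : 0 <= th <= 1.
  apply/andP; split; first by apply: divr_ge0; [lra | exact: ltW].
  by rewrite ler_pdivrMr// mul1r; lra.
pose M (h : R) := (1 - th) * expR (- (th * h)) + th * expR ((1 - th) * h).
pose h := s * c.
have Mle : \sum_v mu v * expR (s * (Z v - m)) <= M h.
  pose t v := (Z v - Z v0) / c.
  have t01 v : 0 <= t v <= 1.
    apply/andP; split; first by apply: divr_ge0; [exact: Zlo | exact: ltW].
    by rewrite ler_pdivrMr// mul1r.
  have -> : M h = \sum_v mu v * ((1 - t v) * expR (- (th * h)) + t v * expR ((1 - th) * h)).
    have tE : \sum_v mu v * t v = th.
      have -> : th = (\sum_v mu v * (Z v - Z v0)) / c.
        by under eq_bigr do rewrite mulrBr; rewrite sumrB wsum_cst.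
      by rewrite mulr_suml; apply: eq_bigr => v _; rewrite mulrA.
    rewrite /M; move: (expR (- _)) (expR ((1 - th) * h)) => x y.
    rewrite (eq_bigr (fun v => mu v * x + mu v * t v * (y - x))); last first.
      by move=> v _; ring.
    by rewrite big_split/= -mulr_suml mu_sum -[X in _ = _ + X]mulr_suml tE; ring.
  apply: wsum_le => v.
  set x := s * _.
  have xE : x = (1 - t v) * (- (th * h)) + t v * ((1 - th) * h).
    by rewrite /x /t /th /h; field; rewrite gt_eqF.
  (* Convexity along a chord: the tangent inequalities at [x], weighted by [1 - t v] and [t v], add
     up because [x] is the corresponding barycentre of the two endpoints. *)
  have tang y : expR x * (1 + (y - x)) <= expR y.
    have -> : expR y = expR x * expR (y - x) by rewrite -expRD addrC subrK.
    by rewrite ler_pM2l ?expR_gt0// expR_ge1Dx.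
  have /andP[t0 t1] := t01 v.
  have -> : expR x = (1 - t v) * (expR x * (1 + (- (th * h) - x)))
                     + t v * (expR x * (1 + ((1 - th) * h - x))).
    by move: (expR x) => E; rewrite xE; ring.
  by apply: lerD; apply: ler_wpM2l; rewrite ?subr_ge0.
apply: le_trans Mle _.
have /andP[th0 th1] := th01.
have M1 : 1 <= M (- h).
  have E1 := expR_ge1Dx (th * h); have E2 := expR_ge1Dx (- ((1 - th) * h)).
  rewrite /M !mulrN opprK.
  rewrite [leLHS](_ : 1 = (1 - th) * (1 + th * h) + th * (1 + - ((1 - th) * h))); last by ring.
  by apply: lerD; apply: ler_wpM2l; rewrite ?subr_ge0.
have Mge0 : 0 <= M h.
  by apply: addr_ge0; apply: mulr_ge0; rewrite ?subr_ge0// expR_ge0.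
have MM : M h * M (- h) <= expR (s ^+ 2 * c ^+ 2 / 4).
  have E0 : expR (- (th * h)) * expR (th * h) = 1 by rewrite -expRD addNr expR0.
  have E1 : expR ((1 - th) * h) * expR (- ((1 - th) * h)) = 1.
    by rewrite -expRD subrr expR0.
  have E2 : expR (- (th * h)) * expR (- ((1 - th) * h)) = expR (- h).
    by rewrite -expRD; congr expR; ring.
  have E3 : expR ((1 - th) * h) * expR (th * h) = expR h.
    by rewrite -expRD; congr expR; ring.
  have -> : M h * M (- h) = (1 - th) ^+ 2 + th ^+ 2 + th * (1 - th) * (expR h + expR (- h)).
    rewrite /M !mulrN opprK -E3 -E2; move: E0 E1.
    move: (expR (- (th * h))) (expR (th * h)) (expR ((1 - th) * h)) (expR (- ((1 - th) * h))).
    move=> a a' b b' E0 E1.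
    rewrite [LHS](_ : _ = (1 - th) ^+ 2 * (a * a') + th ^+ 2 * (b * b')
      + th * (1 - th) * (b * a' + a * b')); last by ring.
    by rewrite E0 E1 !mulr1.
  have Eh : expR h * expR (- h) = 1 by rewrite -expRD subrr expR0.
  pose q := expR (h / 2); pose q' := expR (- (h / 2)).
  have Eq : expR h = q ^+ 2 by rewrite /q expr2 -expRD; congr expR; field.
  have Eq' : expR (- h) = q' ^+ 2 by rewrite /q' expr2 -expRD; congr expR; field.
  have qq : q * q' = 1 by rewrite -expRD subrr expR0.
  have q0 : 0 <= q + q' by rewrite addr_ge0 ?expR_ge0.
  apply: (@le_trans _ _ ((q + q') ^+ 2 / 4)).
    rewrite Eq Eq'.
    (* Since [q * q' = 1], a quarter of this product is the difference of the two sides. *)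
    have : 0 <= (1 - 2 * th) ^+ 2 * (q - q') ^+ 2 by rewrite mulr_ge0 ?sqr_ge0.
    by nra.
  have H : q + q' <= 2 * expR ((h / 2) ^+ 2 / 2) by apply: cosh_le_expR.
  have -> : expR (s ^+ 2 * c ^+ 2 / 4) = expR ((h / 2) ^+ 2 / 2) ^+ 2.
    by rewrite [RHS]expr2 -expRD; congr expR; rewrite /h; field.
  have e0 : 0 <= expR ((h / 2) ^+ 2 / 2) by exact: expR_ge0.
  by nra.
by apply: le_trans MM; rewrite -{1}(mulr1 (M h)) ler_wpM2l.
Qed.

End FiniteWeights.

(** * Euclidean norm of finite families *)

Section EuclideanNorm.
Variables (R : realType) (I : finType).
Implicit Types u v : I -> R.

Definition vnorm u : R := Num.sqrt (\sum_k u k ^+ 2).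

Lemma sumsq_ge0 u : 0 <= \sum_k u k ^+ 2.
Proof. by apply: sumr_ge0 => k _; exact: sqr_ge0. Qed.

Lemma vnorm_ge0 u : 0 <= vnorm u.
Proof. exact: sqrtr_ge0. Qed.

Lemma vnorm_sq u : vnorm u ^+ 2 = \sum_k u k ^+ 2.
Proof. by rewrite sqr_sqrtr ?sumsq_ge0. Qed.

(** The squared norm of |v| u - |u| v is expanded; cancelling the norms needs them positive, hence
    the two degenerate cases. *)
Lemma cauchy_schwarz u v : \sum_k u k * v k <= vnorm u * vnorm v.
Proof.
have [u0|u0] := eqVneq (vnorm u) 0.
  have uk k : u k = 0.
    apply/eqP; rewrite -sqrf_eq0; apply/eqP.
    have /eqP := vnorm_sq u; rewrite u0 expr0n /= eq_sym psumr_eq0; last first.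
      by move=> ? _; exact: sqr_ge0.
    by move=> /allP/(_ k); rewrite mem_index_enum => /(_ isT)/eqP.
  by rewrite u0 mul0r big1// => k _; rewrite uk mul0r.
have u_gt0 : 0 < vnorm u by rewrite lt_neqAle eq_sym u0 vnorm_ge0.
have H : 0 <= \sum_k (vnorm v * u k - vnorm u * v k) ^+ 2.
  exact: (sumsq_ge0 (fun k => vnorm v * u k - vnorm u * v k)).
have E : \sum_k (vnorm v * u k - vnorm u * v k) ^+ 2 =
    2 * (vnorm u * vnorm v) * (vnorm u * vnorm v - \sum_k u k * v k).
  transitivity (vnorm v ^+ 2 * (\sum_k u k ^+ 2) + vnorm u ^+ 2 * (\sum_k v k ^+ 2)
     - 2 * (vnorm u * vnorm v) * \sum_k u k * v k).
    rewrite !mulr_sumr -big_split -sumrB; apply: eq_bigr => k _ /=; ring.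
  by rewrite -!vnorm_sq; ring.
rewrite E in H.
have [v0|v0] := eqVneq (vnorm v) 0.
  have vk k : v k = 0.
    apply/eqP; rewrite -sqrf_eq0; apply/eqP.
    have /eqP := vnorm_sq v; rewrite v0 expr0n /= eq_sym psumr_eq0; last first.
      by move=> ? _; exact: sqr_ge0.
    by move=> /allP/(_ k); rewrite mem_index_enum => /(_ isT)/eqP.
  by rewrite v0 mulr0 big1// => k _; rewrite vk mulr0.
have v_gt0 : 0 < vnorm v by rewrite lt_neqAle eq_sym v0 vnorm_ge0.
by move: H; rewrite pmulr_rge0 ?subr_ge0// !mulr_gt0.
Qed.

Lemma vnormD u v : vnorm (fun k => u k + v k) <= vnorm u + vnorm v.
Proof.
rewrite -(@ler_pXn2r _ 2)// ?nnegrE ?addr_ge0 ?vnorm_ge0//.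
rewrite vnorm_sq sqrrD !vnorm_sq.
rewrite (eq_bigr (fun k => u k ^+ 2 + v k ^+ 2 + 2 * (u k * v k))); last first.
  by move=> k _; ring.
rewrite !big_split /= -mulr_sumr.
by have := cauchy_schwarz u v; lra.
Qed.

Lemma vnormZ a u : vnorm (fun k => a * u k) = `|a| * vnorm u.
Proof.
rewrite /vnorm -sqrtr_sqr -sqrtrM ?sqr_ge0// mulr_sumr.
by congr Num.sqrt; apply: eq_bigr => k _; rewrite exprMn.
Qed.

Lemma vnormN u : vnorm (fun k => - u k) = vnorm u.
Proof. by rewrite /vnorm; congr Num.sqrt; apply: eq_bigr => k _; rewrite sqrrN. Qed.

Lemma eq_vnorm u v : u =1 v -> vnorm u = vnorm v.
Proof. by move=> uv; rewrite /vnorm; congr Num.sqrt; apply: eq_bigr => k _; rewrite uv. Qed.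

Lemma vnormB u v : vnorm u - vnorm v <= vnorm (fun k => u k - v k).
Proof.
rewrite lerBlDr; apply: le_trans (vnormD _ _); rewrite (eq_vnorm (v := u))//.
by move=> k; rewrite subrK.
Qed.

Lemma vnorm_coord u k : `|u k| <= vnorm u.
Proof.
rewrite -sqrtr_sqr ler_sqrt ?sumsq_ge0// (bigD1 k)//= lerDl.
by apply: sumr_ge0 => ? _; exact: sqr_ge0.
Qed.

Lemma vnorm_le_const u c : 0 <= c -> (forall k, `|u k| <= c) ->
  vnorm u <= Num.sqrt #|I|%:R * c.
Proof.
move=> c0 uc; rewrite -(ger0_norm c0) -sqrtr_sqr -sqrtrM ?ler0n//.
apply: ler_wsqrtr; apply: (@le_trans _ _ (\sum_(k : I) c ^+ 2)).
  apply: ler_sum => k _; rewrite -real_normK ?num_real//.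
  by rewrite ler_pXn2r ?nnegrE.
by rewrite sumr_const mulr_natl.
Qed.

(** Cauchy-Schwarz against the indicator of [A]; the factors sqrt s and sqrt (s+1) of the analysis
    originate here. *)
Lemma sum_sq_le (A : {pred I}) (u : I -> R) (r : R) : 0 <= r ->
  \sum_k u k ^+ 2 <= r ^+ 2 -> \sum_(k in A) u k <= Num.sqrt #|A|%:R * r.
Proof.
move=> r0 ur.
apply: (@le_trans _ _ (\sum_k (k \in A)%:R * u k)).
  rewrite big_mkcond; apply: ler_sum => k _.
  by case: (k \in A); rewrite ?mul1r ?mul0r.
apply: (le_trans (cauchy_schwarz _ _)).
have -> : vnorm (fun k => (k \in A)%:R) = Num.sqrt #|A|%:R.
  rewrite /vnorm -sum1_card natr_sum [in RHS]big_mkcond; congr Num.sqrt.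
  by apply: eq_bigr => k _; case: (k \in A); rewrite ?expr1n ?expr0n.
apply: ler_wpM2l; first exact: sqrtr_ge0.
by rewrite -(ger0_norm r0) -sqrtr_sqr; exact: ler_wsqrtr.
Qed.

End EuclideanNorm.

(** * Expectations under finite product laws *)

Section ProductExpectation.
Variables (R : realType) (V : finType).

(** The weights may vary with the coordinate, since the cell probabilities are computed separately
    for each observation. *)
Definition EP n (mu : 'I_n -> V -> R) (F : {ffun 'I_n -> V} -> R) : R :=
  \sum_(m : {ffun 'I_n -> V}) (\prod_i mu i (m i)) * F m.

Definition fcons n (v : V) (m : {ffun 'I_n -> V}) : {ffun 'I_n.+1 -> V} :=
  [ffun i => oapp m v (unlift ord0 i)].

Lemma fcons0 n v (m : {ffun 'I_n -> V}) : fcons v m ord0 = v.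
Proof. by rewrite ffunE unlift_none. Qed.

Lemma fconsS n v (m : {ffun 'I_n -> V}) i : fcons v m (lift ord0 i) = m i.
Proof. by rewrite ffunE liftK. Qed.

(** Fubini for the first coordinate, through which the inductions on the number of factors pass. *)
Lemma EPS n (mu : 'I_n.+1 -> V -> R) F :
  EP mu F = \sum_v mu ord0 v * EP (fun i => mu (lift ord0 i)) (fun m => F (fcons v m)).
Proof.
rewrite /EP; under [RHS]eq_bigr do rewrite mulr_sumr.
rewrite pair_big /=.
pose g (m : {ffun 'I_n.+1 -> V}) := (m ord0, [ffun i => m (lift ord0 i)] : {ffun 'I_n -> V}).
rewrite (reindex (fun p : V * {ffun 'I_n -> V} => fcons p.1 p.2)) /=.
  apply: eq_bigr => -[v m] _ /=; rewrite big_ord_recl /= fcons0 mulrA.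
  by congr (_ * _ * _); apply: eq_bigr => i _; rewrite fconsS.
exists g => [[v m] _|m _]; rewrite /g /=.
  by rewrite fcons0; congr pair; apply/ffunP => i; rewrite ffunE fconsS.
apply/ffunP => i; case: (unliftP ord0 i) => [j|] ->; last by rewrite fcons0.
by rewrite fconsS ffunE.
Qed.

Lemma EP0 (mu : 'I_0 -> V -> R) F m : EP mu F = F m.
Proof.
rewrite /EP (eq_bigr (fun=> F m)).
  by rewrite sumr_const card_ffun card_ord expn0.
move=> m' _; rewrite big_ord0 mul1r; congr F.
by apply/ffunP => -[].
Qed.

Lemma eq_EP n (mu : 'I_n -> V -> R) F G : (forall m, F m = G m) -> EP mu F = EP mu G.
Proof. by move=> FG; rewrite /EP; apply: eq_bigr => m _; rewrite FG. Qed.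

Section Positive.
Variables (n : nat) (mu : 'I_n -> V -> R).
Hypothesis mu_ge0 : forall i v, 0 <= mu i v.

Lemma le_EP F G : (forall m, F m <= G m) -> EP mu F <= EP mu G.
Proof.
by move=> FG; apply: ler_sum => m _; apply: ler_wpM2l => //; exact: prodr_ge0.
Qed.

Lemma EP_ge0 F : (forall m, 0 <= F m) -> 0 <= EP mu F.
Proof.
by move=> F0; apply: sumr_ge0 => m _; apply: mulr_ge0 => //; exact: prodr_ge0.
Qed.

Lemma EPZ c F : EP mu (fun m => c * F m) = c * EP mu F.
Proof. by rewrite /EP mulr_sumr; apply: eq_bigr => m _; rewrite mulrCA. Qed.

Lemma EPD F G : EP mu (fun m => F m + G m) = EP mu F + EP mu G.
Proof. by rewrite /EP -big_split; apply: eq_bigr => m _; rewrite mulrDr. Qed.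

Lemma EP_sum (I : finType) (F : I -> {ffun 'I_n -> V} -> R) :
  EP mu (fun m => \sum_i F i m) = \sum_i EP mu (F i).
Proof.
by rewrite /EP exchange_big; apply: eq_bigr => m _; rewrite mulr_sumr.
Qed.

Lemma EP_prod (F : 'I_n -> V -> R) :
  EP mu (fun m => \prod_i F i (m i)) = \prod_i \sum_v mu i v * F i v.
Proof.
rewrite bigA_distr_bigA /=; apply: eq_bigr => m _.
by rewrite big_split.
Qed.

Hypothesis mu_sum : forall i, \sum_v mu i v = 1.

Lemma EP_cst c : EP mu (fun=> c) = c.
Proof.
rewrite /EP -mulr_suml -(@bigA_distr_bigA _ _ _ _ _ _ _ (fun i v => mu i v)).
by rewrite big1 ?mul1r.
Qed.

Lemma markov_EP (F : {ffun 'I_n -> V} -> R) (t : R) : (forall m, 0 <= F m) -> 0 < t ->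
  EP mu (fun m => (t <= F m)%R%:R) <= EP mu F / t.
Proof.
move=> F0 t0; rewrite mulrC -EPZ; apply: le_EP => m.
have [tF|_] := lerP t (F m); last by rewrite mulr_ge0 ?invr_ge0 ?F0 1?ltW.
by rewrite mulrC ler_pdivlMr// mul1r.
Qed.

End Positive.
End ProductExpectation.

(** * Norm of a weighted sum of independent centred vectors *)

Section NormConcentration.
Variables (R : realType) (V I : finType) (mu : V -> R) (psi : V -> I -> R).
Hypothesis mu_ge0 : forall v, 0 <= mu v.
Hypothesis mu_sum : \sum_v mu v = 1.
Hypothesis psi_diff : forall v v' k, `|psi v k - psi v' k| <= 1.
Hypothesis psi_mean : forall k, \sum_v mu v * psi v k = 0.
Hypothesis psi_var : forall k, \sum_v mu v * psi v k ^+ 2 <= 1 / 4.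

Let E n (F : {ffun 'I_n -> V} -> R) := EP (fun=> mu) F.
(** The starting point [u] is arbitrary so that an induction can absorb the first step into it. *)
Let walk n (a : 'I_n -> R) (u : I -> R) (m : {ffun 'I_n -> V}) : I -> R :=
  fun k => u k + \sum_i a i * psi (m i) k.
Let shift (c : R) (v : V) (u : I -> R) : I -> R := fun k => u k + c * psi v k.
Let mean_norm n (a : 'I_n -> R) u := E (fun m => vnorm (walk a u m)).

Let ES n (F : {ffun 'I_n.+1 -> V} -> R) :
  E F = \sum_v mu v * E (fun m => F (fcons v m)).
Proof. exact: EPS. Qed.

Let walk_fcons n (a : 'I_n.+1 -> R) u v m :
  walk a u (fcons v m) =1 walk (fun i => a (lift ord0 i)) (shift (a ord0) v u) m.
Proof.
move=> k; rewrite /walk /shift big_ord_recl fcons0 addrA; congr (_ + _).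
by apply: eq_bigr => i _; rewrite fconsS.
Qed.

Let mean_normS n (a : 'I_n.+1 -> R) u : mean_norm a u =
  \sum_v mu v * mean_norm (fun i => a (lift ord0 i)) (shift (a ord0) v u).
Proof.
rewrite /mean_norm ES; apply: eq_bigr => v _; congr (_ * _).
by apply: eq_EP => m; apply: eq_vnorm; exact: walk_fcons.
Qed.

Let mean_norm_lip n (a : 'I_n -> R) u u' :
  mean_norm a u - mean_norm a u' <= vnorm (fun k => u k - u' k).
Proof.
rewrite lerBlDr -[X in X + _](EP_cst (mu := fun=> mu) (n := n))// -EPD.
apply: le_EP => // m; rewrite -lerBlDr; apply: le_trans (vnormB _ _) _.
rewrite (eq_vnorm (v := fun k => u k - u' k))// => k.
by rewrite /walk; ring.
Qed.

(** [Z v] is the mean of the final norm once the first step is known. The norm is 1-Lipschitz in the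
    starting point, so [Z] oscillates by at most [sqrt #|I| * C] however long the remaining walk is;
    [hoeffding_mgf] pays for this step and the induction for the others. *)
Lemma norm_walk_mgf n (a : 'I_n -> R) C s u : (forall i, `|a i| <= C) ->
  E (fun m => expR (s * vnorm (walk a u m))) <=
  expR (s * mean_norm a u + n%:R * (s ^+ 2 * (Num.sqrt #|I|%:R * C) ^+ 2 / 4)).
Proof.
elim: n a u => [|n IH] a u aC.
  by rewrite /mean_norm /E !(EP0 _ _ (ffun0 (card_ord 0))) mul0r addr0.
set c := Num.sqrt _ * C; rewrite ES.
pose Z v := mean_norm (fun i => a (lift ord0 i)) (shift (a ord0) v u).
have Zc v v' : Z v - Z v' <= c.
  apply: (le_trans (mean_norm_lip _ _ _)).
  rewrite (eq_vnorm (v := fun k => a ord0 * (psi v k - psi v' k))); last first.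
    by move=> k; rewrite /shift; ring.
  rewrite /c; apply: vnorm_le_const; first exact: le_trans (aC ord0).
  by move=> k; rewrite normrM -[leRHS]mulr1; apply: ler_pM.
apply: (@le_trans _ _ (\sum_v mu v * expR (s * Z v + n%:R * (s ^+ 2 * c ^+ 2 / 4)))).
  apply: wsum_le => // v.
  apply: le_trans (IH _ _ _); last by move=> i; exact: aC.
  by rewrite le_eqVlt; apply/orP; left; apply/eqP; apply: eq_EP => m;
     rewrite (eq_vnorm (walk_fcons _ _ _ _)).
rewrite mean_normS -/(Z _).
set z := \sum_v mu v * Z v.
rewrite (eq_bigr (fun v => (mu v * expR (s * (Z v - z))) *
     expR (s * z + n%:R * (s ^+ 2 * c ^+ 2 / 4)))); last first.
  by move=> v _; rewrite -[RHS]mulrA -expRD; congr (_ * expR _); ring.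
rewrite -mulr_suml -[n.+1%:R]natr1 mulrDl mul1r [in leRHS]addrA [leRHS]expRD [leRHS]mulrC.
by apply: ler_wpM2r; [exact: expR_ge0 | exact: hoeffding_mgf].
Qed.

(** Centred steps make the cross terms vanish, so variances add: each step contributes at most
    [C ^+ 2 / 4] per coordinate. *)
Lemma mean_sq_walk n (a : 'I_n -> R) C u : (forall i, `|a i| <= C) ->
  E (fun m => vnorm (walk a u m) ^+ 2) <= vnorm u ^+ 2 + n%:R * (C ^+ 2 * #|I|%:R / 4).
Proof.
elim: n a u => [|n IH] a u aC.
  rewrite /E (EP0 _ _ (ffun0 (card_ord 0))) mul0r addr0 (eq_vnorm (v := u))// => k.
  by rewrite /walk big_ord0 addr0.
rewrite ES; set q := C ^+ 2 * _ / 4.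
apply: (@le_trans _ _ (\sum_v mu v * (vnorm (shift (a ord0) v u) ^+ 2 + n%:R * q))).
  apply: wsum_le => // v; apply: le_trans (IH (fun i => a (lift ord0 i)) _ _); last first.
    by move=> i; exact: aC.
  by rewrite le_eqVlt; apply/orP; left; apply/eqP; apply: eq_EP => m;
     rewrite (eq_vnorm (walk_fcons _ _ _ _)).
under eq_bigr do rewrite mulrDr.
rewrite big_split /= wsum_cst// -[n.+1%:R]natr1 mulrDl mul1r [n%:R * q + q]addrC addrA lerD2r.
under eq_bigr do rewrite vnorm_sq mulr_sumr.
rewrite exchange_big vnorm_sq /=.
have -> : q = \sum_(k : I) C ^+ 2 / 4 by rewrite sumr_const /q -mulr_natr; ring.
rewrite -big_split /=; apply: ler_sum => k _.
rewrite (eq_bigr (fun v => mu v * u k ^+ 2 + (2 * u k * a ord0) * (mu v * psi v k)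
    + a ord0 ^+ 2 * (mu v * psi v k ^+ 2))); last first.
  by move=> v _; rewrite /shift; ring.
rewrite !big_split /= -!mulr_sumr wsum_cst// psi_mean mulr0 addr0 lerD2l.
have a2 : a ord0 ^+ 2 <= C ^+ 2.
  rewrite -real_normK ?num_real// ler_pXn2r ?nnegrE//.
  exact: le_trans (aC ord0).
have := psi_var k; have := sqr_ge0 (a ord0).
set p := \sum_v _ => a0 p4.
apply: (@le_trans _ _ (a ord0 ^+ 2 * (1 / 4))); first exact: ler_wpM2l.
by lra.
Qed.

(* The mean of the norm is at most the root of its second moment,
   [C * sqrt (n * #|I|) / 2]; the deviation is handled by [norm_walk_mgf].
   The slack [delta] absorbs a later discretization of the coefficients [a]. *)
Lemma norm_walk_tail n (a : 'I_n -> R) C y : (0 < n)%N -> (0 < #|I|)%N -> 0 < C -> 0 < y ->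
  (forall i, `|a i| <= C) ->
  forall delta : R,
  EP (fun=> mu) (fun m : {ffun 'I_n -> V} =>
    (C * Num.sqrt (n%:R * #|I|%:R) / 2 + C * Num.sqrt (n%:R * #|I|%:R) * y - delta
      <= vnorm (fun k => \sum_i a i * psi (m i) k))%R%:R)
  <= expR (- y ^+ 2 + 2 * y / (C * Num.sqrt (n%:R * #|I|%:R)) * delta).
Proof.
move=> n0 I0 C0 y0 aC delta.
set q := C * Num.sqrt _.
have q0 : 0 < q by rewrite mulr_gt0// sqrtr_gt0 mulr_gt0 ?ltr0n.
have q2 : q ^+ 2 = n%:R * (C ^+ 2 * #|I|%:R).
  by rewrite exprMn sqr_sqrtr ?mulr_ge0//; ring.
(* Minimizer of [s ^+ 2 * q ^+ 2 / 4 - s * q * y], whose minimum is [- y ^+ 2]. *)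
pose s := 2 * y / q.
have s0 : 0 < s by rewrite divr_gt0// mulr_gt0.
set t := _ - delta.
have mean : mean_norm a (fun=> 0) <= q / 2.
  rewrite -(@ler_pXn2r _ 2)// ?nnegrE; last 2 first.
  - by apply: EP_ge0 => // m; exact: vnorm_ge0.
  - by rewrite divr_ge0// ltW.
  apply: le_trans (_ : _ <= E (fun m => vnorm (walk a (fun=> 0) m) ^+ 2)) _.
    (* The square of a mean is at most the mean of the square, read off from a nonnegative
       variance. *)
    pose e := mean_norm a (fun=> 0); rewrite -/e.
    have : 0 <= E (fun m => (vnorm (walk a (fun=> 0) m) - e) ^+ 2).
      by apply: EP_ge0 => // m; exact: sqr_ge0.
    rewrite /E (eq_EP _ (G := fun m => vnorm (walk a (fun=> 0) m) ^+ 2 +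
       ((- 2 * e) * vnorm (walk a (fun=> 0) m) + e ^+ 2))); last by move=> m; ring.
    rewrite !EPD EPZ EP_cst//.
    have eE : EP (fun=> mu) (fun m => vnorm (walk a (fun=> 0) m)) = e by [].
    rewrite eE /E.
    by lra.
  apply: le_trans (mean_sq_walk _ aC) _.
  rewrite /vnorm big1 ?sqrtr0; last by move=> *; rewrite expr0n.
  rewrite expr0n add0r exprMn q2; lra.
apply: le_trans (_ : _ <= EP (fun=> mu) (fun m : {ffun 'I_n -> V} =>
    (expR (s * t) <= expR (s * vnorm (walk a (fun=> 0) m)))%R%:R)) _.
  apply: le_EP => // m; rewrite ler_expR ler_pM2l//.
  by rewrite (eq_vnorm (u := walk _ _ _) (v := fun k => \sum_i a i * psi (m i) k))// => k; rewrite /walk add0r.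
have mk := @markov_EP R V n (fun=> mu) (fun=> mu_ge0) (fun m => expR (s * vnorm (walk a (fun=> 0) m))) _ (fun=> expR_ge0 _) (expR_gt0 (s * t)).
apply: (le_trans mk).
rewrite ler_pdivrMr ?expR_gt0// -expRD.
apply: (le_trans (norm_walk_mgf _ _ aC)); rewrite ler_expR.
have -> : n%:R * (s ^+ 2 * (Num.sqrt #|I|%:R * C) ^+ 2 / 4) = y ^+ 2.
  rewrite (_ : _ * (_ / 4) = s ^+ 2 * (n%:R * (C ^+ 2 * Num.sqrt #|I|%:R ^+ 2)) / 4); last by ring.
  by rewrite sqr_sqrtr// -q2 /s; field; rewrite gt_eqF.
have -> : - y ^+ 2 + 2 * y / q * delta + s * t = s * (q / 2) + y ^+ 2.
  by rewrite /t /s; field; rewrite gt_eqF.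
by rewrite lerD2r ler_pM2l.
Qed.

End NormConcentration.

(** * Symmetrization and contraction for finite product laws *)

Section ExpMax.
Variables (R : realType) (J : finType).
Implicit Types u v : J -> R.

(** The exponential of a finite supremum. The base [0] lies below every exponential and serves as
    the value on an empty index type. *)
Definition expmax u : R := \big[Num.max/0]_t expR (u t).

Lemma expmax_ge u t : expR (u t) <= expmax u.
Proof. exact: le_bigmax. Qed.

Lemma expmax_ge0 u : 0 <= expmax u.
Proof. exact: bigmax_ge_id. Qed.

Lemma expmax_le u c : 0 <= c -> (forall t, expR (u t) <= c) -> expmax u <= c.
Proof. by move=> c0 uc; apply: bigmax_le. Qed.

Lemma eq_expmax u v : u =1 v -> expmax u = expmax v.
Proof. by move=> uv; apply: eq_bigr => t _; rewrite uv. Qed.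

Lemma expmax_ex u (t0 : J) : exists t, expmax u = expR (u t) /\
  forall s, u s <= u t.
Proof.
have [t _ tmax] := Order.TotalTheory.arg_maxP u (isT : predT t0).
exists t; split; last by move=> s; exact: tmax.
apply/eqP; rewrite eq_le expmax_ge andbT; apply: expmax_le; first exact: expR_ge0.
by move=> s; rewrite ler_expR; exact: tmax.
Qed.

(** The increment of the exponential grows with the starting point and with the length: the one from
    [b'] to [b] is at most the one from [a] to [a']. *)
Lemma expR_majorize (a a' b b' : R) : b' <= b -> b' <= a -> b - b' <= a' - a ->
  expR a + expR b <= expR a' + expR b'.
Proof.
move=> bb ba d.
suff : expR b' * (expR (b - b') - 1) <= expR a * (expR (a' - a) - 1).
  by rewrite !mulrBr -!expRD !mulr1 ![_ + (_ - _)]addrC !subrK; lra.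
apply: ler_pM; rewrite ?expR_ge0 ?ler_expR//.
  by rewrite subr_ge0 -[leLHS]expR0 ler_expR subr_ge0.
by rewrite lerD2r ler_expR.
Qed.

(* One step of the Ledoux-Talagrand comparison: [t] and [s] maximize the two terms
   on the left, and the signs of [v t], [v s] decide which pair of values on the
   right majorizes them. *)
Lemma expmax_contraction u v f :
  (forall t, `|f t| <= `|v t|) -> (forall s t, `|f s - f t| <= `|v s - v t|) ->
  expmax (fun t => u t + f t) + expmax (fun t => u t - f t) <=
  expmax (fun t => u t + v t) + expmax (fun t => u t - v t).
Proof.
move=> fv ffv.
have [t0 _|J0] := pickP J; last by rewrite /expmax !big_pred0.
have [t [-> tmax]] := expmax_ex (fun t => u t + f t) t0.
have [s [-> smax]] := expmax_ex (fun t => u t - f t) t0.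
have {tmax} := tmax s; have {smax} := smax t => /= H1 H2.
have P1 := expmax_ge (fun t => u t + v t) t; have P2 := expmax_ge (fun t => u t + v t) s.
have P3 := expmax_ge (fun t => u t - v t) t; have P4 := expmax_ge (fun t => u t - v t) s.
have := fv t; have := fv s; have := ffv t s; rewrite !ler_norml.
have [vt|/ltW vt] := lerP 0 (v t); have [vs|/ltW vs] := lerP 0 (v s);
  rewrite ?(ger0_norm vt) ?(ger0_norm vs) ?(ler0_norm vt) ?(ler0_norm vs) => H3 H4 H5.
- have [vst|/ltW vst] := lerP (v s) (v t).
    rewrite ger0_norm in H3; last by lra.
    apply: le_trans (lerD P1 P4); apply: expR_majorize; lra.
  rewrite ler0_norm in H3; last by lra.
  rewrite addrC; apply: le_trans (lerD P2 P3); apply: expR_majorize; lra.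
- by apply: le_trans (lerD P1 P4); apply: lerD; rewrite ler_expR; lra.
- by rewrite addrC; apply: le_trans (lerD P2 P3); apply: lerD; rewrite ler_expR; lra.
- have [vst|/ltW vst] := lerP (v s) (v t).
    rewrite ger0_norm in H3; last by lra.
    apply: le_trans (lerD P1 P4); rewrite addrC [leRHS]addrC; apply: expR_majorize; lra.
  rewrite ler0_norm in H3; last by lra.
  rewrite addrC; apply: le_trans (lerD P2 P3); rewrite addrC [leRHS]addrC; apply: expR_majorize; lra.
Qed.

End ExpMax.

Section Symmetrization.
Variables (R : realType) (J A : finType).

Lemma sum_pair_bool (F : A * bool -> R) :
  \sum_ab F ab = \sum_a (F (a, true) + F (a, false)).
Proof.
transitivity (\sum_a \sum_(b : bool) F (a, b)).
  by rewrite pair_big; apply: eq_bigr => -[].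
by apply: eq_bigr => a _; rewrite big_bool.
Qed.

(* Jensen introduces an independent copy [a'] of [a]; convexity of [expR] then splits
   [u + g a' - g a] into the halves of [u + 2 * g a'] and [u - 2 * g a], so no exchange
   of [a] and [a'] is needed. *)
Lemma symmetrize_step (mu : A -> R) (g v : J -> A -> R) (u : J -> R) :
  (forall a, 0 <= mu a) -> \sum_a mu a = 1 ->
  (forall t a, `|g t a| <= `|v t a|) ->
  (forall s t a, `|g s a - g t a| <= `|v s a - v t a|) ->
  \sum_a mu a * expmax (fun t => u t + (\sum_a' mu a' * g t a' - g t a)) <=
  \sum_a mu a * ((expmax (fun t => u t + 2 * v t a) + expmax (fun t => u t - 2 * v t a)) / 2).
Proof.
move=> mu0 mu1 gv ggv.
apply: (@le_trans _ _ (\sum_a mu a *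
   ((expmax (fun t => u t + 2 * g t a) + expmax (fun t => u t - 2 * g t a)) / 2))).
  pose p a := expmax (fun t => u t + 2 * g t a).
  pose q a := expmax (fun t => u t - 2 * g t a).
  have -> : \sum_a mu a * ((p a + q a) / 2) =
            \sum_a mu a * ((\sum_a' mu a' * p a') / 2 + q a / 2).
    under [LHS]eq_bigr do rewrite mulrDl mulrDr.
    under [RHS]eq_bigr do rewrite mulrDr.
    rewrite !big_split /= wsum_cst//; congr (_ + _).
    by rewrite mulr_suml; apply: eq_bigr => a _; rewrite mulrA.
  apply: wsum_le => // a; apply: expmax_le => [|t].
    rewrite addr_ge0// divr_ge0// ?expmax_ge0// sumr_ge0// => a' _.
    by rewrite mulr_ge0// expmax_ge0.
  have -> : u t + (\sum_a' mu a' * g t a' - g t a) =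
      \sum_a' mu a' * ((u t + 2 * g t a') / 2 + (u t - 2 * g t a) / 2).
    under [RHS]eq_bigr do rewrite mulrDr.
    rewrite big_split /= wsum_cst//.
    rewrite [X in _ = X + _](eq_bigr (fun a' => mu a' * (u t / 2) + mu a' * g t a')); last first.
      by move=> a' _; field.
    by rewrite big_split /= wsum_cst//; field.
  apply: (le_trans (expR_jensen mu0 mu1 _)).
  have -> : (\sum_a' mu a' * p a') / 2 + q a / 2 =
      \sum_a' mu a' * (p a' / 2 + q a / 2).
    under [RHS]eq_bigr do rewrite mulrDr.
    rewrite big_split /= wsum_cst//; congr (_ + _).
    by rewrite mulr_suml; apply: eq_bigr => a' _; rewrite mulrA.
  apply: wsum_le => // a'.
  have Ep := expmax_ge (fun t => u t + 2 * g t a') t.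
  have Eq := expmax_ge (fun t => u t - 2 * g t a) t.
  apply: le_trans (_ : _ <= expR (u t + 2 * g t a') / 2 + expR (u t - 2 * g t a) / 2) _; last first.
    by rewrite /p /q; lra.
  have half x y : expR (x / 2 + y / 2) <= expR x / 2 + expR y / 2 :> R.
    have -> : expR x = expR (x / 2) ^+ 2 by rewrite expr2 -expRD; congr expR; field.
    have -> : expR y = expR (y / 2) ^+ 2 by rewrite expr2 -expRD; congr expR; field.
    by rewrite expRD; have := sqr_ge0 (expR (x / 2) - expR (y / 2)); nra.
  exact: half.
apply: wsum_le => // a; rewrite ler_pM2r ?invr_gt0//.
apply: expmax_contraction => [t|s t]; rewrite ?normrM ?ler_pM2l ?normr_gt0//.
by rewrite -!mulrBr !normrM ler_pM2l ?normr_gt0.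
Qed.

(** The boolean is an independent fair sign attached to [a]; [sg] reads it as a Rademacher
    variable. *)
Let mu2 (mu : A -> R) (ab : A * bool) : R := mu ab.1 / 2.
Let sg (b : bool) : R := if b then 1 else - 1.

(** Coordinates are treated one at a time: the centred term of the first is moved into [u] for the
    induction, then exchanged for its signed version under the expectation over the others. Each
    exchange also contracts [g] to the linear [v]. *)
Lemma symmetrize n (mu : 'I_n -> A -> R) (g v : 'I_n -> J -> A -> R) (u : J -> R) :
  (forall i a, 0 <= mu i a) -> (forall i, \sum_a mu i a = 1) ->
  (forall i t a, `|g i t a| <= `|v i t a|) ->
  (forall i s t a, `|g i s a - g i t a| <= `|v i s a - v i t a|) ->
  EP mu (fun m => expmax (fun t =>
    u t + \sum_i (\sum_a mu i a * g i t a - g i t (m i)))) <=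
  EP (fun i => mu2 (mu i)) (fun m => expmax (fun t =>
    u t + \sum_i 2 * (sg (m i).2 * v i t (m i).1))).
Proof.
elim: n mu g v u => [|n IH] mu g v u mu0 mu1 gv ggv.
  rewrite (EP0 _ _ (ffun0 (card_ord 0))) (EP0 _ _ (ffun0 (card_ord 0))) le_eqVlt; apply/orP; left; apply/eqP.
  by apply: eq_expmax => t; rewrite !big_ord0.
rewrite !EPS.
set nu := fun i => mu2 (mu (lift ord0 i)).
have nu0 i ab : 0 <= nu i ab by rewrite /nu /mu2 divr_ge0.
pose W (m : {ffun 'I_n -> A * bool}) t : R := u t + \sum_i 2 * (sg (m i).2 * v (lift ord0 i) t (m i).1).
pose c0 t a := \sum_a' mu ord0 a' * g ord0 t a' - g ord0 t a.
apply: (@le_trans _ _ (\sum_a mu ord0 a * EP nu (fun m => expmax (fun t => W m t + c0 t a)))).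
  apply: wsum_le => // a.
  have := IH (fun i => mu (lift ord0 i)) (fun i => g (lift ord0 i)) (fun i => v (lift ord0 i))
    (fun t => u t + c0 t a) (fun i => mu0 _) (fun i => mu1 _) (fun i => gv _) (fun i => ggv _).
  congr (_ <= _); apply: eq_EP => m; apply: eq_expmax => t.
    rewrite big_ord_recl fcons0 -addrA; congr (_ + (_ + _)).
    by apply: eq_bigr => i _; rewrite fconsS.
  by rewrite /W addrAC.
have -> : \sum_a mu ord0 a * EP nu (fun m => expmax (fun t => W m t + c0 t a)) =
    EP nu (fun m => \sum_a mu ord0 a * expmax (fun t => W m t + c0 t a)).
  by rewrite EP_sum; apply: eq_bigr => a _; rewrite EPZ.
have -> : \sum_ab mu2 (mu ord0) ab * EP nu (fun m => expmax (fun t =>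
     u t + \sum_i 2 * (sg (fcons ab m i).2 * v i t (fcons ab m i).1))) =
   EP nu (fun m => \sum_a mu ord0 a *
     ((expmax (fun t => W m t + 2 * v ord0 t a) + expmax (fun t => W m t - 2 * v ord0 t a)) / 2)).
  rewrite EP_sum sum_pair_bool; apply: eq_bigr => a _.
  rewrite /mu2 /= -!EPZ -EPD; apply: eq_EP => m.
  have E b : expmax (fun t => u t + \sum_i 2 * (sg (fcons (a, b) m i).2 * v i t (fcons (a, b) m i).1))
     = expmax (fun t => W m t + 2 * (sg b * v ord0 t a)).
    apply: eq_expmax => t; rewrite big_ord_recl fcons0 /= /W [_ * (sg b * _) + _]addrC addrA.
    by congr (_ + _ + _); apply: eq_bigr => i _; rewrite fconsS.
  rewrite !E /sg.
  rewrite (eq_expmax (v := fun t => W m t + 2 * v ord0 t a)); last by move=> t; rewrite mul1r.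
  rewrite [X in _ + _ * X](eq_expmax (v := fun t => W m t - 2 * v ord0 t a)); last first.
    by move=> t; rewrite mulN1r mulrN.
  by field.
by apply: le_EP => // m; exact: symmetrize_step.
Qed.

(** Independence factorizes the exponential, and averaging the sign turns each factor into a
    cosh. *)
Lemma rademacher_mgf n (mu : 'I_n -> A -> R) (x : 'I_n -> A -> R) C k :
  (forall i a, 0 <= mu i a) -> (forall i, \sum_a mu i a = 1) ->
  (forall i a, `|x i a| <= C) ->
  EP (fun i => mu2 (mu i)) (fun m => expR (k * \sum_i sg (m i).2 * x i (m i).1))
  <= expR (n%:R * (k ^+ 2 * C ^+ 2 / 2)).
Proof.
move=> mu0 mu1 xC.
rewrite (eq_EP _ (G := fun m => \prod_i expR (k * (sg (m i).2 * x i (m i).1)))); last first.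
  by move=> m; rewrite mulr_sumr expR_sum.
rewrite (EP_prod _ (fun i ab => expR (k * (sg ab.2 * x i ab.1)))).
rewrite expRM_natl -[in leRHS](card_ord n) -prodr_const.
apply: ler_prod => i _; apply/andP; split.
  by apply: sumr_ge0 => ab _; rewrite mulr_ge0 ?expR_ge0// divr_ge0.
rewrite sum_pair_bool -[leRHS](wsum_cst (mu1 i)); apply: ler_sum => a _.
rewrite /mu2 /= /sg mul1r mulN1r mulrN.
have H := cosh_le_expR (k * x i a).
rewrite (_ : _ + _ = mu i a * ((expR (k * x i a) + expR (- (k * x i a))) / 2)); last by field.
apply: ler_wpM2l => //; rewrite ler_pdivrMr// [leRHS]mulrC; apply: (le_trans H).
rewrite ler_pM2l// ler_expR ler_pM2r ?invr_gt0// exprMn ler_wpM2l ?sqr_ge0//.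
have C0 : 0 <= C by exact: le_trans (xC i a).
by rewrite -[leLHS]real_normK ?num_real// ler_pXn2r ?nnegrE.
Qed.

(** After contraction the functional is linear in [D t], hence at most [M] times the largest
    coordinate sum [|S m j|]. Summing over coordinates and signs costs [2 * q.+1], whatever the size
    of [J]. *)
Lemma empirical_tail n q (mu : 'I_n -> A -> R) (g : 'I_n -> J -> A -> R)
    (x : 'I_n -> 'I_q.+1 -> A -> R) (D : J -> 'I_q.+1 -> R) (M C eta : R) :
  (forall i a, 0 <= mu i a) -> (forall i, \sum_a mu i a = 1) ->
  0 < M -> 0 < C -> 0 < eta ->
  (forall i j a, `|x i j a| <= C) -> (forall t, \sum_j `|D t j| <= M) ->
  (forall i t a, `|g i t a| <= `|\sum_j x i j a * D t j|) ->
  (forall i s t a, `|g i s a - g i t a| <=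
     `|\sum_j x i j a * D s j - \sum_j x i j a * D t j|) ->
  EP mu (fun m => [exists t, n%:R * eta <= \sum_i (\sum_a mu i a * g i t a - g i t (m i))]%:R)
  <= 2 * q.+1%:R * expR (- (n%:R * (eta ^+ 2 / (8 * M ^+ 2 * C ^+ 2)))).
Proof.
move=> mu0 mu1 M0 C0 eta0 xC DM gv ggv.
(* Minimizer of [- th * eta + 2 * th ^+ 2 * M ^+ 2 * C ^+ 2], the exponent per observation. *)
pose th := eta / (4 * M ^+ 2 * C ^+ 2).
have th0 : 0 < th by rewrite divr_gt0// !mulr_gt0// exprn_gt0.
pose v i t a := \sum_j x i j a * D t j.
apply: (@le_trans _ _ (expR (- (th * (n%:R * eta))) * EP mu (fun m => expmax (fun t =>
    0 + \sum_i (\sum_a mu i a * (th * g i t a) - th * g i t (m i)))))).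
  rewrite -EPZ; apply: le_EP => // m.
  case: existsP => [[t ht]|_]; last by rewrite mulr_ge0 ?expR_ge0 ?expmax_ge0.
  apply: le_trans (ler_wpM2l (expR_ge0 _) (expmax_ge _ t)).
  rewrite add0r -expRD -[leLHS]expR0 ler_expR addrC subr_ge0.
  rewrite (eq_bigr (fun i => th * (\sum_a mu i a * g i t a - g i t (m i)))).
    by rewrite -mulr_sumr ler_pM2l.
  move=> i _; rewrite mulrBr mulr_sumr; congr (_ - _).
  by apply: eq_bigr => a _; rewrite mulrCA.
have gv' i t a : `|th * g i t a| <= `|th * v i t a|.
  by rewrite !normrM ler_wpM2l.
have ggv' i s t a : `|th * g i s a - th * g i t a| <= `|th * v i s a - th * v i t a|.
  by rewrite -!mulrBr !normrM ler_wpM2l//; exact: ggv.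
have sym := symmetrize (fun=> 0) mu0 mu1 gv' ggv'.
apply: (le_trans (ler_wpM2l (expR_ge0 _) sym)).
pose S (m : {ffun 'I_n -> A * bool}) j := \sum_i sg (m i).2 * x i j (m i).1.
pose k := 2 * th * M.
have nu0 i ab : 0 <= mu2 (mu i) ab by rewrite divr_ge0.
have k0 : 0 <= k by apply: mulr_ge0; [apply: mulr_ge0 => //|]; exact: ltW.
apply: (@le_trans _ _ (expR (- (th * (n%:R * eta))) *
    \sum_(j < q.+1) (EP (fun i => mu2 (mu i)) (fun m => expR (k * S m j))
          + EP (fun i => mu2 (mu i)) (fun m => expR (- k * S m j))))).
  apply: ler_wpM2l; first exact: expR_ge0.
  rewrite (eq_bigr (fun j => EP (fun i => mu2 (mu i)) (fun m =>
     expR (k * S m j) + expR (- k * S m j)))); last by move=> j _; rewrite EPD.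
  rewrite -EP_sum; apply: le_EP => // m; apply: expmax_le => [|t].
    by apply: sumr_ge0 => j _; rewrite addr_ge0 ?expR_ge0.
  have -> : 0 + \sum_i 2 * (sg (m i).2 * (th * v i t (m i).1)) =
      2 * th * \sum_j D t j * S m j.
    rewrite add0r mulr_sumr /v.
    under [RHS]eq_bigr do rewrite /S !mulr_sumr.
    rewrite exchange_big; apply: eq_bigr => i _ /=.
    by rewrite !mulr_sumr; apply: eq_bigr => j _; ring.
  have [j _ jmax] := Order.TotalTheory.arg_maxP (fun j => `|S m j|) (isT : predT (@ord0 q)).
  have DS : \sum_j D t j * S m j <= M * `|S m j|.
    apply: (@le_trans _ _ (\sum_j' `|D t j'| * `|S m j|)).
      apply: ler_sum => j' _; apply: (le_trans (ler_norm _)); rewrite normrM.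
      by apply: ler_wpM2l => //; exact: jmax.
    by rewrite -mulr_suml ler_wpM2r.
  apply: (@le_trans _ _ (expR (k * `|S m j|))).
    by rewrite ler_expR /k -[leRHS]mulrA ler_wpM2l// mulr_ge0// ltW.
  rewrite (bigD1 j)//= -[leLHS]addr0; apply: lerD; last first.
    by apply: sumr_ge0 => j' _; rewrite addr_ge0 ?expR_ge0.
  have [S0|S0] := lerP 0 (S m j); first by rewrite ?(ger0_norm S0) lerDl expR_ge0.
  by rewrite ?(ltr0_norm S0) mulrN -mulNr lerDr expR_ge0.
have bnd k' : k' ^+ 2 = k ^+ 2 -> forall j, EP (fun i => mu2 (mu i)) (fun m => expR (k' * S m j)) <=
    expR (n%:R * (k ^+ 2 * C ^+ 2 / 2)).
  by move=> <- j; apply: (@rademacher_mgf n mu (fun i => x i j) C k' mu0 mu1) => i a; exact: xC.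
set B := expR (n%:R * _) in bnd.
apply: (@le_trans _ _ (expR (- (th * (n%:R * eta))) * \sum_(j < q.+1) (B + B))).
  apply: ler_wpM2l; first exact: expR_ge0.
  by apply: ler_sum => j _; apply: lerD; apply: bnd; rewrite ?sqrrN.
rewrite sumr_const card_ord -[_ *+ q.+1]mulr_natr.
rewrite [leLHS](_ : _ = 2 * q.+1%:R * (expR (- (th * (n%:R * eta))) * B)); last by ring.
rewrite le_eqVlt; apply/orP; left; apply/eqP; congr (_ * _).
rewrite -expRD; congr expR.
by rewrite /k /th; field; rewrite !gt_eqF.
Qed.

End Symmetrization.

(** * Bounded random variables and discretization *)

Section BoundedExpectation.
Variables (R : realType) (d : measure_display) (T : measurableType d) (P : probability T R).
Implicit Types (Z W : T -> R) (A : set T).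

(** Bounded measurable functions: integrable under a probability and closed under products, so the
    algebra of [Ex] carries a single side condition. *)
Definition bm Z := measurable_fun setT Z /\ exists C : R, forall w, `|Z w| <= C.

Lemma bm_integrable Z : bm Z -> P.-integrable setT (EFin \o Z).
Proof.
move=> [mZ [C ZC]]; apply: measurable_bounded_integrable => //.
  by apply: le_lt_trans (probability_le1 P measurableT) _; rewrite ltry.
exists C; split; first by rewrite num_real.
by move=> M CM w _ /=; apply: le_trans (ZC w) (ltW CM).
Qed.

Lemma bm_cst c : bm (fun=> c).
Proof. by split; [exact: measurable_cst | exists `|c|]. Qed.

Lemma bmD Z W : bm Z -> bm W -> bm (fun w => Z w + W w).
Proof.
move=> [mZ [C ZC]] [mW [D WD]]; split; first exact: measurable_funD.
by exists (C + D) => w; apply: le_trans (ler_normD _ _) (lerD _ _).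
Qed.

Lemma bmM Z W : bm Z -> bm W -> bm (fun w => Z w * W w).
Proof.
move=> [mZ [C ZC]] [mW [D WD]]; split; first exact: measurable_funM.
by exists (C * D) => w; rewrite normrM; apply: ler_pM.
Qed.

Lemma bmZ c Z : bm Z -> bm (fun w => c * Z w).
Proof. exact/bmM/bm_cst. Qed.

Lemma bmN Z : bm Z -> bm (fun w => - Z w).
Proof.
move=> /(bmZ (-1)); congr bm; apply/funext => w; exact: mulN1r.
Qed.

Lemma bmB Z W : bm Z -> bm W -> bm (fun w => Z w - W w).
Proof. by move=> bZ bW; apply: bmD => //; exact: bmN. Qed.

Lemma bm_norm Z : bm Z -> bm (fun w => `|Z w|).
Proof.
move=> [mZ [C ZC]]; split; first exact: measurableT_comp.
by exists C => w; rewrite normr_id.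
Qed.

Lemma bmX n Z : bm Z -> bm (fun w => Z w ^+ n).
Proof.
move=> bZ; elim: n => [|n IH]; first exact: bm_cst.
have := bmM bZ IH; congr bm; apply/funext => w; by rewrite exprS.
Qed.

Lemma bm_sum (I : Type) (r : seq I) (Q : pred I) (Z : I -> T -> R) :
  (forall i, bm (Z i)) -> bm (fun w => \sum_(i <- r | Q i) Z i w).
Proof.
move=> bZ; elim: r => [|i r IH].
  have := bm_cst 0; congr bm; apply/funext => w; by rewrite big_nil.
have := bmD (bZ i) IH; case Qi: (Q i) => H.
  by move: H; congr bm; apply/funext => w; rewrite big_cons Qi.
by move: IH; congr bm; apply/funext => w; rewrite big_cons Qi.
Qed.

Lemma bm_indic A : measurable A -> bm (\1_A : T -> R).
Proof.
move=> mA; split; first exact: measurable_indic.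
by exists 1 => w; rewrite indicE; case: (_ \in _); rewrite ?normr1 ?normr0.
Qed.

Lemma ExD Z W : bm Z -> bm W -> Ex P (fun w => Z w + W w) = Ex P Z + Ex P W.
Proof. by move=> bZ bW; rewrite /Ex RintegralD//; exact: bm_integrable. Qed.

Lemma ExZ c Z : bm Z -> Ex P (fun w => c * Z w) = c * Ex P Z.
Proof. by move=> bZ; rewrite /Ex RintegralZl//; exact: bm_integrable. Qed.

Lemma ExN Z : bm Z -> Ex P (fun w => - Z w) = - Ex P Z.
Proof.
move=> bZ; rewrite -mulN1r -ExZ//; congr Ex; apply/funext => w; by rewrite mulN1r.
Qed.

Lemma ExB Z W : bm Z -> bm W -> Ex P (fun w => Z w - W w) = Ex P Z - Ex P W.
Proof. by move=> bZ bW; rewrite ExD ?ExN//; exact: bmN. Qed.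

Lemma Ex_le Z W : bm Z -> bm W -> (forall w, Z w <= W w) -> Ex P Z <= Ex P W.
Proof. by move=> bZ bW ZW; apply: le_Rintegral => //; exact: bm_integrable. Qed.

Lemma Ex_cst c : Ex P (fun=> c) = c.
Proof.
rewrite /Ex Rintegral_cst// -[RHS]mulr1; congr (_ * _).
exact: (congr1 fine (probability_setT P)).
Qed.

Lemma Ex_ge0 Z : (forall w, 0 <= Z w) -> 0 <= Ex P Z.
Proof. by move=> Z0; apply: Rintegral_ge0. Qed.

Lemma Ex_sum (I : Type) (r : seq I) (Q : pred I) (Z : I -> T -> R) :
  (forall i, bm (Z i)) ->
  Ex P (fun w => \sum_(i <- r | Q i) Z i w) = \sum_(i <- r | Q i) Ex P (Z i).
Proof.
move=> bZ; elim: r => [|i r IH].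
  by rewrite big_nil -[RHS]Ex_cst; congr Ex; apply/funext => w; rewrite big_nil.
rewrite big_cons; case Qi: (Q i).
  rewrite -IH -ExD//; last exact: bm_sum.
  by congr Ex; apply/funext => w; rewrite big_cons Qi.
by rewrite -IH; congr Ex; apply/funext => w; rewrite big_cons Qi.
Qed.

Lemma Ex_indic A : measurable A -> Ex P (\1_A) = fine (P A).
Proof. by move=> mA; rewrite /Ex /Rintegral integral_indic// setIT. Qed.

Lemma Ex_norm_le Z c : bm Z -> (forall w, `|Z w| <= c) -> `|Ex P Z| <= c.
Proof.
move=> bZ Zc; rewrite ler_norml -[- c]Ex_cst -[X in _ && (_ <= X)]Ex_cst.
by apply/andP; split; apply: Ex_le => //; try exact: bm_cst;
   move=> w; have := Zc w; rewrite ler_norml => /andP[].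
Qed.

Lemma fineP_le A B : measurable A -> measurable B -> A `<=` B -> fine (P A) <= fine (P B).
Proof.
move=> mA mB AB; rewrite fine_le ?fin_num_measure//.
by apply: le_measure; rewrite ?inE.
Qed.

Lemma fin_indic_sum (M : finType) (D : T -> M) (G : M -> R) :
  (fun w => G (D w)) = (fun w => \sum_m G m * \1_(D @^-1` [set m]) w).
Proof.
apply/funext => w; rewrite (bigD1 (D w))//= big1 ?addr0.
  by rewrite indicE mem_set ?mulr1.
move=> m mDw; rewrite indicE memNset ?mulr0// => /= E.
by rewrite E eqxx in mDw.
Qed.

Lemma bm_fin (M : finType) (D : T -> M) (G : M -> R) :
  (forall m, measurable (D @^-1` [set m])) -> bm (fun w => G (D w)).
Proof.
by move=> mD; rewrite fin_indic_sum; apply: bm_sum => m; apply: bmZ; exact: bm_indic.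
Qed.

Lemma Ex_partition (M : finType) (D : T -> M) (G : M -> R) :
  (forall m, measurable (D @^-1` [set m])) ->
  Ex P (fun w => G (D w)) = \sum_m fine (P (D @^-1` [set m])) * G m.
Proof.
move=> mD; rewrite fin_indic_sum Ex_sum; last by move=> m; apply: bmZ; exact: bm_indic.
by apply: eq_bigr => m _; rewrite ExZ ?Ex_indic 1?mulrC//; exact: bm_indic.
Qed.

Lemma partition_sum (M : finType) (D : T -> M) :
  (forall m, measurable (D @^-1` [set m])) ->
  \sum_m fine (P (D @^-1` [set m])) = 1.
Proof.
move=> mD; rewrite -[RHS]Ex_cst (Ex_partition (fun=> 1) mD).
by apply: eq_bigr => m _; rewrite mulr1.
Qed.


Lemma prob_partition (M : finType) (D : T -> M) (F : pred M) :
  (forall m, measurable (D @^-1` [set m])) ->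
  measurable [set w | F (D w)] ->
  fine (P [set w | F (D w)]) = \sum_m fine (P (D @^-1` [set m])) * (F m)%:R.
Proof.
move=> mD mF; rewrite -Ex_indic// -(Ex_partition (fun m => (F m)%:R) mD).
congr Ex; apply/funext => w; rewrite indicE.
by case: (boolP (F (D w))) => Fw; [rewrite mem_set | rewrite memNset//=; exact/negP].
Qed.

End BoundedExpectation.

(** * Finite codes of real variables *)

Section Cells.
Variable R : realType.

(* The position of [x] relative to the grid [- V + l * h], [l < m]: a finite-valued
   measurable code that determines [x] up to [h] on [[-V, V]]. *)
Definition bits (V h : R) (m : nat) (x : R) : {ffun 'I_m -> bool} :=
  [ffun l : 'I_m => - V + l%:R * h <= x].

Lemma bits_close (V h : R) m x x' : 0 < h -> 2 * V < m%:R * h ->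
  `|x| <= V -> `|x'| <= V -> bits V h m x = bits V h m x' -> `|x - x'| <= h.
Proof.
move=> h0 mV; wlog xx' : x x' / x <= x'.
  move=> H xV x'V E; have [xx'|/ltW xx'] := leP x x'; first exact: H.
  by rewrite distrC; exact: H.
move=> + + E; rewrite ler_norml => /andP[x1 x2]; rewrite ler_norml => /andP[y1 y2].
have [//|xh] := leP `|x - x'| h.
rewrite distrC ger0_norm ?subr_ge0// in xh.
have q0 : 0 <= (x + V) / h by rewrite divr_ge0 ?(ltW h0)//; lra.
(* First grid index strictly above [x]; if the gap exceeds [h], this grid point separates [x] from
   [x'] and the codes differ there. *)
pose l := (Num.truncn ((x + V) / h)).+1.
have l1 : x + V < l%:R * h by rewrite -ltr_pdivrMr//; exact: truncnS_gt.
have l2 : l%:R * h <= x + V + h.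
  rewrite /l -natr1 mulrDl mul1r lerD2r -ler_pdivlMr//.
  by rewrite truncn_le.
have lm : (l < m)%N by rewrite -(ltr_nat R) -(ltr_pM2r h0); lra.
have /ffunP/(_ (Ordinal lm)) := E; rewrite !ffunE /=.
have -> : - V + l%:R * h <= x' by lra.
by move/idP; lra.
Qed.

Lemma exists_bits (V h : R) : 0 < h -> exists m : nat, 2 * V < m%:R * h.
Proof.
move=> h0; exists (Num.truncn (2 * V / h)).+1.
by rewrite -ltr_pdivrMr//; exact: truncnS_gt.
Qed.

End Cells.

(** * Transfer from finite product laws to independent observations *)

Section Independence.
Variables (R : realType) (d : measure_display) (T : measurableType d) (P : probability T R).

Lemma g_sigma_sub (G : set (set T)) : G `<=` measurable -> <<s G >> `<=` measurable.
Proof. by move=> GM; apply: smallest_sub => //; exact: sigma_algebra_measurable. Qed.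

Lemma measurable_fun_g_sigma (G : set (set T)) (Z : T -> R) : G `<=` measurable ->
  measurable_fun (setT : set (g_sigma_algebraType G)) Z -> measurable_fun setT Z.
Proof. by move=> GM mZ _ B mB; apply: (g_sigma_sub GM); exact: (mZ measurableT B mB). Qed.

(** The measurable space is generic because the lemma is also applied to [T] with a generated
    σ-algebra, which places the code in that σ-algebra. *)
Lemma measurable_bits d' (T' : measurableType d') (Z : T' -> R) V h m a :
  measurable_fun setT Z -> measurable ((fun w => bits V h m (Z w)) @^-1` [set a]).
Proof.
move=> mZ.
have -> : (fun w => bits V h m (Z w)) @^-1` [set a] =
    \bigcap_(l in [set: 'I_m]) [set w | (- V + l%:R * h <= Z w) = a l].
  apply/seteqP; split => w /=; first by move=> <- l _ /=; rewrite ffunE.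
  by move=> H; apply/ffunP => l; rewrite ffunE; exact: H.
apply: fin_bigcap_measurable => // l _.
have mle : measurable [set w | - V + l%:R * h <= Z w].
  by rewrite -[X in measurable X]setTI; exact: (measurable_fun_ler (@measurable_cst _ _ _ _ _ (- V + l%:R * h)) mZ measurableT (Y := [set true])).
case: (a l) => //.
rewrite (_ : [set w | _] = ~` [set w | - V + l%:R * h <= Z w]); first exact: measurableC.
by apply/seteqP; split => w /= => [/negbT/negP|/negP/negbTE].
Qed.

Lemma measurable_ffun_pre d' (T' : measurableType d') (J B : finType) (D : T' -> {ffun J -> B}) m :
  (forall t b, measurable ((fun w => D w t) @^-1` [set b])) ->
  measurable (D @^-1` [set m]).
Proof.
move=> mD; rewrite (_ : _ @^-1` _ = \bigcap_(t in [set: J]) ((fun w => D w t) @^-1` [set m t])).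
  by apply: fin_bigcap_measurable.
apply/seteqP; split => w /=; first by move=> E t _ /=; rewrite E.
by move=> H; apply/ffunP => t; exact: H.
Qed.

Lemma measurable_pred_fin d' (T' : measurableType d') (M : finType) (D : T' -> M) (F : pred M) :
  (forall m, measurable (D @^-1` [set m])) -> measurable [set w | F (D w)].
Proof.
move=> mD; rewrite (_ : [set w | _] = \bigcup_(m in [set m | F m]) (D @^-1` [set m])).
  by apply: fin_bigcup_measurable.
apply/seteqP; split => w /=; first by exists (D w).
by move=> [m Fm E] /=; rewrite E.
Qed.

Lemma indep_law n (G : 'I_n -> set (set T)) (A : finType) (D : 'I_n -> T -> A) m :
  mutually_independent P (fun i => <<s G i >>) ->
  (forall i a, <<s G i >> (D i @^-1` [set a])) ->
  fine (P ((fun w => [ffun i => D i w]) @^-1` [set m])) =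
  \prod_(i < n) fine (P (D i @^-1` [set m i])).
Proof.
move=> ind GD.
rewrite (_ : _ @^-1` _ = \bigcap_(i in [set: 'I_n]) (D i @^-1` [set m i])).
  by rewrite ind.
apply/seteqP; split => w /=; first by move=> <- i _ /=; rewrite ffunE.
by move=> H; apply/ffunP => i; rewrite ffunE; exact: H.
Qed.

(* Each [g i t] is replaced by its value at a representative point of its cell.  As
   representatives are points of [T], the contraction hypotheses survive exactly. *)
Theorem empirical_tail_measure n q (J : finType) (G : 'I_n -> set (set T))
    (g : 'I_n -> J -> T -> R) (x : 'I_n -> 'I_q.+1 -> T -> R) (D : J -> 'I_q.+1 -> R) (M C eta : R) :
  mutually_independent P (fun i => <<s G i >>) -> (forall i, G i `<=` measurable) ->
  (forall i t, measurable_fun (setT : set (g_sigma_algebraType (G i))) (g i t)) ->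
  0 < M -> 0 < C -> 0 < eta ->
  (forall i j w, `|x i j w| <= C) -> (forall t, \sum_j `|D t j| <= M) ->
  (forall i t w, `|g i t w| <= `|\sum_j x i j w * D t j|) ->
  (forall i s t w, `|g i s w - g i t w| <=
     `|\sum_j x i j w * D s j - \sum_j x i j w * D t j|) ->
  exists B : set T, [/\ measurable B,
    fine (P B) <= 2 * q.+1%:R * expR (- (n%:R * (eta ^+ 2 / (8 * M ^+ 2 * C ^+ 2)))) &
    forall w t, n%:R * (2 * eta) < \sum_i (Ex P (g i t) - g i t w) -> B w].
Proof.
move=> ind GM mg M0 C0 eta0 xC DM gv ggv.
(* The mean and the sample value each move by at most [h] per observation, so [2 * eta] drops to
   [eta]. *)
pose h := eta / 2; have h0 : 0 < h by rewrite divr_gt0.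
pose V := M * C.
have gV i t w : `|g i t w| <= V.
  apply: (le_trans (gv i t w)); apply: (le_trans (ler_norm_sum _ _ _)).
  apply: (@le_trans _ _ (\sum_j `|D t j| * C)).
    by apply: ler_sum => j _; rewrite normrM mulrC ler_wpM2l.
  by rewrite -mulr_suml ler_wpM2r// ltW.
have [m mV] := exists_bits V h0.
pose A := {ffun J -> {ffun 'I_m -> bool}}.
pose c i w : A := [ffun t => bits V h m (g i t w)].
have GD i (a : A) : <<s G i >> (c i @^-1` [set a]).
  apply: (@measurable_ffun_pre _ (g_sigma_algebraType (G i))) => t b.
  rewrite (_ : _ @^-1` _ = (fun w => bits V h m (g i t w)) @^-1` [set b]).
    exact: (@measurable_bits _ (g_sigma_algebraType (G i))).
  by apply/seteqP; split => w /=; rewrite ffunE.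
have mGD i (a : A) : measurable (c i @^-1` [set a]).
  by apply: (g_sigma_sub (GM i)); exact: GD.
have bg i t : bm (g i t).
  by split; [exact: (measurable_fun_g_sigma (GM i)) | exists V].
(* The default [point] serves the empty cells, which have probability zero; the hypotheses on [g]
   hold there as at any point. *)
pose rep i (a : A) : T := xget point (c i @^-1` [set a]).
have repE i w : c i (rep i (c i w)) = c i w.
  by rewrite /rep; case: xgetP => [y -> /= ->|/(_ w) /= H] //; case: H.
have close i t w : `|g i t w - g i t (rep i (c i w))| <= h.
  apply: (bits_close h0 mV) => //.
  by have /ffunP/(_ t) := repE i w; rewrite !ffunE.
pose mu i (a : A) : R := fine (P (c i @^-1` [set a])).
pose gh i t (a : A) := g i t (rep i a).
have mu0 i a : 0 <= mu i a by exact: fine_ge0.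
have mu1 i : \sum_a mu i a = 1 by exact: partition_sum.
have Eg i t : Ex P (g i t) <= \sum_a mu i a * gh i t a + h.
  have bgh := bm_fin (gh i t) (mGD i).
  rewrite -(Ex_partition P (gh i t) (mGD i)) -lerBlDl -ExB//.
  rewrite -[leRHS](Ex_cst P); apply: Ex_le; [exact: bmB | exact: bm_cst |] => w.
  exact: le_trans (ler_norm _) (close _ _ _).
pose F (a : {ffun 'I_n -> A}) := [exists t, n%:R * eta <= \sum_i (\sum_b mu i b * gh i t b - gh i t (a i))].
pose DD w : {ffun 'I_n -> A} := [ffun i => c i w].
have mDD a : measurable (DD @^-1` [set a]).
  apply: measurable_ffun_pre => i b.
  rewrite (_ : _ @^-1` _ = c i @^-1` [set b])//.
  by apply/seteqP; split => w /=; rewrite ffunE.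
exists [set w | F (DD w)]; split.
- exact: measurable_pred_fin.
- rewrite prob_partition//; last exact: measurable_pred_fin.
  have := @empirical_tail R J A n q mu gh (fun i j a => x i j (rep i a)) D M C eta mu0 mu1 M0 C0 eta0
    (fun i j a => xC i j (rep i a)) DM (fun i t a => gv i t (rep i a))
    (fun i s t a => ggv i s t (rep i a)).
  congr (_ <= _); rewrite /EP; apply: eq_bigr => a _.
  by rewrite (indep_law _ ind GD).
- move=> w t wt; apply/existsP; exists t; apply: ltW.
  have -> : n%:R * eta = n%:R * (2 * eta) - \sum_(i < n) (h + h).
    by rewrite sumr_const card_ord -[_ *+ n]mulr_natl /h; field.
  rewrite ltrBlDr -big_split /=; apply: (lt_le_trans wt); apply: ler_sum => i _.
  have := Eg i t; have := close i t w; rewrite ffunE ler_norml /gh => /andP[]; lra.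
Qed.

End Independence.

(** * Check loss and conditional densities *)

Section CheckLoss.
Variable R : realType.
Implicit Types tau u a : R.

Lemma check_lossE tau u : check_loss tau u = u * (tau - (u < 0)%R%:R).
Proof. by rewrite /check_loss; case: ltP. Qed.

Lemma check_subgradient tau u a : 0 < tau < 1 ->
  check_loss tau u - a * (tau - (u < 0)%R%:R) <= check_loss tau (u - a).
Proof.
move=> /andP[t0 t1]; rewrite !check_lossE.
by case: (ltP u 0); case: (ltP (u - a) 0) => /= h1 h2; nra.
Qed.

Lemma check_lipschitz tau u u' : 0 < tau < 1 ->
  `|check_loss tau u - check_loss tau u'| <= `|u - u'|.
Proof.
move=> /andP[t0 t1]; rewrite !check_lossE.
have H a b : a * (tau - (a < 0)%R%:R) - b * (tau - (b < 0)%R%:R) <= `|a - b| :> R.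
  have := ler_norm (a - b); have := ler_norm (b - a); rewrite distrC.
  move: `|a - b| => m h1 h2.
  by case: (ltP a 0) => /= a0; case: (ltP b 0) => /= b0; nra.
by rewrite ler_norml; apply/andP; split; [rewrite lerNl opprB distrC | ]; exact: H.
Qed.

Lemma check_convex tau u u' t : 0 < tau < 1 -> 0 <= t <= 1 ->
  check_loss tau (u + t * (u' - u)) <= check_loss tau u + t * (check_loss tau u' - check_loss tau u).
Proof.
move=> /andP[t0 t1] /andP[s0 s1]; rewrite !check_lossE.
by case: (ltP (u + t * (u' - u)) 0) => /= h0; case: (ltP u 0) => /= h1; case: (ltP u' 0) => /= h2; nra.
Qed.

Lemma measurable_check_loss d (T : measurableType d) (z : T -> R) tau :
  0 < tau < 1 -> measurable_fun setT z -> measurable_fun setT (fun w => check_loss tau (z w)).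
Proof.
move=> /andP[t0 t1] mz.
rewrite (_ : (fun w => _) = (fun w => Num.max (tau * z w) ((tau - 1) * z w))).
  by apply: measurable_maxr; apply: measurable_funM.
apply/funext => w.
by rewrite /check_loss; case: ltP => z0; [rewrite max_r | rewrite max_l]; nra.
Qed.

End CheckLoss.

Section LowerIntegral.
Local Open Scope ereal_scope.
Context d (T : measurableType d) (R : realType).
Variable mu : {measure set T -> \bar R}.

(* Superadditivity without measurability: integrals of nonnegative functions are suprema
   over simple functions below them. *)
Lemma ge0_le_integral_add (A : set T) (F1 F2 : T -> \bar R) (k : R) :
  measurable A -> mu A < +oo -> (0 <= k)%R -> (forall w, A w -> 0 <= F1 w) ->
  (forall w, A w -> F1 w + k%:E <= F2 w) ->
  \int[mu]_(w in A) F1 w + k%:E * mu A <= \int[mu]_(w in A) F2 w.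
Proof.
move=> mA muA k0 F10 F12.
have F20 w : A w -> 0 <= F2 w.
  by move=> Aw; apply: le_trans (F12 w Aw); rewrite adde_ge0 ?F10// lee_fin.
have kA : k%:E * mu A \is a fin_num by rewrite fin_numM// ge0_fin_numE.
rewrite -leeBrDr// ge0_integralE// (ge0_integralE _ F20).
apply: ge_ereal_sup => _ [s sF1 <-]; rewrite leeBrDr//.
pose t := add_nnsfun s (scale_nnsfun (indic_nnsfun R mA) k0).
apply: ereal_sup_ubound; exists t.
  move=> w /=; rewrite /patch; have := sF1 w; rewrite /patch.
  have [/set_mem Aw|nAw] := boolP (w \in A).
    move=> sw; apply: le_trans (F12 w Aw); rewrite EFinD; apply: leeD => //.
    by rewrite lee_fin /mindic indicE mem_set// mulr1.
  rewrite /mindic indicE (negbTE nAw) mulr0 addr0; exact.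
rewrite sintegralD//; congr (_ + _).
rewrite sintegralrM; congr (_ * _).
exact: sintegral_indic.
Qed.

End LowerIntegral.

Section Density.
Variable R : realType.

Lemma derive_bound_lipschitz (f : R -> R) (c : R) :
  (forall t : R, derivable f t 1 /\ `|derive1 f t| <= c) ->
  forall u q, `|f u - f q| <= c * `|u - q|.
Proof.
move=> df.
have cf : continuous f.
  by move=> t; apply/differentiable_continuous/derivable1_diffP; exact: (df t).1.
have H a b : a <= b -> `|f b - f a| <= c * `|b - a|.
  move=> ab.
  have [t _ ->] := MVT_segment ab (fun t _ => (DeriveDef (df t).1 (esym (derive1E f t))) : is_derive t 1 f (derive1 f t))
     (continuous_subspaceT cf).
  by rewrite normrM ler_wpM2r//; exact: (df t).2.
move=> u q; have [uq|/ltW qu] := leP u q; last exact: H.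
by rewrite distrC [`|u - q|]distrC; exact: H.
Qed.

Lemma integral_Nyc_add (f : R -> R) (a b m : R) : a <= b -> 0 <= m ->
  continuous f -> (forall u, 0 <= f u) -> (forall u, a < u <= b -> m <= f u) ->
  (\int[lebesgue_measure]_(u in `]-oo, a]) (f u)%:E + (m * (b - a))%:E <=
   \int[lebesgue_measure]_(u in `]-oo, b]) (f u)%:E)%E.
Proof.
move=> ab m0 cf f0 fm.
have mf (D : set R) : measurable_fun D (EFin \o f).
  by apply/measurable_EFinP; apply: measurable_funS (continuous_measurable_fun cf).
have -> : [set` `]-oo, b]] = [set` `]-oo, a]] `|` [set` `]a, b]] :> set R.
  by rewrite -itv_bndbnd_setU// bnd_simp.
rewrite ge0_integral_setU//=; last 3 first.
- exact: mf.
- by move=> u _; rewrite lee_fin.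
- apply/disj_setPS => u [] /=; rewrite in_itv /= => ua; rewrite in_itv /= => /andP[au _].
  by move: (lt_le_trans au ua); rewrite ltxx.
apply: leeD => //.
have -> : ((m * (b - a))%:E = \int[lebesgue_measure]_(u in `]a, b]) m%:E)%E.
  rewrite integral_cst//= lebesgue_measure_itv/= lte_fin.
  case: ltP => [_|ba]; first by rewrite -EFinD -EFinM.
  have -> : b = a by apply/eqP; rewrite eq_le ab ba.
  by rewrite subrr mulr0 mule0.
apply: ge0_le_integral => //=.
exact: mf.
Qed.

End Density.

(** * Expected increase of the check loss for one observation *)

Section ConditionalDensity.
Variables (R : realType) (d : measure_display) (T : measurableType d) (P : probability T R).
Variables (G : set (set T)) (y : T -> R) (f : T -> R -> R) (q v : T -> R) (tau c1 c2 V : R).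
Hypothesis G_meas : G `<=` measurable.
Hypothesis y_meas : measurable_fun setT y.
Hypothesis q_meas : measurable_fun (setT : set (g_sigma_algebraType G)) q.
Hypothesis v_meas : measurable_fun (setT : set (g_sigma_algebraType G)) v.
Hypothesis q_bnd : forall w, `|q w| <= V.
Hypothesis v_bnd : forall w, `|v w| <= V.
Hypothesis c1_gt0 : 0 < c1.
Hypothesis c2_gt0 : 0 < c2.
Hypothesis f_ge0 : forall w t, 0 <= f w t.
Hypothesis q_quantile : forall A, <<s G >> A ->
  P (A `&` [set w | y w < q w]) = (tau%:E * P A)%E.
Hypothesis f_density : forall A t, <<s G >> A ->
  P (A `&` [set w | y w <= t]) =
  (\int[P]_(w in A) \int[lebesgue_measure]_(u in `]-oo, t]) (f w u)%:E)%E.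
Hypothesis f_at_q : forall w, c1 <= f w (q w).
Hypothesis f_deriv : forall w (t : R), derivable (f w) t 1 /\ `|derive1 (f w) t| <= c2.

Let mA A : <<s G >> A -> measurable A.
Proof. exact: g_sigma_sub. Qed.

Let my_le t : measurable [set w | y w <= t].
Proof.
by rewrite -[X in measurable X]setTI; exact: (measurable_fun_ler y_meas (@measurable_cst _ _ _ _ _ t) measurableT (Y := [set true])).
Qed.

Lemma density_lower w u : c1 - c2 * `|u - q w| <= f w u.
Proof.
have := derive_bound_lipschitz (f_deriv w) u (q w); rewrite ler_norml => /andP[+ _].
by have := f_at_q w; lra.
Qed.

(** The density is given through half-lines, and the inner integral is not known to be measurable in
    [w]; superadditivity of the integral therefore replaces a subtraction. *)
Lemma interval_prob_lower A (a b m : R) : <<s G >> A -> a <= b -> 0 <= m ->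
  (forall w u, A w -> a < u <= b -> m <= f w u) ->
  m * (b - a) * fine (P A) <= fine (P (A `&` [set w | a < y w <= b])).
Proof.
move=> GA ab m0 fm.
have mb0 : 0 <= m * (b - a) by rewrite mulr_ge0// subr_ge0.
have cf w : continuous (f w).
  by move=> t; apply/differentiable_continuous/derivable1_diffP; exact: (f_deriv w t).1.
have mAab : measurable (A `&` [set w | a < y w <= b]).
  rewrite (_ : [set w | _] = [set w | y w <= b] `\` [set w | y w <= a]).
    by apply: measurableI; [exact: mA | exact: measurableD].
  apply/seteqP; split => w /=; first by move=> /andP[ay yb]; split=> //; apply/negP; rewrite -ltNge.
  by move=> [yb /negP]; rewrite -ltNge => ->.
have PA : (P A < +oo)%E by apply: le_lt_trans (probability_le1 P (mA GA)) _; rewrite ltry.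
have H := @ge0_le_integral_add _ T R P A
  (fun w => \int[lebesgue_measure]_(u in `]-oo, a]) (f w u)%:E)%E
  (fun w => \int[lebesgue_measure]_(u in `]-oo, b]) (f w u)%:E)%E (m * (b - a)) (mA GA) PA mb0.
have : (P (A `&` [set w | (y w <= a)%R]) + (m * (b - a))%:E * P A <= P (A `&` [set w | (y w <= b)%R]))%E.
  rewrite !f_density//; apply: H.
    by move=> w _; apply: integral_ge0 => u _; rewrite lee_fin.
  by move=> w Aw; apply: integral_Nyc_add => // u uab; exact: fm.
have -> : A `&` [set w | y w <= b] = (A `&` [set w | y w <= a]) `|` (A `&` [set w | a < y w <= b]).
  apply/seteqP; split => w /=.
    move=> [Aw yb]; have [ya|ya] := leP (y w) a; first by left.
    by right; rewrite ?ya.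
  move=> [[Aw ya]|[Aw /andP[_ yb]]]; split => //; exact: le_trans ab.
rewrite measureU//; last 2 first.
- by apply: measurableI => //; exact: mA.
- apply/seteqP; split => w //= [[_ ya] [_ /andP[ay _]]].
  by move: (lt_le_trans ay ya); rewrite ltxx.
rewrite leeD2lE; last first.
  by rewrite fin_num_measure//; apply: measurableI => //; exact: mA.
move=> H2; rewrite -lee_fin EFinM !fineK ?fin_num_measure//; exact: mA.
Qed.


Hypothesis tau01 : 0 < tau < 1.

Let fine_quantile A : <<s G >> A -> fine (P (A `&` [set w | y w < q w])) = tau * fine (P A).
Proof. by move=> GA; rewrite q_quantile// fineM// fin_num_measure//; exact: mA. Qed.

Let q_meas' : measurable_fun setT q.
Proof. exact: measurable_fun_g_sigma q_meas. Qed.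

Let v_meas' : measurable_fun setT v.
Proof. exact: measurable_fun_g_sigma v_meas. Qed.

Let bm_v : bm v.
Proof. by split => //; exists V. Qed.

Let bm_lt (z : T -> R) : measurable_fun setT z -> bm (fun w => (y w < z w)%R%:R : R).
Proof.
move=> mz.
have -> : (fun w => (y w < z w)%R%:R : R) = \1_[set w | y w < z w].
  apply/funext => w; rewrite indicE.
  by case: ltP => h; [rewrite mem_set | rewrite memNset//=; apply/negP; rewrite -leNgt].
apply: bm_indic; rewrite -[X in measurable X]setTI.
exact: (measurable_fun_ltr y_meas mz measurableT (Y := [set true])).
Qed.

Section CrossingCells.
Variables (h : R) (m : nat).
Hypothesis h_gt0 : 0 < h.
Hypothesis mV : 2 * V < m%:R * h.

Let M : finType := ({ffun 'I_m -> bool} * {ffun 'I_m -> bool})%type.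
Let cell w : M := (bits V h m (q w), bits V h m (v w)).
Let rep (a : M) : T := xget point (cell @^-1` [set a]).

Let G_cell a : <<s G >> (cell @^-1` [set a]).
Proof.
have -> : cell @^-1` [set a] = ((fun w => bits V h m (q w)) @^-1` [set a.1]) `&`
    ((fun w => bits V h m (v w)) @^-1` [set a.2]).
  by apply/seteqP; case: a => a b; split => w /=; rewrite /cell => -[E1 E2]; [split | rewrite E1 E2].
by apply: (@measurableI _ (g_sigma_algebraType G));
  apply: (@measurable_bits R _ (g_sigma_algebraType G)).
Qed.

Let m_cell a : measurable (cell @^-1` [set a]).
Proof. by apply: mA; exact: G_cell. Qed.

Let rep_close a w : cell w = a -> `|q w - q (rep a)| <= h /\ `|v w - v (rep a)| <= h.
Proof.
move=> wa; have : cell (rep a) = cell w.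
  by rewrite /rep; case: xgetP => [z -> /= ->|/(_ w)/(_ wa)].
by move=> [E1 E2]; split; apply: (bits_close h_gt0 mV).
Qed.

Let cell_indicE w a : \1_(cell @^-1` [set a]) w = (cell w == a)%:R :> R.
Proof.
rewrite indicE; case: eqVneq => [wa|/eqP wa]; first by rewrite mem_set.
by rewrite memNset.
Qed.

(** With [v] replaced by its cellwise constant version [vh], the quantile identity makes the
    contribution of each cell vanish; the replacement costs at most [h]. *)
Lemma Ex_score_le : `|Ex P (fun w => v w * ((y w < q w)%R%:R - tau))| <= h.
Proof.
pose vh w := v (rep (cell w)).
have bvh : bm vh by exact: (bm_fin (fun a => v (rep a)) m_cell).
have bs : bm (fun w => (y w < q w)%R%:R - tau : R).
  by apply: bmB; [exact: bm_lt | exact: bm_cst].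
have E0 : Ex P (fun w => vh w * ((y w < q w)%R%:R - tau)) = 0.
  rewrite (_ : (fun w => _) = (fun w => \sum_a v (rep a) *
      (\1_(cell @^-1` [set a] `&` [set w | y w < q w]) w - tau * \1_(cell @^-1` [set a]) w))); last first.
    apply/funext => w; rewrite (bigD1 (cell w))//= big1 ?addr0; last first.
      move=> a aw; rewrite indicI /= cell_indicE eq_sym (negbTE aw).
      by rewrite mul0r mulr0 subrr mulr0.
    rewrite indicI /= cell_indicE eqxx mul1r mulr1; congr (_ * (_ - _)).
    by rewrite indicE; case: ltP => H; [rewrite mem_set | rewrite memNset//=; apply/negP; rewrite -leNgt].
  have mq : measurable [set w | y w < q w].
    rewrite -[X in measurable X]setTI.
    exact: (measurable_fun_ltr y_meas q_meas' measurableT (Y := [set true])).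
  have mI a := measurableI _ _ (m_cell a) mq.
  have b1 a := bm_indic R (mI a); have b2 a := bmZ tau (bm_indic R (m_cell a)).
  rewrite Ex_sum => [|a]; last by apply: bmZ; exact: bmB.
  rewrite big1// => a _; rewrite ExZ ?ExB ?ExZ ?Ex_indic//; [|exact: bm_indic|exact: bmB].
  by rewrite fine_quantile// subrr mulr0.
rewrite -[Ex P _]subr0 -E0 -ExB; [|exact: bmM|exact: bmM].
apply: Ex_norm_le; first by apply: bmB; exact: bmM.
move=> w; rewrite -mulrBl normrM -[leRHS]mulr1; apply: ler_pM => //.
  by rewrite /vh; exact: (rep_close erefl).2.
by case: ltP => _ /=; rewrite ler_norml; move/andP: tau01 => [t0 t1]; apply/andP; split; lra.
Qed.

(** An interval of length [b / 4] within [b / 2] of [q] would ideally give [1 / 4] and [1 / 8]. The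
    weaker [1 / 5] and [3 / 20] leave room for [|v|] to vary between [15 / 16 * b] and [17 / 16 * b]
    on a cell. *)
Let target w := 1 / 5 * c1 * v w ^+ 2 - 3 / 20 * c2 * `|v w| ^+ 3.
Let cross w : R := v w * ((y w < q w + v w / 2)%R%:R - (y w < q w)%R%:R).

Let cross_ge0 w : 0 <= cross w.
Proof.
rewrite /cross; case: (ltP (y w)) => h1; case: (ltP (y w)) => h2 /=; rewrite ?subrr ?mulr0//.
  by rewrite subr0 mulr1; lra.
by rewrite sub0r mulrN1; lra.
Qed.

Let target_le1 w : target w <= 1 / 5 * c1 * v w ^+ 2.
Proof.
by rewrite /target gerBl !mulr_ge0// ?exprn_ge0// ltW.
Qed.

Let bm_target : bm target.
Proof.
by apply: bmB; apply: bmZ; apply: bmX => //; exact: bm_norm.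
Qed.

Let bm_cross : bm cross.
Proof.
apply: bmM => //; apply: bmB; apply: bm_lt => //.
by apply: measurable_funD => //; apply: measurable_funM.
Qed.

(* On a cell where [`|v|] is of order [b >= 16 * h], the response falls with the
   appropriate probability in an interval of length [b / 4] lying between [q] and
   [q + v / 2]; on the other cells the left-hand side is nonpositive. *)
Let cell_lower a :
  Ex P (fun w => (target w - 1 / 5 * c1 * 17 ^+ 2 * h ^+ 2) * \1_(cell @^-1` [set a]) w) <=
  Ex P (fun w => cross w * \1_(cell @^-1` [set a]) w).
Proof.
have h0 := h_gt0; have c10 := c1_gt0; have c20 := c2_gt0.
set k := 1 / 5 * c1 * 17 ^+ 2 * h ^+ 2.
have k0 : 0 <= k by rewrite /k !mulr_ge0 ?sqr_ge0// ltW.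
set A := cell @^-1` [set a]; have bA : bm (\1_A : T -> R) by exact: (bm_indic R (m_cell a)).
have bL : bm (fun w => (target w - k) * \1_A w).
  by apply: bmM => //; apply: bmB => //; exact: bm_cst.
have bR : bm (fun w => cross w * \1_A w) by exact: bmM.
have easy : (forall w, A w -> target w <= k) ->
    Ex P (fun w => (target w - k) * \1_A w) <= Ex P (fun w => cross w * \1_A w).
  move=> H; apply: Ex_le => // w; apply: (@le_trans _ _ 0); last first.
    by rewrite mulr_ge0// indicE; case: (_ \in _).
  rewrite indicE; case: (boolP (w \in A)) => [/set_mem/H|_] /=; last by rewrite mulr0.
  by rewrite mulr1 subr_le0.
pose b : R := `|v (rep a)|.
have vb w : A w -> b - h <= `|v w| <= b + h.
  move=> /rep_close[_ H]; rewrite /b; apply/andP; split.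
    rewrite lerBlDr -lerBlDl; apply: le_trans H; rewrite distrC.
    exact: lerB_dist.
  by rewrite -lerBlDl; apply: le_trans H; exact: lerB_dist.
(* Below this threshold [|v|] is at most [17 * h] on the cell, and [k] is the quadratic term at that
   value. *)
have [b16|b16] := ltP b (16 * h).
  apply: easy => w /vb/andP[_ vb']; apply: (le_trans (target_le1 w)).
  have -> : k = 1 / 5 * c1 * (17 * h) ^+ 2 by rewrite /k; ring.
  apply: ler_wpM2l; first by rewrite mulr_ge0// ltW.
  rewrite -[leLHS]real_normK ?num_real// ler_pXn2r ?nnegrE//; last by lra.
  by apply: (le_trans vb'); lra.
pose mm := c1 - c2 * (b / 2).
have b_gt0 : 0 < b by apply: lt_le_trans b16; rewrite mulr_gt0.
have vw w : A w -> 15 / 16 * b <= `|v w| <= 17 / 16 * b.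
  by move=> /vb/andP[H1 H2]; apply/andP; split; lra.
(* When the lower bound on the density is void, the cubic term already outweighs the quadratic
   one. *)
have [mm0|mm0] := leP mm 0.
  apply: easy => w /vw/andP[H1 H2]; apply: le_trans k0.
  rewrite /target -real_normK ?num_real//; move: H1 H2; move: `|v w| => z H1 H2.
  rewrite (_ : _ - _ = z ^+ 2 * (1 / 5 * c1 - 3 / 20 * c2 * z)); last by ring.
  rewrite mulr_ge0_le0 ?sqr_ge0// subr_le0.
  have : c1 <= c2 * (b / 2) by rewrite -subr_le0.
  have : c2 * (15 / 16 * b) <= c2 * z by rewrite ler_pM2l.
  by lra.
(* The interval runs from [b / 8] to [3 * b / 8] away from [q (rep a)], on the side of [v]. Moving
   [q] and [v] by [h <= b / 16] keeps it between [q] and [q + v / 2]. *)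
pose lo := if 0 <= v (rep a) then q (rep a) + b / 8 else q (rep a) - 3 * b / 8.
have facts w : A w ->
  (forall u, lo < u <= lo + b / 4 -> `|u - q w| <= b / 2) /\
  (lo < y w <= lo + b / 4 -> 15 / 16 * b <= cross w).
  move=> Aw; have [q1 v1] := rep_close Aw; have := vw w Aw => /andP[vw1 _].
  move: q1 v1; rewrite !ler_norml => /andP[q1 q2] /andP[v1 v2].
  have [va|va] := leP 0 (v (rep a)).
    have bE : b = v (rep a) by rewrite /b ger0_norm.
    rewrite /lo va.
    split; first by move=> u /andP[u1 u2]; rewrite ler_norml; apply/andP; split; lra.
    move=> /andP[y1 y2]; rewrite /cross.
    have -> : y w < q w + v w / 2 by lra.
    have -> : (y w < q w) = false by apply/negbTE; rewrite -leNgt; lra.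
    by rewrite /= subr0 mulr1 -(ger0_norm (_ : 0 <= v w))//; lra.
  have bE : b = - v (rep a) by rewrite /b ltr0_norm.
  rewrite /lo leNgt va /=.
  split; first by move=> u /andP[u1 u2]; rewrite ler_norml; apply/andP; split; lra.
  move=> /andP[y1 y2]; rewrite /cross.
  have -> : y w < q w by lra.
  have -> : (y w < q w + v w / 2) = false by apply/negbTE; rewrite -leNgt; lra.
  by rewrite /= sub0r mulrN1 -(ler0_norm (_ : v w <= 0))//; lra.
have GA : <<s G >> A by exact: G_cell.
pose I := A `&` [set w | lo < y w <= lo + b / 4].
have mI : measurable I.
  rewrite /I (_ : [set w | _] = [set w | y w <= lo + b / 4] `\` [set w | y w <= lo]).
    by apply: measurableI; [exact: mA | exact: measurableD].
  apply/seteqP; split => w /=; first by move=> /andP[ay yb]; split=> //; apply/negP; rewrite -ltNge.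
  by move=> [yb /negP]; rewrite -ltNge => ->.
have PI : mm * (b / 4) * fine (P A) <= fine (P I).
  have := @interval_prob_lower A lo (lo + b / 4) mm GA.
  rewrite [lo + _ - lo]addrAC subrr add0r; apply.
  - by rewrite lerDl divr_ge0// ltW.
  - exact: ltW.
  - move=> w u Aw /((facts w Aw).1 u) H; apply: le_trans (density_lower w u).
    by rewrite /mm lerD2l lerN2 ler_pM2l.
apply: (@le_trans _ _ (Ex P (fun w => (15 / 16 * b) * \1_I w))); last first.
  apply: Ex_le => //; first by apply: bmZ; exact: bm_indic.
  move=> w; rewrite !indicE; case: (boolP (w \in I)) => [/set_mem[Aw Iw]|_].
    by rewrite (mem_set Aw) !mulr1; exact: (facts w Aw).2.
  by rewrite mulr0 mulr_ge0//; case: (_ \in _).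
rewrite ExZ ?Ex_indic//; last exact: bm_indic.
apply: (@le_trans _ _ (15 / 16 * b * (mm * (b / 4) * fine (P A)))); last first.
  by rewrite ler_wpM2l// mulr_ge0// ltW.
rewrite -Ex_indic; last exact: mA.
rewrite [leRHS]mulrA -ExZ//; apply: Ex_le => //; first exact: bmZ.
move=> w; rewrite indicE; case: (boolP (w \in A)) => [/set_mem Aw|_]; last by rewrite !mulr0.
rewrite !mulr1 lerBlDr; apply: (@le_trans _ _ (15 / 16 * b * (mm * (b / 4)))); last by rewrite lerDl.
rewrite /target -real_normK ?num_real//; move: (vw w Aw) => /andP[]; move: `|v w| => z H1 H2.
have z2 : z ^+ 2 <= (17 / 16 * b) ^+ 2 by rewrite ler_pXn2r ?nnegrE//; lra.
have z3 : (15 / 16 * b) ^+ 3 <= z ^+ 3 by rewrite ler_pXn2r ?nnegrE//; lra.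
have c1b : 0 <= c1 * b ^+ 2 by rewrite mulr_ge0 ?sqr_ge0// ltW.
have c2b : 0 <= c2 * b ^+ 3 by rewrite mulr_ge0 ?exprn_ge0// ltW.
have Ha : c1 * z ^+ 2 <= c1 * (17 / 16 * b) ^+ 2 by rewrite ler_pM2l.
have Hb : c2 * (15 / 16 * b) ^+ 3 <= c2 * z ^+ 3 by rewrite ler_pM2l.
by rewrite /mm; lra.
Qed.

Lemma Ex_crossing_cells : Ex P target - 1 / 5 * c1 * 17 ^+ 2 * h ^+ 2 <= Ex P cross.
Proof.
have split_cells (Z : T -> R) : bm Z -> Ex P Z = \sum_a Ex P (fun w => Z w * \1_(cell @^-1` [set a]) w).
  move=> bZ; rewrite -Ex_sum; last by move=> a; apply: bmM => //; exact: bm_indic.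
  congr Ex; apply/funext => w; rewrite -mulr_sumr (bigD1 (cell w))//= big1.
    by rewrite cell_indicE eqxx addr0 mulr1.
  by move=> a aw; rewrite cell_indicE eq_sym (negbTE aw).
rewrite -[X in _ - X](Ex_cst P) -ExB//; last exact: bm_cst.
rewrite split_cells; last by apply: bmB => //; exact: bm_cst.
rewrite (split_cells cross)//; apply: ler_sum => a _; exact: cell_lower.
Qed.

End CrossingCells.

Lemma Ex_score : Ex P (fun w => v w * ((y w < q w)%R%:R - tau)) = 0.
Proof.
apply/eqP; rewrite -normr_le0; apply/ler_addgt0Pr => h h0; rewrite add0r.
by have [m mV] := exists_bits V h0; exact: Ex_score_le mV.
Qed.

Lemma Ex_crossing :
  1 / 5 * c1 * Ex P (fun w => v w ^+ 2) - 3 / 20 * c2 * Ex P (fun w => `|v w| ^+ 3) <=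
  Ex P (fun w => v w * ((y w < q w + v w / 2)%R%:R - (y w < q w)%R%:R)).
Proof.
rewrite -!ExZ; [|by apply: bmX; exact: bm_norm|exact: bmX].
rewrite -ExB; [|by apply: bmZ; exact: bmX|by apply: bmZ; apply: bmX; exact: bm_norm].
apply/ler_addgt0Pr => e e0.
pose k := 1 / 5 * c1 * 17 ^+ 2.
have k0 : 0 < k by rewrite !mulr_gt0// exprn_gt0.
(* The error is quadratic in [h]; the cap at 1 gives [h ^+ 2 <= h <= e / k]. *)
pose h := Num.min 1 (e / k).
have h0 : 0 < h by rewrite lt_min ltr01 divr_gt0.
have [m mV] := exists_bits V h0.
rewrite -lerBlDr; apply: le_trans (Ex_crossing_cells h0 mV).
rewrite lerD2l lerN2 -/k -ler_pdivlMl// mulrC.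
apply: (@le_trans _ _ h); last by rewrite ge_min lexx orbT.
by rewrite expr2 -[leRHS]mulr1; apply: ler_wpM2l; [exact: ltW | rewrite ge_min lexx].
Qed.

(* Two subgradient steps, from [y - q] to [y - q - v / 2] and on to [y - q - v]: the
   first has mean zero, the second only sees whether [y] lies between [q] and
   [q + v / 2]. *)
Theorem Ex_check_loss_lower :
  1 / 10 * c1 * Ex P (fun w => v w ^+ 2) - 3 / 40 * c2 * Ex P (fun w => `|v w| ^+ 3) <=
  Ex P (fun w => check_loss tau (y w - q w - v w) - check_loss tau (y w - q w)).
Proof.
have bs : bm (fun w => v w * ((y w < q w)%R%:R - tau)).
  by apply: bmM => //; apply: bmB; [exact: bm_lt | exact: bm_cst].
have bc : bm (fun w => v w * ((y w < q w + v w / 2)%R%:R - (y w < q w)%R%:R)).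
  apply: bmM => //; apply: bmB; apply: bm_lt => //.
  by apply: measurable_funD => //; apply: measurable_funM.
apply: (@le_trans _ _ (Ex P (fun w => v w * ((y w < q w)%R%:R - tau) +
   1 / 2 * (v w * ((y w < q w + v w / 2)%R%:R - (y w < q w)%R%:R))))).
  rewrite ExD//; last exact: bmZ.
  by rewrite Ex_score add0r ExZ//; have := Ex_crossing; lra.
have my1 : measurable_fun setT (fun w => y w - q w) by exact: measurable_funB.
apply: Ex_le.
- by apply: bmD => //; exact: bmZ.
- split.
    by apply: measurable_funB; apply: measurable_check_loss => //; exact: measurable_funB.
  exists V => w; apply: (le_trans (check_lipschitz _ _ tau01)).
  by rewrite addrAC subrr add0r normrN.
move=> w.
have H1 := check_subgradient (y w - q w) (v w / 2) tau01.
have H2 := check_subgradient (y w - q w - v w / 2) (v w / 2) tau01.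
have E : y w - q w - v w / 2 - v w / 2 = y w - q w - v w by field.
rewrite E in H2.
have E1 : (y w - q w < 0) = (y w < q w) by rewrite subr_lt0.
have E2 : (y w - q w - v w / 2 < 0) = (y w < q w + v w / 2) by rewrite subr_lt0 ltrBlDl.
by rewrite E1 in H1; rewrite E2 in H2; lra.
Qed.

End ConditionalDensity.

(** * Concentration of the gradient *)

Section QuantileRank.
Variables (R : realType) (d : measure_display) (T : measurableType d) (P : probability T R).
Variables (K : nat) (G : set (set T)) (y : T -> R) (q : 'I_K -> T -> R) (tau : 'I_K -> R).
Hypothesis G_meas : G `<=` measurable.
Hypothesis y_meas : measurable_fun setT y.
Hypothesis q_meas : forall k, measurable_fun (setT : set (g_sigma_algebraType G)) (q k).
Hypothesis tau_lt : forall k k' : 'I_K, (k < k')%N -> tau k < tau k'.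
Hypothesis q_quantile : forall k A, <<s G >> A ->
  P (A `&` [set w | y w < q k w]) = ((tau k)%:E * P A)%E.

Let mA A : <<s G >> A -> measurable A.
Proof. exact: g_sigma_sub. Qed.

Let m_lt k : measurable [set w | y w < q k w].
Proof.
rewrite -[X in measurable X]setTI.
apply: (measurable_fun_ltr y_meas _ measurableT (Y := [set true])) => //.
exact: measurable_fun_g_sigma (q_meas k).
Qed.

Let bad (k k' : 'I_K) : set T := [set w | q k' w <= q k w].

Let G_bad k k' : <<s G >> (bad k k').
Proof.
have := measurable_fun_ler (q_meas k') (q_meas k) measurableT (Y := [set true]).
by rewrite setTI; apply.
Qed.

(** Where the curves are in the wrong order, [y < q k'] implies [y < q k]. Comparing probabilities
    on this event gives [tau k' * P <= tau k * P], which forces a null event. *)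
Let bad0 (k k' : 'I_K) : (k < k')%N -> P (bad k k') = 0%E.
Proof.
move=> kk'; have GB := G_bad k k'; have mB := mA GB.
have Pfin : P (bad k k') \is a fin_num by exact: fin_num_measure.
have : fine (P (bad k k' `&` [set w | y w < q k' w])) <=
       fine (P (bad k k' `&` [set w | y w < q k w])).
  apply: fineP_le; try exact: measurableI.
  by move=> w [/= B yq]; split => //=; exact: lt_le_trans B.
rewrite !q_quantile// !fineM//= => H.
have p0 : 0 <= fine (P (bad k k')) by exact: fine_ge0.
have tt := tau_lt kk'.
have : fine (P (bad k k')) = 0 by apply/eqP; rewrite eq_le p0 andbT; nra.
by move=> E; rewrite -(fineK Pfin) E.
Qed.

Definition crossing_set : set T :=
  \bigcup_(p in [set p : 'I_K * 'I_K | (p.1 < p.2)%N]) [set w | q p.2 w <= q p.1 w].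

Lemma measurable_crossing_set : measurable crossing_set.
Proof.
apply: fin_bigcup_measurable => [|[k k'] _]; first exact: finite_finset.
by apply: mA; exact: G_bad.
Qed.

Lemma crossing_set0 : P crossing_set = 0%E.
Proof.
apply/eqP; rewrite -measure_le0.
have := @content_sub_fsum _ R T P _ [set p : 'I_K * 'I_K | (p.1 < p.2)%N] crossing_set
  (fun p => [set w | q p.2 w <= q p.1 w]).
rewrite fsbig1; last by move=> p /= p12; exact: bad0.
apply => //.
- exact: finite_finset.
- by move=> [k k'] _; apply: mA; exact: G_bad.
- exact: measurable_crossing_set.
Qed.

Definition rank (w : T) : 'I_K.+1 := inord (\sum_(k < K) (y w < q k w)%R).

Lemma sum_geq_ord k0 m : (k0 <= m)%N -> (\sum_(k < m) (k0 <= k) = m - k0)%N.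
Proof.
elim: m => [|m IH]; first by rewrite big_ord0 leqn0 => /eqP ->.
rewrite leq_eqVlt => /predU1P[->|km].
  rewrite subnn big1// => k _; apply/eqP; rewrite eqb0 -ltnNge; exact: ltn_ord.
by rewrite big_ord_recr /= IH// -ltnS km addn1 subSn.
Qed.

(** With ordered curves the indicators are nondecreasing in [k], so those that hold are exactly the
    last [rank w] of them. *)
Lemma rankE w : ~ crossing_set w -> forall k : 'I_K, (K <= k + rank w)%N = (y w < q k w).
Proof.
move=> nw k.
have mono (k1 k2 : 'I_K) : (k1 <= k2)%N -> y w < q k1 w -> y w < q k2 w.
  rewrite leq_eqVlt => /predU1P[/val_inj ->//|k12] yq; apply: (lt_trans yq).
  by rewrite ltNge; apply/negP => H; apply: nw; exists (k1, k2).
have rle : (\sum_(k < K) (y w < q k w)%R <= K)%N.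
  rewrite -[leqRHS]card_ord -sum1_card; apply: leq_sum => j _; exact: leq_b1.
rewrite /rank inordK//.
case: (boolP (y w < q k w)) => yq.
  rewrite -leq_subLR -(sum_geq_ord (ltnW (ltn_ord k))); apply: leq_sum => j _.
  by case: (leqP k j) => // kj; rewrite (mono k j kj yq).
apply/negbTE; rewrite -ltnNge.
have : (\sum_(k < K) (y w < q k w)%R <= K - k.+1)%N.
  rewrite -(sum_geq_ord (ltn_ord k)); apply: leq_sum => j _.
  case: (boolP (y w < q j w)) => //= yj; rewrite lt0b ltnNge.
  by apply/negP => jk; move/negP: yq; apply; exact: mono yj.
by have := ltn_ord k; lia.
Qed.

(* [rank_tail m] is the probability of [m <= rank]; see [rank_law]. *)
Definition rank_tail (m : nat) : R :=
  if m == 0%N then 1 else if (m <= K)%N then oapp tau 0 (insub (K - m)%N) else 0.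

Lemma measurable_rank m : measurable (rank @^-1` [set m]).
Proof.
pose b w : {ffun 'I_K -> bool} := [ffun k => y w < q k w].
rewrite (_ : _ @^-1` _ = [set w | (fun c : {ffun 'I_K -> bool} => inord (\sum_(k < K) c k) == m) (b w)]).
  apply: (measurable_pred_fin (fun c : {ffun 'I_K -> bool} => inord (\sum_(k < K) c k) == m)) => c.
  apply: measurable_ffun_pre => k e.
  case: e.
    by rewrite (_ : _ @^-1` _ = [set w | y w < q k w])//; apply/seteqP; split => w /=; rewrite ffunE.
  rewrite (_ : _ @^-1` _ = ~` [set w | y w < q k w]); first exact: measurableC.
  by apply/seteqP; split => w /=; rewrite ffunE; [move=> /negbT/negP | move=> /negP/negbTE].
have E w : inord (\sum_(k < K) b w k) = rank w.
  by rewrite /rank; congr inord; apply: eq_bigr => k _; rewrite ffunE.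
by apply/seteqP; split => w /=; rewrite E => /eqP.
Qed.

Let eq_off_null (N U W : set T) : measurable N -> measurable U -> measurable W ->
  P N = 0%E -> (forall w, ~ N w -> (U w <-> W w)) -> P U = P W.
Proof.
move=> mN mU mW N0 UW.
have H (U' W' : set T) : measurable U' -> measurable W' -> (forall w, ~ N w -> (U' w -> W' w)) -> (P U' <= P W')%E.
  move=> mU' mW' H; rewrite -[leRHS]adde0 -N0; apply: le_trans (measureU2 _ mW' mN).
  apply: le_measure; rewrite ?inE//; first exact: measurableU.
  by move=> w U'w; have [Nw|/(H w)] := pselect (N w); [right | left; auto].
by apply/eqP; rewrite eq_le !H// => w /UW[].
Qed.

Let rank_tail_law A m : <<s G >> A -> (m <= K.+1)%N ->
  P (A `&` [set w | (m <= rank w)%N]) = ((rank_tail m)%:E * P A)%E.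
Proof.
move=> GA; rewrite /rank_tail; case: m => [|m] mK /=.
  by rewrite mul1e (_ : [set w | _] = setT) ?setIT//; apply/seteqP; split.
have mm : measurable [set w | (m < rank w)%N].
  by apply: (measurable_pred_fin (fun r : 'I_K.+1 => (m < r)%N)) => r; exact: measurable_rank.
case: (ltnP m K) => mlt; last first.
  rewrite (_ : [set w | _] = set0) ?setI0 ?measure0 ?mul0e//.
  by apply/seteqP; split => w //=; have := ltn_ord (rank w); lia.
have kK : (K - m.+1 < K)%N by lia.
rewrite (insubT (fun i => i < K)%N kK) /= -q_quantile//.
apply: (eq_off_null measurable_crossing_set) => //.
- by apply: measurableI => //; exact: mA.
- by apply: measurableI => //; exact: mA.
- exact: crossing_set0.
move=> w /rankE nw /=; have -> // : (m < rank w)%N = (y w < q (Sub (K - m.+1)%N kK) w).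
by rewrite -nw /=; lia.
Qed.

(** Each upper tail of the rank is, up to a null set, the event that [y] lies below one curve, to
    which the quantile identity applies; consecutive tails are subtracted. The factor not involving
    [A] expresses the independence from the covariates. *)
Lemma rank_law A (m : 'I_K.+1) : <<s G >> A ->
  P (A `&` (rank @^-1` [set m])) = ((rank_tail m - rank_tail m.+1)%:E * P A)%E.
Proof.
move=> GA; have mK : (m.+1 <= K.+1)%N by exact: ltn_ord.
have H := rank_tail_law GA (ltnW mK); have H' := rank_tail_law GA mK.
have mtail j : measurable (A `&` [set w | (j <= rank w)%N]).
  apply: measurableI; first exact: mA.
  by apply: (measurable_pred_fin (fun r : 'I_K.+1 => (j <= r)%N)) => r; exact: measurable_rank.
have mr : measurable (A `&` (rank @^-1` [set m])).
  by apply: measurableI; [exact: mA | exact: measurable_rank].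
have E : A `&` [set w | (m <= rank w)%N] =
    (A `&` (rank @^-1` [set m])) `|` (A `&` [set w | (m.+1 <= rank w)%N]).
  apply/seteqP; split => w /=.
    move=> [Aw]; rewrite leq_eqVlt => /predU1P[/val_inj E|]; first by left; split.
    by right.
  by move=> [[Aw ->]|[Aw /ltnW]].
rewrite E measureU// in H; last first.
  by apply/seteqP; split => w //= [[_ ->] [_]]; rewrite ltnn.
have {}H : (P (A `&` (rank @^-1` [set m])) + (rank_tail m.+1)%:E * P A = (rank_tail m)%:E * P A)%E.
  by rewrite -H'; exact: H.
have Af : P A \is a fin_num by rewrite fin_num_measure//; exact: mA.
rewrite EFinB muleBl// -H addeK// fin_numM//.
Qed.

Lemma rank_tailE (k : 'I_K) : rank_tail (K - k) = tau k.
Proof.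
rewrite /rank_tail subn_eq0 leqNgt ltn_ord /= leq_subr subKn; last exact: ltnW.
by rewrite valK.
Qed.

End QuantileRank.

Section ProductPair.
Variables (R : realType) (V C : finType).

(** Fubini in the order that freezes the covariate codes [a] and averages over the ranks [r]
    inside. *)
Lemma EP_pair n (mu : 'I_n -> V -> R) (nu : 'I_n -> C -> R) (F : {ffun 'I_n -> V * C} -> R) :
  EP (fun i p => mu i p.1 * nu i p.2) F =
  EP nu (fun a => EP mu (fun r => F [ffun i => (r i, a i)])).
Proof.
rewrite /EP; under [RHS]eq_bigr do rewrite mulr_sumr.
rewrite pair_big /=.
rewrite (reindex (fun p : {ffun 'I_n -> C} * {ffun 'I_n -> V} => [ffun i => (p.2 i, p.1 i)])) /=.
  apply: eq_bigr => -[a r] _ /=; rewrite mulrA; congr (_ * _).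
  rewrite -big_split; apply: eq_bigr => i _ /=; by rewrite ffunE mulrC.
exists (fun m : {ffun 'I_n -> V * C} => ([ffun i => (m i).2], [ffun i => (m i).1])) => [[a r] _|m _] /=.
  by congr pair; apply/ffunP => i; rewrite !ffunE.
by apply/ffunP => i; rewrite !ffunE; case: (m i).
Qed.

End ProductPair.

Section GradientTail.
Variables (R : realType) (d : measure_display) (T : measurableType d) (P : probability T R).

(** Off the crossing sets the score vector is [psi] of the rank. The joint law of rank and covariate
    code factorizes, so the codes can be fixed and [norm_walk_tail] applied with the coefficients
    [x i (rep i (a i))]; its bound is free of [a]. *)
Theorem gradient_tail (n K : nat) (GX GYX : 'I_n -> set (set T)) (y x : 'I_n -> T -> R)
    (q : 'I_n -> 'I_K -> T -> R) (tau : 'I_K -> R) (C z : R) :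
  (0 < n)%N -> (0 < K)%N -> 0 < C -> 0 < z ->
  mutually_independent P (fun i => <<s GYX i >>) ->
  (forall i, GYX i `<=` measurable) -> (forall i, GX i `<=` GYX i) ->
  (forall i, measurable_fun (setT : set (g_sigma_algebraType (GYX i))) (y i)) ->
  (forall i k, measurable_fun (setT : set (g_sigma_algebraType (GX i))) (q i k)) ->
  (forall i, measurable_fun (setT : set (g_sigma_algebraType (GX i))) (x i)) ->
  (forall i w, `|x i w| <= C) ->
  (forall k, 0 < tau k < 1) ->
  (forall k k' : 'I_K, (k < k')%N -> tau k < tau k') ->
  (forall i k A, <<s GX i >> A ->
     P (A `&` [set w | y i w < q i k w]) = ((tau k)%:E * P A)%E) ->
  exists B : set T, [/\ measurable B, fine (P B) <= 4 / 3 * expR (- z ^+ 2) &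
    forall w, C * Num.sqrt (n%:R * K%:R) / 2 + C * Num.sqrt (n%:R * K%:R) * z <
      vnorm (fun k => \sum_i x i w * (tau k - (y i w < q i k w)%R%:R)) -> B w].
Proof.
move=> n0 K0 C0 z0 ind mGYX GXY my mq mx xC tau01 tau_lt quant.
have mGX i : GX i `<=` measurable by move=> A /GXY /mGYX.
have sGXY i A : <<s GX i >> A -> <<s GYX i >> A by exact: sub_sigma_algebra2.
have my' i : measurable_fun setT (y i) by exact: measurable_fun_g_sigma (my i).
pose Q := C * Num.sqrt (n%:R * K%:R).
have Q0 : 0 < Q by rewrite mulr_gt0// sqrtr_gt0 mulr_gt0 ?ltr0n.
(* This slack raises the exponent by exactly [1 / 4], and expR (1/4) <= 4/3. *)
pose delta := Q / (8 * z).
have delta0 : 0 < delta by rewrite divr_gt0// mulr_gt0.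
have nK0 : 0 < n%:R * Num.sqrt K%:R :> R by rewrite mulr_gt0 ?sqrtr_gt0 ?ltr0n.
(* Discretizing the [n] coefficients by [h] moves a vector with [K] entries by at most [delta] in
   norm. *)
pose h := delta / (n%:R * Num.sqrt K%:R).
have h0 : 0 < h by rewrite divr_gt0.
have [m mV] := exists_bits C h0.
pose V : finType := 'I_K.+1; pose W : finType := {ffun 'I_m -> bool}.
pose c i w : W := bits C h m (x i w).
have Gc i a : <<s GX i >> (c i @^-1` [set a]).
  exact: (@measurable_bits R _ (g_sigma_algebraType (GX i))).
pose rep i (a : W) : T := xget point (c i @^-1` [set a]).
have close i w : `|x i w - x i (rep i (c i w))| <= h.
  apply: (bits_close h0 mV) => //.
  by rewrite -/(c i _) -/(c i _) /rep; case: xgetP => [s -> /= ->|/(_ w)/(_ erefl)].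
pose rk i w : V := rank (y i) (q i) w.
have Grk i (r : V) : <<s GYX i >> (rk i @^-1` [set r]).
  apply: (@measurable_rank R _ (g_sigma_algebraType (GYX i)) K (GX i) (y i) (q i)) => //.
  by move=> A /GXY; exact: sub_sigma_algebra.
pose D i w : V * W := (rk i w, c i w).
have GD i p : <<s GYX i >> (D i @^-1` [set p]).
  have -> : D i @^-1` [set p] = (rk i @^-1` [set p.1]) `&` (c i @^-1` [set p.2]).
    by apply/seteqP; case: p => a b; split => w /=; rewrite /D => -[E1 E2]; [split | rewrite E1 E2].
  apply: (@measurableI _ (g_sigma_algebraType (GYX i))); first exact: Grk.
  by apply: sGXY; exact: Gc.
have mD i p : measurable (D i @^-1` [set p]) by apply: (g_sigma_sub (mGYX i)); exact: GD.
pose mu (r : V) : R := rank_tail tau r - rank_tail tau r.+1.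
pose nu i (a : W) : R := fine (P (c i @^-1` [set a])).
have law i p : fine (P (D i @^-1` [set p])) = mu p.1 * nu i p.2.
  have -> : D i @^-1` [set p] = (c i @^-1` [set p.2]) `&` (rk i @^-1` [set p.1]).
    by apply/seteqP; case: p => a b; split => w /=; rewrite /D => -[E1 E2]; [split | rewrite E1 E2].
  rewrite (rank_law (mGX i) (my' i) (mq i) tau_lt (quant i))// fineM// fin_num_measure//.
  by apply: (g_sigma_sub (mGX i)); exact: Gc.
have nu0 i a : 0 <= nu i a by exact: fine_ge0.
have mc i a : measurable (c i @^-1` [set a]) by apply: (g_sigma_sub (mGX i)); exact: Gc.
have nu1 i : \sum_a nu i a = 1 by exact: partition_sum.
(* The law of the rank is the same for all observations; reading it at one of them shows that [mu]
   is a probability. *)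
pose i0 := Ordinal n0.
have mrk r : measurable (rk i0 @^-1` [set r]) by apply: (g_sigma_sub (mGYX i0)); exact: Grk.
have muE r : mu r = fine (P (rk i0 @^-1` [set r])).
  have GT : <<s GX i0 >> setT by exact: (@measurableT _ (g_sigma_algebraType (GX i0))).
  have := rank_law (mGX i0) (my' i0) (mq i0) tau_lt (quant i0) r GT.
  rewrite setTI => ->; rewrite fineM ?fin_num_measure//=.
  by rewrite (congr1 fine (probability_setT P)) mulr1.
have mu0 r : 0 <= mu r by rewrite muE; exact: fine_ge0.
have mu1 : \sum_r mu r = 1.
  by rewrite -(partition_sum P mrk); apply: eq_bigr => r _; exact: muE.
pose psi (r : V) (k : 'I_K) : R := tau k - (K <= k + r)%N%:R.
have mu_ind (k : 'I_K) : \sum_r mu r * (K <= k + r)%N%:R = tau k.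
  (* Summing point masses beyond [j] gives back a tail, here [rank_tail (K - k)], which is
     [tau k]. *)
  have telescope (e : nat -> R) j l : (j <= l)%N ->
      \sum_(r < l) (e r - e r.+1) * (j <= r)%N%:R = e j - e l.
    elim: l => [|l IH]; first by rewrite leqn0 big_ord0 => /eqP ->; rewrite subrr.
    rewrite leq_eqVlt => /predU1P[->|jl].
      by rewrite subrr big1// => r _; rewrite leqNgt ltn_ord mulr0.
    by rewrite big_ord_recr /= IH// -ltnS jl mulr1; ring.
  have kK : (K - k <= K.+1)%N by lia.
  transitivity (rank_tail tau (K - k) - rank_tail tau K.+1); last first.
    by rewrite rank_tailE /rank_tail ltnn subr0.
  rewrite -(telescope _ _ _ kK); apply: eq_bigr => r _.
  by rewrite leq_subLR.
have psi_diff r r' k : `|psi r k - psi r' k| <= 1.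
  rewrite /psi; case: (K <= k + r)%N; case: (K <= k + r')%N => /=; rewrite ler_norml; apply/andP; split; lra.
have psi_mean k : \sum_r mu r * psi r k = 0.
  under eq_bigr do rewrite mulrBr.
  by rewrite sumrB mu_ind wsum_cst// subrr.
have psi_var k : \sum_r mu r * psi r k ^+ 2 <= 1 / 4.
  rewrite (eq_bigr (fun r => mu r * tau k ^+ 2 + (1 - 2 * tau k) * (mu r * (K <= k + r)%N%:R))); last first.
    by move=> r _; rewrite /psi; case: (K <= k + r)%N => /=; ring.
  rewrite big_split /= -mulr_sumr mu_ind wsum_cst//.
  by have := sqr_ge0 (2 * tau k - 1); nra.
have C_rep a i : `|x i (rep i (a i))| <= C by [].
pose F (p : {ffun 'I_n -> V * W}) : bool :=
  Q / 2 + Q * z - delta <= vnorm (fun k => \sum_i x i (rep i (p i).2) * psi (p i).1 k).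
pose DD w : {ffun 'I_n -> V * W} := [ffun i => D i w].
have mDD p : measurable (DD @^-1` [set p]).
  apply: measurable_ffun_pre => i b.
  rewrite (_ : _ @^-1` _ = D i @^-1` [set b])//.
  by apply/seteqP; split => w /=; rewrite ffunE.
have mF : measurable [set w | F (DD w)] by exact: measurable_pred_fin.
have PF : fine (P [set w | F (DD w)]) <= 4 / 3 * expR (- z ^+ 2).
  rewrite prob_partition//.
  rewrite (eq_bigr (fun p : {ffun 'I_n -> V * W} => (\prod_i (mu (p i).1 * nu i (p i).2)) * (F p)%:R)); last first.
    by move=> p _; rewrite (indep_law _ ind GD); congr (_ * _); apply: eq_bigr => i _; exact: law.
  rewrite -[leLHS]/(EP (fun i p => mu p.1 * nu i p.2) (fun p => (F p)%:R)) (@EP_pair R V W n (fun=> mu) nu).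
  rewrite -[leRHS](EP_cst nu1); apply: le_EP => // a.
  have I0 : (0 < #|'I_K|)%N by rewrite card_ord.
  have := norm_walk_tail mu0 mu1 psi_diff psi_mean psi_var n0 I0 C0 z0 (C_rep a) delta.
  rewrite card_ord -/Q => H.
  apply: (@le_trans _ _ (expR (- z ^+ 2 + 2 * z / Q * delta))).
    apply: le_trans H; rewrite le_eqVlt; apply/orP; left; apply/eqP; apply: eq_EP => r.
    congr (nat_of_bool _)%:R; congr (_ <= _); apply: eq_vnorm => k.
    by apply: eq_bigr => i _; rewrite ffunE.
  rewrite expRD mulrC; apply: ler_wpM2r; first exact: expR_ge0.
  rewrite (_ : 2 * z / Q * delta = 1 / 4); last by rewrite /delta; field; rewrite !gt_eqF.
  have := expR_ge1Dx (- (1 / 4) : R).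
  have := expRD (1 / 4) (- (1 / 4) : R); rewrite subrr expR0.
  by have := expR_gt0 (1 / 4 : R); nra.
(* The indicators need not be determined by the rank where curves cross, so this null set is added
   to the exceptional event. *)
pose N := \bigcup_(i in [set: 'I_n]) crossing_set (q i).
have mN : measurable N.
  by apply: fin_bigcup_measurable => // i _; exact: measurable_crossing_set (mGX i) (mq i).
have PN : P N = 0%E.
  apply/eqP; rewrite -measure_le0.
  have := @content_sub_fsum _ R T P _ [set: 'I_n] N (fun i => crossing_set (q i)).
  rewrite fsbig1; last first.
    by move=> i _; exact: (crossing_set0 (mGX i) (my' i) (mq i) tau_lt (quant i)).
  apply => //; first exact: finite_finset.
  by move=> i _; exact: measurable_crossing_set (mGX i) (mq i).
exists ([set w | F (DD w)] `|` N); split.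
- exact: measurableU.
- apply: le_trans PF; rewrite fine_le ?fin_num_measure//; first exact: measurableU.
  have PN' : (P N <= 0)%E by rewrite PN.
  apply: le_trans (measureU2 _ mF mN) _; rewrite -[leRHS]adde0.
  by apply: leeD => //; exact: PN'.
move=> w Hw; have [Nw|Nw] := pselect (N w); [by right | left].
rewrite /= /F.
have rkE i (k : 'I_K) : (K <= k + rk i w)%N = (y i w < q i k w).
  by apply: rankE => H; apply: Nw; exists i.
pose u (k : 'I_K) := \sum_i x i w * (tau k - (y i w < q i k w)%R%:R).
pose u' (k : 'I_K) := \sum_i x i (rep i (DD w i).2) * psi (DD w i).1 k.
have uu : vnorm u - vnorm u' <= delta.
  apply: (le_trans (vnormB _ _)).
  have -> : delta = Num.sqrt #|'I_K|%:R * (n%:R * h).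
    by rewrite card_ord /h; field; rewrite !gt_eqF ?sqrtr_gt0 ?ltr0n.
  apply: vnorm_le_const; first by rewrite mulr_ge0// ltW.
  move=> k; rewrite /u /u' -sumrB; apply: (le_trans (ler_norm_sum _ _ _)).
  rewrite mulr_natl -[X in _ *+ X](card_ord n) -sumr_const; apply: ler_sum => i _.
  rewrite /DD ffunE /= /psi rkE -mulrBl normrM -[leRHS]mulr1; apply: ler_pM => //.
  have /andP[t0 t1] := tau01 k.
  by case: (y i w < q i k w) => /=; rewrite ler_norml; apply/andP; split; lra.
have {}Hw : Q / 2 + Q * z < vnorm u by [].
by rewrite -/u'; lra.
Qed.

End GradientTail.

(** * Deterministic analysis of the minimizer *)

Section Deterministic.
Variables (R : realType) (n K p : nat) (tau : 'I_K -> R) (lam : R).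
Variables (y : 'I_n -> R) (x : 'I_n -> 'I_p.+1 -> R) (b : 'M[R]_(K, p.+1)).
Implicit Types D : 'M[R]_(K, p.+1).
Hypothesis n_gt0 : (0 < n)%N.
Hypothesis lam_gt0 : 0 < lam.
Hypothesis tau01 : forall k, 0 < tau k < 1.

Lemma xdotD (z : 'I_p.+1 -> R) D D' k : xdot z (D + D') k = xdot z D k + xdot z D' k.
Proof. by rewrite /xdot -big_split; apply: eq_bigr => j _; rewrite mxE mulrDr. Qed.

Lemma xdotZ (z : 'I_p.+1 -> R) t D k : xdot z (t *: D) k = t * xdot z D k.
Proof. by rewrite /xdot mulr_sumr; apply: eq_bigr => j _; rewrite mxE mulrCA. Qed.

Lemma group_normE D j : group_norm D j = vnorm (fun k => D k j).
Proof. by []. Qed.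

Lemma l2norm_group D : l2norm D ^+ 2 = \sum_j group_norm D j ^+ 2.
Proof.
rewrite sqr_sqrtr; last by apply: sumr_ge0 => k _; exact: (sumsq_ge0 (fun j => D k j)).
by rewrite exchange_big; apply: eq_bigr => j _; rewrite group_normE vnorm_sq.
Qed.

Lemma l2norm_ge0 D : 0 <= l2norm D. Proof. exact: sqrtr_ge0. Qed.

Lemma l2normZ t D : l2norm (t *: D) = `|t| * l2norm D.
Proof.
rewrite /l2norm -sqrtr_sqr -sqrtrM ?sqr_ge0//; congr Num.sqrt.
rewrite mulr_sumr; apply: eq_bigr => k _; rewrite mulr_sumr; apply: eq_bigr => j _.
by rewrite mxE exprMn.
Qed.

Lemma Sbar_split (F : 'I_p.+1 -> R) :
  \sum_(j in Sbar b) F j = F ord0 + \sum_(j in Sact b) F j.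
Proof.
rewrite (bigD1 ord0) /=; last by rewrite inE eqxx.
by congr (_ + _); apply: eq_bigl => j; rewrite !inE; case: (j == ord0) => //=; rewrite andbT.
Qed.

Lemma Sact_sum_le D : \sum_(j in Sact b) group_norm D j <= Num.sqrt #|Sact b|%:R * l2norm D.
Proof.
apply: sum_sq_le; first exact: l2norm_ge0.
by rewrite l2norm_group.
Qed.

Lemma Sbar_sum_le D :
  \sum_(j in Sbar b) group_norm D j <= Num.sqrt (#|Sact b|%:R + 1) * l2norm D.
Proof.
have -> : #|Sact b|%:R + 1 = #|Sbar b|%:R :> R.
  rewrite -!sum1_card !natr_sum addrC -[X in X + _]/(1%:R).
  exact/esym/(Sbar_split (fun=> 1%:R)).
apply: sum_sq_le; first exact: l2norm_ge0.
by rewrite l2norm_group.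
Qed.

Let loss D := \sum_(k < K) \sum_(i < n) check_loss (tau k) (y i - xdot (x i) D k).
Let pen D := \sum_(j < p.+1 | j != ord0) group_norm D j.

Let LobjE D : Lobj tau lam y x D = n%:R^-1 * loss D + lam * pen D.
Proof. by []. Qed.

(** Decomposability: outside [Sbar b] the columns of [b] vanish and the penalty changes by the full
    norm of [D]; on the active groups the triangle inequality applies. The intercept is unpenalized,
    hence [Sact] in the second sum. *)
Lemma penalty_diff D :
  \sum_(j in ~: Sbar b) group_norm D j - \sum_(j in Sact b) group_norm D j <=
  pen (b + D) - pen b.
Proof.
have bj j : j \notin Sact b -> j != ord0 -> forall k, b k j = 0.
  rewrite inE negb_and negbK => /orP[->//|]; rewrite negbK => /eqP b0 _ k.
  have := vnorm_coord (fun k => b k j) k; rewrite -group_normE b0 normr_le0.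
  by move/eqP.
have pen_split D' : pen D' = \sum_(j in ~: Sbar b) group_norm D' j + \sum_(j in Sact b) group_norm D' j.
  rewrite /pen (bigID (mem (Sact b))) /= addrC; congr (_ + _); apply: eq_bigl => j; rewrite !inE;
  by case: (j == ord0) => //=; rewrite ?andbT ?andbF.
rewrite !pen_split.
have -> : \sum_(j in ~: Sbar b) group_norm b j = 0.
  apply: big1 => j; rewrite !inE negb_or negbK => /andP[_ /eqP]; exact.
have -> : \sum_(j in ~: Sbar b) group_norm (b + D) j = \sum_(j in ~: Sbar b) group_norm D j.
  apply: eq_bigr => j; rewrite !inE negb_or => /andP[j0 bj0].
  rewrite !group_normE; apply: eq_vnorm => k; rewrite mxE (bj j) ?add0r//.
  by rewrite inE j0.
rewrite add0r -addrA lerD2l -sumrB -sumrN; apply: ler_sum => j _.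
rewrite lerNl opprB.
apply: le_trans (vnormB _ _) _; rewrite group_normE.
rewrite -vnormN (eq_vnorm (v := fun k => D k j))// => k; rewrite mxE; ring.
Qed.

Hypothesis grad : forall j,
  vnorm (fun k => \sum_i x i j * (tau k - (y i < xdot (x i) b k)%R%:R)) <= n%:R * (lam / 2).

(** The subgradient inequality is summed and regrouped by predictor; Cauchy-Schwarz over the levels
    then pairs each group of [D] with the gradient group bounded by [grad]. *)
Lemma loss_diff_lower D :
  - (n%:R * (lam / 2)) * \sum_j group_norm D j <= loss (b + D) - loss b.
Proof.
apply: (@le_trans _ _ (\sum_(k < K) \sum_(i < n) - xdot (x i) D k * (tau k - (y i < xdot (x i) b k)%R%:R))).
  rewrite (eq_bigr (fun k => \sum_(j < p.+1) \sum_(i < n) - (x i j * D k j * (tau k - (y i < xdot (x i) b k)%R%:R)))); last first.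
    move=> k _; rewrite exchange_big; apply: eq_bigr => i _.
    by rewrite sumrN -mulr_suml mulNr.
  rewrite exchange_big mulr_sumr; apply: ler_sum => j _.
  rewrite (eq_bigr (fun k => - (D k j * \sum_i x i j * (tau k - (y i < xdot (x i) b k)%R%:R)))); last first.
    by move=> k _; rewrite sumrN mulr_sumr; congr (- _); apply: eq_bigr => i _; ring.
  rewrite sumrN mulNr lerN2; apply: le_trans (cauchy_schwarz _ _) _.
  rewrite mulrC; apply: ler_wpM2r; first exact: vnorm_ge0.
  exact: grad.
rewrite /loss -sumrB; apply: ler_sum => k _; rewrite -sumrB; apply: ler_sum => i _.
have := check_subgradient (y i - xdot (x i) b k) (xdot (x i) D k) (tau01 k).
by rewrite xdotD subr_lt0 opprD addrA mulNr; lra.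
Qed.

(** With g0, e2, e1 the norm sums over the intercept, the active groups and the rest, the two
    differences give e1 - e2 <= (g0 + e2 + e1) / 2, so e1 <= g0 + 3 e2, inside the cone of aperture
    3. *)
Lemma descent_in_cone D : Lobj tau lam y x (b + D) <= Lobj tau lam y x b -> cone b D.
Proof.
rewrite !LobjE => H; rewrite /cone /=.
have nr : 0 < n%:R :> R by rewrite ltr0n.
have H1 := loss_diff_lower D; have H2 := penalty_diff D.
have {}H1 : - (lam / 2) * \sum_j group_norm D j <= n%:R^-1 * loss (b + D) - n%:R^-1 * loss b.
  by rewrite -mulrBr ler_pdivlMl// mulrA mulrN.
have all : \sum_j group_norm D j = \sum_(j in Sbar b) group_norm D j + \sum_(j in ~: Sbar b) group_norm D j.
  by rewrite (bigID (mem (Sbar b))) /=; congr (_ + _); apply: eq_bigl => j; rewrite finset.in_setC.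
have g0 : 0 <= group_norm D ord0 by exact: sqrtr_ge0.
rewrite all in H1; rewrite Sbar_split in H1 *.
have {}H2 : lam * (\sum_(j in ~: Sbar b) group_norm D j - \sum_(j in Sact b) group_norm D j)
   <= lam * (pen (b + D) - pen b) by rewrite ler_pM2l.
rewrite -(ler_pM2l lam_gt0).
move: H1 H2 H; move: (\sum_(j in ~: _) _) (\sum_(j in Sact _) _) => e1 e2.
have l0 := lam_gt0.
have := mulr_ge0 (ltW l0) g0; lra.
Qed.

Lemma Lobj_convex D t : 0 <= t <= 1 ->
  Lobj tau lam y x (b + t *: D) <=
  Lobj tau lam y x b + t * (Lobj tau lam y x (b + D) - Lobj tau lam y x b).
Proof.
move=> t01; rewrite !LobjE.
have nr : 0 <= n%:R^-1 :> R by rewrite invr_ge0.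
have H1 : loss (b + t *: D) <= loss b + t * (loss (b + D) - loss b).
  rewrite /loss -sumrB mulr_sumr -big_split; apply: ler_sum => k _ /=.
  rewrite -sumrB mulr_sumr -big_split; apply: ler_sum => i _ /=.
  have := check_convex (y i - xdot (x i) b k) (y i - xdot (x i) (b + D) k) (tau01 k) t01.
  congr (check_loss _ _ <= _); rewrite !xdotD xdotZ; ring.
have H2 : pen (b + t *: D) <= pen b + t * (pen (b + D) - pen b).
  rewrite /pen -sumrB mulr_sumr -big_split; apply: ler_sum => j _ /=.
  rewrite !group_normE; move/andP: t01 => [t0 t1].
  have := vnormD (fun k => (1 - t) * b k j) (fun k => t * (b + D) k j).
  rewrite !vnormZ (ger0_norm t0) ger0_norm ?subr_ge0//.
  rewrite (eq_vnorm (v := fun k => (b + t *: D) k j)); last by move=> k; rewrite !mxE; ring.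
  by lra.
have := ler_wpM2l nr H1; have := ler_wpM2l (ltW lam_gt0) H2; nra.
Qed.

(** At distance exactly [r] the penalty can fall only through the active groups, by at most
    [lam * sqrt s * r]. A loss growth [kappa] above this contradicts the descent obtained by
    shrinking [bh - b] to norm [r]. *)
Theorem minimizer_bound (r kappa : R) (bh : 'M[R]_(K, p.+1)) :
  0 < r -> is_minimizer tau lam y x bh ->
  (forall D, cone b D -> l2norm D = r -> n%:R * kappa <= loss (b + D) - loss b) ->
  lam * (Num.sqrt #|Sact b|%:R * r) < kappa ->
  l2norm (bh - b) <= r.
Proof.
move=> r0 bh_min rsc kr; rewrite leNgt; apply/negP => rlt.
have l0 : 0 < l2norm (bh - b) by exact: lt_trans rlt.
pose t := r / l2norm (bh - b).
have t01 : 0 <= t <= 1.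
  by apply/andP; split; [apply: divr_ge0; exact: ltW | rewrite ler_pdivrMr// mul1r ltW].
pose D := t *: (bh - b).
have Dr : l2norm D = r.
  rewrite /D l2normZ ger0_norm; last by case/andP: t01.
  by rewrite /t divfK// gt_eqF.
have desc : Lobj tau lam y x (b + D) <= Lobj tau lam y x b.
  apply: (le_trans (Lobj_convex (bh - b) t01)).
  rewrite [b + _]addrC subrK gerDl; case/andP: t01 => t0 _.
  by rewrite mulr_ge0_le0// subr_le0; exact: bh_min.
have cD := descent_in_cone desc.
have nr : 0 < n%:R :> R by rewrite ltr0n.
have H1 : kappa <= n%:R^-1 * loss (b + D) - n%:R^-1 * loss b.
  by rewrite -mulrBr ler_pdivlMl//; exact: rsc.
have H2 := penalty_diff D.
have H3 : 0 <= \sum_(j in ~: Sbar b) group_norm D j.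
  by apply: sumr_ge0 => j _; exact: sqrtr_ge0.
have H4 := Sact_sum_le D; rewrite Dr in H4.
move: desc; rewrite !LobjE leNgt => /negP; apply.
have : lam * (- (Num.sqrt #|Sact b|%:R * r)) <= lam * (pen (b + D) - pen b).
  by rewrite ler_pM2l//; lra.
by lra.
Qed.

End Deterministic.

(** * Empirical process and population loss *)

Section Net.
Variable R : realType.

(** One point of the ball is picked in each grid cell that meets it, so the net keeps the radius
    [M]; the default, the zero vector, also lies in the ball. *)
Lemma l1_net q (M eta : R) : 0 <= M -> 0 < eta ->
  exists (J : finType) (D : J -> 'I_q.+1 -> R), (forall t, \sum_j `|D t j| <= M) /\
    forall v, \sum_j `|v j| <= M -> exists t, \sum_j `|v j - D t j| <= eta.
Proof.
move=> M0 eta0.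
pose h := eta / q.+1%:R; have h0 : 0 < h by rewrite divr_gt0// ltr0n.
have [m mV] := exists_bits M h0.
pose J : finType := {ffun 'I_q.+1 -> {ffun 'I_m -> bool}}.
pose S (t : J) : set ('I_q.+1 -> R) :=
  [set v | \sum_j `|v j| <= M /\ forall j, bits M h m (v j) = t j].
pose D t := xget (fun=> 0) (S t).
exists J, D; split => [t|v vM].
  rewrite /D; case: xgetP => [v -> [] //|_].
  by rewrite big1// => j _; rewrite normr0.
have coord (u : 'I_q.+1 -> R) j : \sum_j `|u j| <= M -> `|u j| <= M.
  by apply: le_trans; rewrite (bigD1 j)//= lerDl; apply: sumr_ge0.
pose t : J := [ffun j => bits M h m (v j)]; exists t.
have [uM ut] : S t (D t).
  rewrite /D; case: xgetP => [u -> //|/(_ v)]; case; split => // j; by rewrite ffunE.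
have -> : eta = \sum_(j < q.+1) h.
  by rewrite sumr_const card_ord -[_ *+ q.+1]mulr_natr /h divfK.
apply: ler_sum => j _; apply: (bits_close h0 mV); [exact: coord|exact: coord|].
by rewrite ut ffunE.
Qed.

End Net.

Section Moments.
Variables (R : realType) (d : measure_display) (T : measurableType d) (P : probability T R).

(** The generators inside [gen_sigma], named apart because [g_sigma_algebraType] takes a generating
    family. *)
Definition sigma_gens m (Z : 'I_m -> T -> R) : set (set T) :=
  [set A | exists j B, measurable B /\ A = Z j @^-1` B].

Lemma measurable_sigma_gens m (Z : 'I_m -> T -> R) j :
  measurable_fun (setT : set (g_sigma_algebraType (sigma_gens Z))) (Z j).
Proof. by move=> _ B mB; rewrite setTI; apply: sub_sigma_algebra; exists j, B. Qed.

Lemma sigma_gens_measurable m (Z : 'I_m -> T -> R) :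
  (forall j, measurable_fun setT (Z j)) -> sigma_gens Z `<=` measurable.
Proof. by move=> mZ A [j [B [mB ->]]]; rewrite -[X in measurable X]setTI; exact: mZ. Qed.

Lemma measurable_xdot d' (T' : measurableType d') K p (X : T' -> 'I_p.+1 -> R) (D : 'M[R]_(K, p.+1)) k :
  (forall j, measurable_fun setT (fun w => X w j)) -> measurable_fun setT (fun w => xdot (X w) D k).
Proof. by move=> mX; apply: measurable_sum => j; apply: measurable_funM. Qed.

Lemma xdot_bound K p (x : 'I_p.+1 -> R) (D : 'M[R]_(K, p.+1)) k C : (forall j, `|x j| <= C) ->
  `|xdot x D k| <= C * \sum_j `|D k j|.
Proof.
move=> xC; rewrite mulr_sumr; apply: (le_trans (ler_norm_sum _ _ _)).
by apply: ler_sum => j _; rewrite normrM ler_wpM2r.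
Qed.

Lemma quad_form_Ex K p (X : T -> 'I_p.+1 -> R) (D : 'M[R]_(K, p.+1)) k C :
  (forall j, measurable_fun setT (fun w => X w j)) -> (forall j w, `|X w j| <= C) ->
  quad_form P X (fun j => D k j) = Ex P (fun w => xdot (X w) D k ^+ 2).
Proof.
move=> mX XC.
have bX j : bm (fun w => X w j) by split => //; exists C.
have bXX j l : bm (fun w => X w j * X w l) by exact: bmM.
have -> : (fun w => xdot (X w) D k ^+ 2) =
    (fun w => \sum_j \sum_l (D k j * D k l) * (X w j * X w l)).
  apply/funext => w; rewrite expr2 /xdot mulr_suml; apply: eq_bigr => j _.
  by rewrite mulr_sumr; apply: eq_bigr => l _; ring.
rewrite Ex_sum; last by move=> j; apply: bm_sum => l; exact: bmZ.
apply: eq_bigr => j _; rewrite Ex_sum; last by move=> l; exact: bmZ.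
by apply: eq_bigr => l _; rewrite ExZ//; ring.
Qed.

(* When [Bk <= 0] or [A3 = 0] the right-hand side of the last hypothesis is [<= 0]
   because [x / 0 = 0], which [0 < dt] excludes. *)
Lemma moment_ratio (c1 c2 dt Bk A2 A3 nv : R) (E : set R) :
  0 < c1 -> 0 < c2 -> 0 < dt -> 0 <= A2 -> 0 <= A3 -> 0 <= nv -> nv < dt ->
  (forall e, E e -> 0 <= e) -> E (A2 `^ (3 / 2) / A3) ->
  A2 <= Bk * nv ^+ 2 ->
  dt <= c1 / (c2 * Num.sqrt Bk) * inf E ->
  c2 * A3 <= c1 * A2.
Proof.
move=> c10 c20 dt0 A20 A30 nv0 nvdt E0 EA AB H.
have infle : inf E <= A2 `^ (3 / 2) / A3.
  by apply: ge_inf => //; exists 0 => e; exact: E0.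
have [B0|B0] := leP Bk 0.
  by move: H; rewrite ler0_sqrtr// mulr0 invr0 mulr0 mul0r => /(lt_le_trans dt0); rewrite ltxx.
have sB : 0 < Num.sqrt Bk by rewrite sqrtr_gt0.
have {}H : dt <= c1 / (c2 * Num.sqrt Bk) * (A2 `^ (3 / 2) / A3).
  by apply: (le_trans H); apply: ler_wpM2l => //; rewrite divr_ge0 ?mulr_ge0// ltW.
have A3p : 0 < A3.
  rewrite lt_neqAle A30 andbT; apply/eqP => A3E.
  by move: H; rewrite -A3E invr0 !mulr0 => /(lt_le_trans dt0); rewrite ltxx.
have pE : A2 `^ (3 / 2) = A2 * Num.sqrt A2.
  have -> : 3 / 2 = 1 + 2^-1 :> R by field.
  rewrite powRD; last by apply/implyP => /eqP; lra.
  by rewrite powRr1// powR12_sqrt.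
rewrite pE in H.
(* The extra root of the second moment is at most [sqrt Bk * nv]; with [nv < dt] it cancels the
   factor [dt / sqrt Bk] of the condition. *)
have s2 : Num.sqrt A2 <= Num.sqrt Bk * nv.
  by rewrite -(ger0_norm nv0) -sqrtr_sqr -(sqrtrM _ (ltW B0)); exact: ler_wsqrtr.
have H1 : dt * (c2 * Num.sqrt Bk * A3) <= c1 * (A2 * Num.sqrt A2).
  move: H; rewrite mulrACA -invfM ler_pdivlMr//.
  by rewrite !mulr_gt0.
have H2 : c1 * (A2 * Num.sqrt A2) <= c1 * A2 * (Num.sqrt Bk * dt).
  rewrite mulrA; apply: ler_wpM2l; first by rewrite mulr_ge0// ltW.
  apply: (le_trans s2); rewrite ler_pM2l//; exact: ltW.
have H3 := le_trans H1 H2.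
move: sB H3; move: (Num.sqrt Bk) => sq sq0 H3.
have : (sq * dt) * (c2 * A3) <= (sq * dt) * (c1 * A2).
  have -> : (sq * dt) * (c2 * A3) = dt * (c2 * sq * A3) by ring.
  by have -> : (sq * dt) * (c1 * A2) = c1 * A2 * (sq * dt) by ring.
by rewrite ler_pM2l// mulr_gt0.
Qed.

End Moments.

(** * Empirical deviation and curvature in the quantile model *)

Section QuantileModel.
Variables (R : realType) (d : measure_display) (T : measurableType d) (P : probability T R).
Variables (K n p : nat) (tau : 'I_K -> R) (Cx c1 c2 bt dt : R).
Variables (y : 'I_n -> T -> R) (X : 'I_n -> T -> 'I_p.+1 -> R).
Variables (f : 'I_n -> ('I_p.+1 -> R) -> R -> R) (b : 'M[R]_(K, p.+1)) (bk Bk : 'I_K -> R).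
Hypothesis tau01 : forall k, 0 < tau k < 1.
Hypothesis Cx_gt0 : 0 < Cx.
Hypothesis y_meas : forall i, measurable_fun setT (y i).
Hypothesis X_meas : forall i j, measurable_fun setT (fun w => X i w j).
Hypothesis X_bnd : forall i j w, `|X i w j| < Cx.

Definition gens_X i := sigma_gens (fun j w => X i w j).
Definition gens_YX i := sigma_gens (fun j : 'I_p.+2 =>
  match unlift ord0 j with None => y i | Some j' => fun w => X i w j' end).

Lemma gens_X_measurable i : gens_X i `<=` measurable.
Proof. by apply: sigma_gens_measurable => j; exact: X_meas. Qed.

Lemma gens_YX_measurable i : gens_YX i `<=` measurable.
Proof. by apply: sigma_gens_measurable => j; case: unlift => [j'|]. Qed.

Lemma gens_XYX i : gens_X i `<=` gens_YX i.
Proof. by move=> A [j [B [mB ->]]]; exists (lift ord0 j), B; rewrite liftK. Qed.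

Lemma measurable_gX_X i j : measurable_fun (setT : set (g_sigma_algebraType (gens_X i))) (fun w => X i w j).
Proof. exact: (@measurable_sigma_gens R _ T _ (fun j w => X i w j) j). Qed.

Lemma measurable_gYX_X i j : measurable_fun (setT : set (g_sigma_algebraType (gens_YX i))) (fun w => X i w j).
Proof.
have := @measurable_sigma_gens R _ T _ (fun j : 'I_p.+2 =>
  match unlift ord0 j with None => y i | Some j' => fun w => X i w j' end) (lift ord0 j).
by rewrite liftK.
Qed.

Lemma measurable_gYX_y i : measurable_fun (setT : set (g_sigma_algebraType (gens_YX i))) (y i).
Proof.
have := @measurable_sigma_gens R _ T _ (fun j : 'I_p.+2 =>
  match unlift ord0 j with None => y i | Some j' => fun w => X i w j' end) ord0.
by rewrite unlift_none.
Qed.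

Let X_le i j w : `|X i w j| <= Cx.
Proof. exact: ltW. Qed.

Definition loss_gap (D : 'M[R]_(K, p.+1)) (k : 'I_K) (i : 'I_n) (w : T) : R :=
  check_loss (tau k) (y i w - xdot (X i w) b k - xdot (X i w) D k) -
  check_loss (tau k) (y i w - xdot (X i w) b k).

Lemma measurable_loss_gap d' (T' : measurableType d') (yi : T' -> R) (Xi : T' -> 'I_p.+1 -> R) D k :
  measurable_fun setT yi -> (forall j, measurable_fun setT (fun w => Xi w j)) ->
  measurable_fun setT (fun w => check_loss (tau k) (yi w - xdot (Xi w) b k - xdot (Xi w) D k) -
     check_loss (tau k) (yi w - xdot (Xi w) b k)).
Proof.
move=> my mX; have mx E : measurable_fun setT (fun w => xdot (Xi w) E k) by exact: measurable_xdot.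
by apply: measurable_funB; apply: measurable_check_loss => //; do ?apply: measurable_funB.
Qed.

Lemma loss_gap_lip D D' k i w :
  `|loss_gap D k i w - loss_gap D' k i w| <= `|xdot (X i w) D k - xdot (X i w) D' k|.
Proof.
rewrite /loss_gap [X in `|X|](_ : _ = check_loss (tau k) (y i w - xdot (X i w) b k - xdot (X i w) D k) -
  check_loss (tau k) (y i w - xdot (X i w) b k - xdot (X i w) D' k)); last by ring.
apply: le_trans (check_lipschitz _ _ (tau01 k)) _.
by rewrite distrC le_eqVlt; apply/orP; left; apply/eqP; congr `|_|; ring.
Qed.

Lemma loss_gap_abs D k i w : `|loss_gap D k i w| <= `|xdot (X i w) D k|.
Proof.
apply: le_trans (check_lipschitz _ _ (tau01 k)) _.
by rewrite addrAC subrr add0r normrN.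
Qed.

Lemma bm_loss_gap D k i : bm (loss_gap D k i).
Proof.
split; first by apply: measurable_loss_gap => // j; exact: X_meas.
exists (Cx * \sum_j `|D k j|) => w; apply: (le_trans (loss_gap_abs _ _ _ _)).
exact: xdot_bound.
Qed.

(** Passing from the net to any [D] changes the sample gap and its mean by at most [eta / 2] each,
    which together with the [2 * eta] on the net makes [3 * eta]. *)
Theorem empirical_event (k : 'I_K) (M eta : R) : 0 < M -> 0 < eta ->
  mutually_independent P (fun i => <<s gens_YX i >>) ->
  exists B : set T, [/\ measurable B,
    fine (P B) <= 2 * p.+1%:R * expR (- (n%:R * (eta ^+ 2 / (8 * M ^+ 2 * Cx ^+ 2)))) &
    forall w, ~ B w -> forall D : 'M[R]_(K, p.+1), \sum_j `|D k j| <= M ->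
      \sum_i Ex P (loss_gap D k i) - n%:R * (3 * eta) <= \sum_i loss_gap D k i w].
Proof.
move=> M0 eta0 ind.
have e0 : 0 < eta / (2 * Cx) by rewrite divr_gt0// mulr_gt0.
have [J [D0 [D0M net]]] := l1_net p (ltW M0) e0.
(* Only row [k] is read, so every row is given the same net point. *)
pose Dm t : 'M[R]_(K, p.+1) := \matrix_(k', j) D0 t j.
have DmE t i w : xdot (X i w) (Dm t) k = \sum_j X i w j * D0 t j.
  by apply: eq_bigr => j _; rewrite mxE.
have [B [mB PB HB]] := @empirical_tail_measure R d T P n p J gens_YX (fun i t => loss_gap (Dm t) k i)
  (fun i j w => X i w j) D0 M Cx eta ind gens_YX_measurable
  (fun i t => measurable_loss_gap (Dm t) k (@measurable_gYX_y i) (@measurable_gYX_X i))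
  M0 Cx_gt0 eta0 X_le D0M
  (fun i t w => eq_ind _ (fun z => `|_| <= `|z|) (loss_gap_abs (Dm t) k i w) _ (DmE t i w))
  (fun i s t w => eq_ind _ (fun z => `|_| <= `|z - _|)
     (eq_ind _ (fun z => `|_| <= `|_ - z|) (loss_gap_lip (Dm s) (Dm t) k i w) _ (DmE t i w)) _ (DmE s i w)).
exists B; split => // w Bw D DM.
have [t Dt] := net _ DM.
have close i w' : `|loss_gap D k i w' - loss_gap (Dm t) k i w'| <= eta / 2.
  apply: (le_trans (loss_gap_lip _ _ _ _ _)).
  have -> : xdot (X i w') D k - xdot (X i w') (Dm t) k = xdot (X i w') (D - Dm t) k.
    by rewrite /xdot -sumrB; apply: eq_bigr => j _; rewrite !mxE; ring.
  apply: (le_trans (xdot_bound _ _ (fun j => X_le i j w'))).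
  have -> : eta / 2 = Cx * (eta / (2 * Cx)) by field; rewrite gt_eqF.
  rewrite ler_pM2l//; apply: le_trans Dt; apply: ler_sum => j _.
  by rewrite !mxE.
have close2 i : Ex P (loss_gap D k i) - Ex P (loss_gap (Dm t) k i) <= eta / 2.
  rewrite -ExB; [|exact: bm_loss_gap|exact: bm_loss_gap].
  apply: le_trans (ler_norm _) _; apply: Ex_norm_le => //.
  by apply: bmB; exact: bm_loss_gap.
have H : \sum_i (Ex P (loss_gap (Dm t) k i) - loss_gap (Dm t) k i w) <= n%:R * (2 * eta).
  by rewrite leNgt; apply/negP => /HB.
have -> : n%:R * (3 * eta) = n%:R * (2 * eta) + \sum_(i < n) (eta / 2 + eta / 2).
  by rewrite sumr_const card_ord -[_ *+ n]mulr_natl; field.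
rewrite lerBlDr; apply: le_trans (lerD (lexx _) (lerD H (lexx _))).
rewrite -!big_split /=; apply: ler_sum => i _.
have := close2 i; have := close i w; rewrite ler_norml => /andP[]; lra.
Qed.

Hypothesis c1_gt0 : 0 < c1.
Hypothesis c2_gt0 : 0 < c2.
Hypothesis dt_gt0 : 0 < dt.
Hypothesis q_quantile : forall i k A, <<s gens_X i >> A ->
  P (A `&` [set w | y i w < xdot (X i w) b k]) = ((tau k)%:E * P A)%E.
Hypothesis f_ge0 : forall i x t, 0 <= f i x t.
Hypothesis f_density : forall i A (t : R), <<s gens_X i >> A ->
  P (A `&` [set w | y i w <= t]) =
  (\int[P]_(w in A) \int[lebesgue_measure]_(u in `]-oo, t]) (f i (X i w) u)%:E)%E.
Hypothesis f_at_q : forall i k w, c1 <= f i (X i w) (xdot (X i w) b k).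
Hypothesis f_deriv : forall i w (t : R), derivable (f i (X i w)) t 1 /\
  `|derive1 (f i (X i w)) t| <= c2.
Hypothesis C3_const : forall k, bt <= bk k.
Hypothesis C3 : forall i (D : 'M[R]_(K, p.+1)), cone b D -> forall k,
  bk k * block_norm D k ^+ 2 <= quad_form P (X i) (fun j => D k j) /\
  quad_form P (X i) (fun j => D k j) <= Bk k * block_norm D k ^+ 2.
Hypothesis C4 : forall i k,
  dt <= c1 / (c2 * Num.sqrt (Bk k)) *
    inf [set Ex P (fun w => xdot (X i w) D k ^+ 2) `^ (3 / 2) /
             Ex P (fun w => `|xdot (X i w) D k| ^+ 3)
        | D in [set D | cone b D /\ block_norm D k != 0]].

(** (C4) bounds the cubic moment by the quadratic one, and [1 / 10 - 3 / 40 = 1 / 40] of the latter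
    survives; (C3) converts it into the block norm. *)
Theorem population_lower D k i : cone b D -> block_norm D k < dt ->
  1 / 40 * (c1 * bt) * block_norm D k ^+ 2 <= Ex P (loss_gap D k i).
Proof.
move=> cD Ddt.
have bnorm0 : 0 <= block_norm D k by exact: sqrtr_ge0.
(* The infimum in (C4) ranges over nonzero blocks; for a zero block the loss gap vanishes
   identically. *)
have [D0|D0] := eqVneq (block_norm D k) 0.
  rewrite D0 expr0n mulr0 (_ : loss_gap D k i = fun=> 0) ?Ex_cst//.
  apply/funext => w; apply/eqP; rewrite -normr_le0; apply: le_trans (loss_gap_abs _ _ _ _) _.
  have Dk j : D k j = 0.
    have : `|D k j| <= block_norm D k := vnorm_coord (fun j => D k j) j.
    by rewrite D0 normr_le0 => /eqP.
  by rewrite /xdot big1 ?normr0// => j _; rewrite Dk mulr0.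
set A2 := Ex P (fun w => xdot (X i w) D k ^+ 2).
set A3 := Ex P (fun w => `|xdot (X i w) D k| ^+ 3).
have A20 : 0 <= A2 by apply: Ex_ge0 => w; exact: sqr_ge0.
have A30 : 0 <= A3 by apply: Ex_ge0 => w; exact: exprn_ge0.
have [L U] := C3 i cD k.
have qE := quad_form_Ex P D k (X_meas i) (X_le i).
rewrite qE -/A2 in L U.
have A32 : c2 * A3 <= c1 * A2.
  apply: (moment_ratio c1_gt0 c2_gt0 dt_gt0 A20 A30 bnorm0 Ddt _ _ U (C4 i k)).
    by move=> e [E _ <-]; rewrite divr_ge0 ?powR_ge0//; apply: Ex_ge0 => w; exact: exprn_ge0.
  by exists D.
pose V := Num.max (Cx * \sum_j `|b k j|) (Cx * \sum_j `|D k j|).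
have := @Ex_check_loss_lower R d T P (gens_X i) (y i) (fun w => f i (X i w))
  (fun w => xdot (X i w) b k) (fun w => xdot (X i w) D k) (tau k) c1 c2 V
  (@gens_X_measurable i) (y_meas i) (measurable_xdot b k (@measurable_gX_X i))
  (measurable_xdot D k (@measurable_gX_X i)).
rewrite -/A2 -/A3 -/(loss_gap D k i) => H.
have {}H : 1 / 10 * c1 * A2 - 3 / 40 * c2 * A3 <= Ex P (loss_gap D k i).
  apply: H => //.
  - by move=> w; rewrite le_max xdot_bound.
  - by move=> w; rewrite le_max xdot_bound ?orbT.
  - by move=> A GA; exact: q_quantile.
  - by move=> A t GA; exact: f_density.
apply: le_trans H.
have bA : bt * block_norm D k ^+ 2 <= A2.
  by apply: le_trans L; apply: ler_wpM2r => //; exact: sqr_ge0.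
have : c1 * (bt * block_norm D k ^+ 2) <= c1 * A2 by rewrite ler_pM2l.
by lra.
Qed.

End QuantileModel.

Section Union.
Variables (R : realType) (d : measure_display) (T : measurableType d) (P : probability T R).

Lemma union_bound (I : finType) (B : I -> set T) : (forall i, measurable (B i)) ->
  measurable (\bigcup_(i in [set: I]) B i) /\
  fine (P (\bigcup_(i in [set: I]) B i)) <= \sum_i fine (P (B i)).
Proof.
move=> mB.
have mU : measurable (\bigcup_(i in [set: I]) B i).
  by apply: fin_bigcup_measurable => //; exact: finite_finset.
split=> //; rewrite -Ex_indic//.
rewrite (eq_bigr (fun i => Ex P (\1_(B i)))); last by move=> i _; rewrite Ex_indic.
rewrite -Ex_sum; last by move=> i; exact: bm_indic.
apply: Ex_le; [exact: bm_indic | by apply: bm_sum => i; exact: bm_indic |] => w.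
have ind0 i : 0 <= \1_(B i) w :> R by rewrite indicE; case: (_ \in _).
rewrite [leLHS]indicE; case: (boolP (w \in _)) => [/set_mem[i _ Bi]|_]; last exact: sumr_ge0.
rewrite (bigD1 i)//= indicE (mem_set Bi) lerDl; exact: sumr_ge0.
Qed.

End Union.

(** * Probability rates and comparison of radii *)

Section Rates.
Variable R : realType.

Lemma powRN_expR (p a : R) : 0 < p -> expR (- (a * ln p)) = p `^ (- a).
Proof. by move=> p0; rewrite /powR gt_eqF// mulNr. Qed.

Lemma powR_pred (p a : R) : 0 < p -> p `^ (1 - a) = p * p `^ (- a).
Proof.
by move=> p0; rewrite powRD ?powRr1 ?ltW//; apply/implyP => _; rewrite gt_eqF.
Qed.

(** [4 / 3 * (p + 1) <= 2 * p] holds precisely from [p = 2] on, which is why the slack in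
    [gradient_tail] was tuned to [4 / 3]. *)
Lemma gradient_rate (p : nat) (D2 : R) : (2 <= p)%N ->
  p.+1%:R * (4 / 3 * expR (- (D2 * ln p%:R))) <= 2 * p%:R `^ (1 - D2).
Proof.
move=> p2; have p0 : 0 < p%:R :> R by rewrite ltr0n (leq_trans _ p2).
rewrite powRN_expR// powR_pred// -natr1.
have : 0 <= p%:R `^ (- D2) by exact: powR_ge0.
have : 2 <= p%:R :> R by rewrite (ler_nat _ 2).
by nra.
Qed.

(** The summand [K] in the exponent pays for the union over the levels, since [K <= p ^ K]. *)
Lemma empirical_rate (p K : nat) (D1 : R) : (2 <= p)%N ->
  K%:R * (2 * p.+1%:R * expR (- ((D1 + K%:R) * ln p%:R))) <= 16 * p%:R `^ (1 - D1).
Proof.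
move=> p2; have p0 : 0 < p%:R :> R by rewrite ltr0n (leq_trans _ p2).
have -> : - ((D1 + K%:R) * ln p%:R) = - (D1 * ln p%:R) - K%:R * ln p%:R :> R by ring.
rewrite expRD powRN_expR// powR_pred//.
have KE : K%:R * expR (- (K%:R * ln p%:R)) <= 1 :> R.
  rewrite expRN ler_pdivrMr ?expR_gt0// mul1r expRM_natl lnK ?posrE//.
  rewrite -natrX ler_nat; apply: ltnW; exact: ltn_expl.
have q0 : 0 <= p%:R `^ (- D1) by exact: powR_ge0.
have pge : 2 <= p%:R :> R by rewrite (ler_nat _ 2).
have k0 : 0 <= K%:R * expR (- (K%:R * ln p%:R)) :> R by rewrite mulr_ge0 ?expR_ge0.
rewrite -natr1; move: KE k0; move: (expR _) => e KE k0.
rewrite [leLHS](_ : _ = (2 * (p%:R + 1) * p%:R `^ (- D1)) * (K%:R * e)); last by ring.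
have : 2 * (p%:R + 1) * p%:R `^ (- D1) * (K%:R * e) <= 2 * (p%:R + 1) * p%:R `^ (- D1).
  by rewrite ler_piMr// !mulr_ge0// addr_ge0.
by move: q0; move: (p%:R `^ (- D1)) => z; nra.
Qed.

(* [Cstar] is chosen so that the [deltastar] part of the radius alone absorbs both the
   penalty and the deviation of the empirical loss. *)
Lemma rate_compare (Cx D1 D2 kap L r : R) (K n s : nat) :
  let Cstar := 2 * Cx + (2 * Cx * Num.sqrt (D2 * K%:R) +
    12 * K%:R * Cx * Num.sqrt (8 * (D1 + K%:R))) / D1 in
  let lam := Cx * Num.sqrt (K%:R / n%:R) + 2 * Cx * Num.sqrt (D2 * K%:R * L / n%:R) in
  let eta := 4 * Num.sqrt (s%:R + 1) * r * Cx * Num.sqrt (8 * (D1 + K%:R) * L / n%:R) in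
  (0 < K)%N -> (0 < n)%N -> 0 < Cx -> 0 < D1 -> 0 < D2 -> 0 < L -> 0 < kap -> 0 < r ->
  3 / kap * (8 * Cstar * Num.sqrt ((s%:R + 1) / n%:R) *
    (4 * D1 * Num.sqrt L + Num.sqrt (2 * K%:R))) <= r ->
  lam * (Num.sqrt s%:R * r) < 1 / 40 * kap * r ^+ 2 - K%:R * (3 * eta).
Proof.
move=> Cstar lam eta K0 n0 Cx0 D10 D20 L0 kap0 r0 rge.
have K0' : 0 < K%:R :> R by rewrite ltr0n.
have n0' : 0 < n%:R :> R by rewrite ltr0n.
set a := Num.sqrt ((s%:R + 1) / n%:R) in rge.
have a0 : 0 < a by rewrite sqrtr_gt0 divr_gt0// ltr_wpDl.
pose l := Num.sqrt L; have l0 : 0 < l by rewrite sqrtr_gt0.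
pose e1 := Num.sqrt (K%:R : R); have e10 : 0 < e1 by rewrite sqrtr_gt0.
pose e2 := Num.sqrt (D2 * K%:R); have e20 : 0 <= e2 by exact: sqrtr_ge0.
pose e3 := Num.sqrt (8 * (D1 + K%:R)); have e30 : 0 <= e3 by exact: sqrtr_ge0.
have s_le : s%:R / n%:R <= (s%:R + 1) / n%:R :> R.
  by rewrite ler_pM2r ?invr_gt0// lerDl.
have sn0 : 0 <= s%:R / n%:R :> R by rewrite divr_ge0.
have b1 : Num.sqrt (K%:R / n%:R) * Num.sqrt s%:R <= e1 * a.
  rewrite -sqrtrM ?divr_ge0// (_ : K%:R / n%:R * s%:R = K%:R * (s%:R / n%:R)); last by field; rewrite gt_eqF.
  by rewrite sqrtrM// ler_pM2l//; exact: ler_wsqrtr.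
have b2 : Num.sqrt (D2 * K%:R * L / n%:R) * Num.sqrt s%:R <= e2 * l * a.
  have D2K : 0 <= D2 * K%:R by rewrite mulr_ge0// ltW.
  have D2KL : 0 <= D2 * K%:R * L by rewrite mulr_ge0// ltW.
  rewrite -sqrtrM ?divr_ge0// (_ : _ * s%:R = D2 * K%:R * L * (s%:R / n%:R)); last by field; rewrite gt_eqF.
  rewrite (sqrtrM _ D2KL) (sqrtrM _ D2K) ler_wpM2l ?mulr_ge0 ?sqrtr_ge0//.
  exact: ler_wsqrtr.
have b3 : Num.sqrt (s%:R + 1) * Num.sqrt (8 * (D1 + K%:R) * L / n%:R) = e3 * l * a.
  have DK : 0 <= 8 * (D1 + K%:R) by rewrite mulr_ge0// addr_ge0// ltW.
  have DKL : 0 <= 8 * (D1 + K%:R) * L by rewrite mulr_ge0// ltW.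
  rewrite -sqrtrM ?addr_ge0// (_ : (s%:R + 1) * _ = 8 * (D1 + K%:R) * L * ((s%:R + 1) / n%:R)); last by field; rewrite gt_eqF.
  by rewrite (sqrtrM _ DKL) (sqrtrM _ DK).
have e12 : e1 <= Num.sqrt (2 * K%:R) by apply: ler_wsqrtr; rewrite mulr_natl mulr2n lerDl.
have etaE : eta = 4 * r * Cx * (e3 * l * a) by rewrite /eta -b3; ring.
have Cs : D1 * Cstar = 2 * Cx * D1 + (2 * Cx * e2 + 12 * K%:R * Cx * e3).
  by rewrite /Cstar -/e2 -/e3; field; rewrite gt_eqF.
have CxC : 2 * Cx <= Cstar.
  rewrite /Cstar -/e2 -/e3 lerDl; apply: divr_ge0; last exact: ltW.
  by have Cx0' := ltW Cx0; apply: addr_ge0; rewrite !mulr_ge0.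
have step1 : lam * Num.sqrt s%:R <= Cx * (e1 * a) + 2 * Cx * (e2 * l * a).
  have Cx0' := ltW Cx0.
  rewrite /lam mulrDl -[X in X + _]mulrA -[X in _ + X]mulrA.
  by apply: lerD; apply: ler_wpM2l; rewrite ?mulr_ge0.
(* The 24 is the [3 * 8] of [rge]; against the curvature [1 / 40] it leaves the factor [24 / 40] of
   the next two steps. *)
have step2 : 24 * (Cstar * a * (4 * D1 * l + e1)) <= kap * r.
  move: rge; rewrite mulrAC ler_pdivrMr// [r * kap]mulrC; apply: le_trans.
  rewrite (_ : 3 * (8 * Cstar * a * _) = 24 * (Cstar * a * (4 * D1 * l + Num.sqrt (2 * K%:R)))); last by rewrite -/l; ring.
  rewrite ler_pM2l// ler_wpM2l ?lerD2l//.
  by rewrite mulr_ge0// ?(ltW a0)//; lra.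
(* The summand [2 * Cx] of [Cstar] pays for the part of [lam] without logarithm, strictly as
   [2 * 24 / 40 > 1]. *)
have step3 : Cx * (e1 * a) < 24 / 40 * (Cstar * (e1 * a)).
  have ea : 0 < e1 * a by rewrite mulr_gt0.
  have : 2 * Cx * (e1 * a) <= Cstar * (e1 * a) by rewrite ler_pM2r.
  have : 0 < Cx * (e1 * a) by rewrite mulr_gt0.
  by lra.
(* The quotient by [D1] in [Cstar] meets the factor [4 * D1] and pays for the logarithmic part of
   [lam] and for the empirical deviation. *)
have step4 : 2 * Cx * (e2 * l * a) + K%:R * (3 * (4 * Cx * (e3 * l * a))) <= 24 / 40 * (Cstar * a * (4 * D1 * l)).
  rewrite (_ : Cstar * a * (4 * D1 * l) = 4 * (D1 * Cstar) * (l * a)); last by ring.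
  rewrite Cs (_ : 2 * Cx * (e2 * l * a) + K%:R * (3 * (4 * Cx * (e3 * l * a))) =
    (2 * Cx * e2 + 12 * K%:R * Cx * e3) * (l * a)); last by ring.
  have la : 0 <= l * a by rewrite mulr_ge0// ltW.
  have q1 : 0 <= 2 * Cx * D1 by rewrite !mulr_ge0// ltW.
  have q2 : 0 <= 2 * Cx * e2 + 12 * K%:R * Cx * e3 by have Cx0' := ltW Cx0; rewrite addr_ge0// !mulr_ge0.
  move: q2; move: (2 * Cx * e2 + _) => q q2.
  have : 0 <= q * (l * a) by rewrite mulr_ge0.
  have : 0 <= 2 * Cx * D1 * (l * a) by rewrite mulr_ge0.
  by lra.
have key : lam * Num.sqrt s%:R + K%:R * (3 * (4 * Cx * (e3 * l * a))) < 1 / 40 * (kap * r).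
  have : Cstar * a * (4 * D1 * l + e1) = Cstar * a * (4 * D1 * l) + Cstar * (e1 * a) by ring.
  by lra.
rewrite etaE [lam * _]mulrA ltrBrDr.
have -> : K%:R * (3 * (4 * r * Cx * (e3 * l * a))) = K%:R * (3 * (4 * Cx * (e3 * l * a))) * r by ring.
have -> : 1 / 40 * kap * r ^+ 2 = 1 / 40 * (kap * r) * r by ring.
by rewrite -mulrDl ltr_pM2r.
Qed.

End Rates.

(** * Exceptional events and the bound on the estimation error *)

Theorem theorem1 (R : realType) (K : nat) (tau : 'I_K -> R)
  (Cx c1 c2 bt Bt dt D1 D2 : R) :
  (0 < K)%N ->
  (forall k, 0 < tau k < 1) ->
  (forall k k' : 'I_K, (k < k')%N -> tau k < tau k') ->
  0 < Cx -> 0 < c1 -> 0 < c2 -> 0 < bt -> 0 < Bt -> 0 < dt ->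
  0 < D1 -> 0 < D2 ->
  exists Cstar : R, 0 < Cstar /\
  forall (d : measure_display) (T : measurableType d) (P : probability T R)
    (n p : nat) (y : 'I_n -> T -> R) (X : 'I_n -> T -> 'I_p.+1 -> R)
    (f : 'I_n -> ('I_p.+1 -> R) -> R -> R)
    (betastar : 'M[R]_(K, p.+1)) (b B : 'I_K -> R)
    (betahat : T -> 'M[R]_(K, p.+1)),
  (0 < n)%N -> (2 <= p)%N ->
  (* the sample: measurable, intercept coordinate, i.i.d. *)
  (forall i, measurable_fun setT (y i)) ->
  (forall i j, measurable_fun setT (fun w => X i w j)) ->
  (forall i w, X i w ord0 = 1) ->
  mutually_independent P (sigmaYX y X) ->
  identically_distributed P y X ->
  (* quantile model: P(eps_i^k < 0 | x_i) = tau_k *)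
  (forall i k A, sigmaX X i A ->
     P (A `&` [set w | y i w < xdot (X i w) betastar k]) = ((tau k)%:E * P A)%E) ->
  (* f i (x_i) is the conditional density of y_i given x_i *)
  (forall i (t : R), measurable_fun setT (fun w => f i (X i w) t)) ->
  (forall i x t, 0 <= f i x t) ->
  (forall i A (t : R), sigmaX X i A ->
     P (A `&` [set w | y i w <= t]) =
     (\int[P]_(w in A) \int[lebesgue_measure]_(u in `]-oo, t]) (f i (X i w) u)%:E)%E) ->
  (* (C1) *)
  (forall i k w, c1 <= f i (X i w) (xdot (X i w) betastar k)) ->
  (forall i w (t : R), derivable (f i (X i w)) t 1 /\
                       `|derive1 (f i (X i w)) t| <= c2) ->
  (* (C2) *)
  (forall i j w, `|X i w j| < Cx) ->
  (* (C3) *)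
  (forall k, bt <= b k /\ B k <= Bt /\ 0 < b k) ->
  (forall i (D : 'M[R]_(K, p.+1)), cone betastar D -> forall k,
     b k * block_norm D k ^+ 2 <= quad_form P (X i) (fun j => D k j) /\
     quad_form P (X i) (fun j => D k j) <= B k * block_norm D k ^+ 2) ->
  (* (C4) *)
  (forall i k,
     dt <= c1 / (c2 * Num.sqrt (B k)) *
       inf [set Ex P (fun w => xdot (X i w) D k ^+ 2) `^ (3 / 2) /
                Ex P (fun w => `|xdot (X i w) D k| ^+ 3)
           | D in [set D | cone betastar D /\ block_norm D k != 0]]) ->
  let lam := Cx * Num.sqrt (K%:R / n%:R) +
             2 * Cx * Num.sqrt (D2 * K%:R * ln p%:R / n%:R) in
  let s := #|Sact betastar| in
  let deltastar := 8 * Cstar * Num.sqrt ((s%:R + 1) / n%:R) *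
             (4 * D1 * Num.sqrt (ln p%:R) + Num.sqrt (2 * K%:R)) in
  let bound := 3 / (c1 * bt) *
      (Num.max deltastar (K%:R * Num.sqrt (8 * Bt / n%:R)) + c2 * lam * Num.sqrt s%:R) in
  (forall w, is_minimizer tau lam (fun i => y i w) (fun i => X i w) (betahat w)) ->
  bound < dt ->
  exists E : set T, measurable E /\
    ((1 - 16 * p%:R `^ (1 - D1) - 2 * p%:R `^ (1 - D2))%:E <= P E)%E /\
    forall w, E w -> l2norm (betahat w - betastar) <= bound.
Proof.
move=> K0 tau01 tau_lt Cx0 c10 c20 bt0 Bt0 dt0 D10 D20.
have K0' : 0 < K%:R :> R by rewrite ltr0n.
pose Cstar := 2 * Cx + (2 * Cx * Num.sqrt (D2 * K%:R) +
  12 * K%:R * Cx * Num.sqrt (8 * (D1 + K%:R))) / D1.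
have Cstar0 : 0 < Cstar.
  have Cx0' := ltW Cx0; rewrite /Cstar; apply: ltr_wpDr; last by rewrite mulr_gt0.
  by apply: divr_ge0; [apply: addr_ge0; rewrite !mulr_ge0 ?sqrtr_ge0 | exact: ltW].
exists Cstar; split => //.
move=> d T P n p y X f betastar b B betahat n0 p2 my mX X1 ind _ quant mf f0 fdens fq fder XC C3c C3 C4.
move=> lam s deltastar bound bh_min bdt.
have n0' : 0 < n%:R :> R by rewrite ltr0n.
have p0 : 0 < p%:R :> R by rewrite ltr0n (leq_trans _ p2).
have L0 : 0 < ln p%:R :> R by rewrite ln_gt0// ltr1n.
set L := ln p%:R in L0 *.
have lam0 : 0 < lam.
  rewrite /lam; apply: ltr_pwDl; first by rewrite mulr_gt0// sqrtr_gt0 divr_gt0.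
  by rewrite !mulr_ge0 ?sqrtr_ge0// ltW.
have c1bt : 0 < c1 * bt by rewrite mulr_gt0.
have delta0 : 0 < deltastar.
  apply: mulr_gt0; last first.
    apply: ltr_wpDl; last by rewrite sqrtr_gt0 mulr_gt0.
    by rewrite mulr_ge0 ?sqrtr_ge0// mulr_ge0// ltW.
  by rewrite mulr_gt0 ?sqrtr_gt0 ?divr_gt0 ?ltr_wpDl// mulr_gt0.
have bound_ge : 3 / (c1 * bt) * deltastar <= bound.
  rewrite /bound ler_pM2l ?divr_gt0//.
  apply: (@le_trans _ _ (Num.max deltastar (K%:R * Num.sqrt (8 * Bt / n%:R)))).
    by rewrite le_max lexx.
  by rewrite lerDl !mulr_ge0 ?sqrtr_ge0// ltW.
move: bound bdt bound_ge => r bdt bound_ge.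
have r0 : 0 < r by apply: lt_le_trans bound_ge; rewrite mulr_gt0// divr_gt0.
(* In the cone the group norms sum to at most 1 + 3 times their sum over [Sbar], itself at most
   [sqrt (s + 1) * r]; this bounds the l1 norm of every row. *)
pose M := 4 * (Num.sqrt (s%:R + 1) * r).
have S0 : 0 < Num.sqrt (s%:R + 1) :> R by rewrite sqrtr_gt0 ltr_wpDl.
have M0 : 0 < M by apply: mulr_gt0 => //; exact: mulr_gt0.
(* Solves [n * eta ^+ 2 / (8 * M ^+ 2 * Cx ^+ 2) = (D1 + K) * L], the exponent required by
   [empirical_rate]. *)
pose eta := 4 * Num.sqrt (s%:R + 1) * r * Cx * Num.sqrt (8 * (D1 + K%:R) * L / n%:R).
have DK : 0 < D1 + K%:R by rewrite addr_gt0.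
have eta0 : 0 < eta.
  apply: mulr_gt0; first by do ! apply: mulr_gt0.
  by rewrite sqrtr_gt0 divr_gt0// !mulr_gt0.
have eta_rate : n%:R * (eta ^+ 2 / (8 * M ^+ 2 * Cx ^+ 2)) = (D1 + K%:R) * L.
  have -> : eta = M * Cx * Num.sqrt (8 * (D1 + K%:R) * L / n%:R) by rewrite /eta /M; ring.
  rewrite exprMn sqr_sqrtr; last by rewrite divr_ge0// !mulr_ge0// ltW.
  by field; rewrite !gt_eqF.
have [BE BEP] := choice (fun k => empirical_event betastar tau01 Cx0 my mX XC k M0 eta0 ind).
(* With this [z] the threshold of [gradient_tail] equals [n * lam / 2]. *)
pose z := Num.sqrt (D2 * L).
have z0 : 0 < z by rewrite sqrtr_gt0 mulr_gt0.
have z2 : z ^+ 2 = D2 * L by rewrite sqr_sqrtr// ltW// mulr_gt0.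
have mXdot i k : measurable_fun (setT : set (g_sigma_algebraType (gens_X X i)))
    (fun w => xdot (X i w) betastar k).
  by apply: measurable_xdot => j; exact: measurable_gX_X.
have [BG BGP] := choice (fun j : 'I_p.+1 => @gradient_tail R d T P n K (gens_X X) (gens_YX y X) y
  (fun i w => X i w j) (fun i k w => xdot (X i w) betastar k) tau Cx z n0 K0 Cx0 z0 ind
  (fun i => @gens_YX_measurable R d T n p y X my mX i) (fun i => @gens_XYX R d T n p y X i)
  (fun i => @measurable_gYX_y R d T n p y X i) mXdot (fun i => @measurable_gX_X R d T n p X i j)
  (fun i w => ltW (XC i j w)) tau01 tau_lt quant).
have [mUE PUE] := union_bound P (fun k => let: And3 m _ _ := BEP k in m).
have [mUG PUG] := union_bound P (fun j => let: And3 m _ _ := BGP j in m).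
set UE := \bigcup_(k in _) BE k in mUE PUE.
set UG := \bigcup_(j in _) BG j in mUG PUG.
have mU : measurable (UE `|` UG) by exact: measurableU.
exists (~` (UE `|` UG)); split; first exact: measurableC.
split.
  rewrite probability_setC// -(fineK (fin_num_measure P _ mU)) -EFinB lee_fin.
  have PU : fine (P (UE `|` UG)) <= fine (P UE) + fine (P UG).
    rewrite -fineD ?fin_num_measure// fine_le ?fin_numD ?fin_num_measure//.
    exact: measureU2.
  have H1 : fine (P UE) <= 16 * p%:R `^ (1 - D1).
    apply: (le_trans PUE); apply: le_trans (empirical_rate K D1 p2).
    rewrite mulr_natl -[X in _ *+ X](card_ord K) -sumr_const; apply: ler_sum => k _.
    by have [_ + _] := BEP k; rewrite eta_rate.
  have H2 : fine (P UG) <= 2 * p%:R `^ (1 - D2).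
    apply: (le_trans PUG); apply: le_trans (gradient_rate D2 p2).
    rewrite mulr_natl -[X in _ *+ X](card_ord p.+1) -sumr_const; apply: ler_sum => j _.
    by have [_ + _] := BGP j; rewrite z2.
  by lra.
move=> w /not_orP[nUE nUG].
have nBE k : ~ BE k w by move=> H; apply: nUE; exists k.
have nBG j : ~ BG j w by move=> H; apply: nUG; exists j.
apply: (@minimizer_bound R n K p tau lam (fun i => y i w) (fun i => X i w) betastar n0 lam0 tau01
  _ r (1 / 40 * (c1 * bt) * r ^+ 2 - K%:R * (3 * eta)) (betahat w) r0 (bh_min w)).
- move=> j; rewrite leNgt; apply/negP => H; apply: (nBG j).
  have [_ _ HB] := BGP j; apply: HB; apply: le_lt_trans H.
  rewrite le_eqVlt; apply/orP; left; apply/eqP; rewrite /lam.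
  have nn : n%:R = Num.sqrt (n%:R ^+ 2) :> R by rewrite sqrtr_sqr ger0_norm.
  have E1 : n%:R * Num.sqrt (K%:R / n%:R) = Num.sqrt (n%:R * K%:R) :> R.
    rewrite {1}nn -sqrtrM ?sqr_ge0//; congr Num.sqrt; field; rewrite gt_eqF//.
  have E2 : n%:R * Num.sqrt (D2 * K%:R * L / n%:R) = Num.sqrt (n%:R * K%:R) * z.
    rewrite {1}nn -sqrtrM ?sqr_ge0// -sqrtrM ?mulr_ge0//; congr Num.sqrt.
    by field; rewrite gt_eqF.
  rewrite -/L [RHS](_ : _ = Cx * (n%:R * Num.sqrt (K%:R / n%:R)) / 2 +
    Cx * (n%:R * Num.sqrt (D2 * K%:R * L / n%:R))); last by field.
  by rewrite E1 E2 mulrA.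
- move=> D cD Dr.
  have row k : \sum_j `|D k j| <= M.
    apply: (@le_trans _ _ (\sum_j group_norm D j)).
      apply: ler_sum => j _; rewrite group_normE; exact: (vnorm_coord (fun k => D k j)).
    rewrite (bigID (mem (Sbar betastar))) /=.
    have := Sbar_sum_le betastar D; rewrite Dr -/s.
    have := cD; rewrite /cone /=.
    rewrite [X in X <= 3 * _](eq_bigl (fun j => j \notin Sbar betastar)); last first.
      by move=> j; rewrite finset.in_setC.
    by rewrite /M; lra.
  have H k := (let: And3 _ _ h := BEP k in h) w (nBE k) D (row k).
  rewrite -sumrB; under eq_bigr do rewrite -sumrB.
  apply: (@le_trans _ _ (\sum_k (\sum_i Ex P (loss_gap tau y X betastar D k i) - n%:R * (3 * eta)))).
    rewrite big_split /= sumr_const card_ord mulrBr.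
    apply: lerD; last by rewrite -mulr_natl -mulrN le_eqVlt; apply/orP; left; apply/eqP; ring.
    have -> : n%:R * (1 / 40 * (c1 * bt) * r ^+ 2) =
        \sum_(k < K) \sum_(i < n) 1 / 40 * (c1 * bt) * block_norm D k ^+ 2.
      rewrite -Dr.
      have -> : l2norm D ^+ 2 = \sum_k block_norm D k ^+ 2.
        rewrite sqr_sqrtr; last by apply: sumr_ge0 => k _; exact: (sumsq_ge0 (fun j => D k j)).
        by apply: eq_bigr => k _; rewrite -(vnorm_sq (fun j => D k j)).
      rewrite !mulr_sumr; apply: eq_bigr => k _.
      by rewrite sumr_const card_ord mulr_natl.
    apply: ler_sum => k _; apply: ler_sum => i _.
    apply: (@population_lower R d T P K n p tau Cx c1 c2 bt dt y X f betastar b B) => //.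
      by move=> k'; case: (C3c k').
    (* Each block norm is at most the full norm [r], which lies below [dt]. *)
    apply: le_lt_trans bdt; rewrite -Dr; apply: ler_wsqrtr.
    rewrite [leRHS](bigD1 k)//= lerDl; apply: sumr_ge0 => k' _.
    exact: (sumsq_ge0 (fun j => D k' j)).
  apply: ler_sum => k _; apply: (le_trans (H k)).
  apply: ler_sum => i _; rewrite /loss_gap.
  rewrite le_eqVlt; apply/orP; left; apply/eqP; congr (_ - _); congr check_loss.
  by rewrite xdotD; ring.
- exact: rate_compare.
Qed.
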